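(* The implied constants below can be chosen (those in $\lesssim_d,\gtrsim_d,\asymp_d$ depending only on $d$, those in $\lesssim,\asymp$ absolute) so that the following holds. Suppose we are given noisy samples of $\tilde y=y+\eta$ on $X_\star=\{-2m,\dots,2m\}^d$ with $d\ge2$ and $m\ge1$ integers, where $y(x)=\sum_{\ell=1}^sa_\ell e^{2\pi i\theta_\ell\cdot x}$ with $a_\ell\in\mathbb C\setminus\{0\}$ and $\min_\ell|a_\ell|=1$, and suppose $\vartheta=\{\theta_\ell\}_{\ell=1}^s\subset\mathbb T^d$, $s\ge1$, satisfies $\Delta(\vartheta)\gtrsim_dm^{-1}$. Choose a grid $G\subset\mathbb T^d$, a threshold $\alpha_1$ and a step size $h$ with $\mathrm{mesh}(G)\asymp_dm^{-1}$, $\alpha_1\asymp_d1$, $h\asymp m^{-2}$. Then: (a) (Adversarial noise) Suppose that for some $p\in[1,\infty]$, $\|\eta\|_{\ell^p(X_\star)}\lesssim m^{d/p}/|a|_\infty$. Then $\tilde U$ is well-defined as the leading $s$-dimensional left singular space of $H(\tilde y)$. Let $\{\theta_\ell^\sharp\}_{\ell=1}^s$ denote the $n$-th iterate of Gradient-MUSIC, where $n\asymp\log\big(m^{d/p}/\|\eta\|_{\ell^p(X_\star)}\big)$. Then $$\max_{\ell=1,\dots,s}|\theta_\ell-\theta_\ell^\sharp|\lesssim_d\frac{\|\eta\|_{\ell^p(X_\star)}}{m^{1+d/p}}.$$ (b) (Random noise) Suppose $\eta=\sigma g$, where the values of $g$ on $X_\star$ are i.i.d. standard normal $\mathcal N(0,1)$,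 and $\sigma:\mathbb R^d\to[0,\infty)$ satisfies $\|\sigma\|_{\ell^2(X_\star)}\lesssim_d\frac{m^d}{|a|_\infty\sqrt{\log m}}$. Then $\tilde U$ is well-defined as the leading $s$-dimensional left singular space of $H(\tilde y)$. Let $\{\theta_\ell^\sharp\}_{\ell=1}^s$ denote the $n$-th iterate of Gradient-MUSIC, where $n\asymp\log\Big(\frac{m^d}{\|\sigma\|_{\ell^2(X_\star)}\sqrt{\log m}}\Big)$. Then, with probability at least $1-m^{-d}$, $$\max_{\ell=1,\dots,s}|\theta_\ell-\theta_\ell^\sharp|\lesssim_d\frac{\|\sigma\|_{\ell^2(X_\star)}\sqrt{\log m}}{m^{d+1}}.$$
   Context: Notation. $\mathbb T^d=(\mathbb R/\mathbb Z)^d$ with $|\omega|=\min_{n\in\mathbb Z^d}|\omega+n|$ (Euclidean norm); $\Delta(\vartheta)=\min_{j\ne k}|\theta_j-\theta_k|$; $|a|_\infty=\max_\ell|a_\ell|$. $x\lesssim y$ means $x\le Cy$ with $C>0$ an absolute constant, $x\asymp y$ means $x\lesssim y\lesssim x$; a subscript $d$ means the constant may depend on $d$ only. When such a relation appears as a hypothesis or as a parameter choice it means: for a suitable choice of the implied constant(s); when it appears as a conclusion it means: for some constant. Complex normal: $z\sim\mathcal N(0,1)$ means $\Re z,\Im z$ are independent real Gaussians with mean $0$ and variance $1/2$. Subspace. Let $X=\{-m,\dots,m\}^d$ with counting measure, ordered as $x^{(1)},x^{(2)},\dots$. $H(\tilde y)$ is the multilevel Hankel matrix $H(\tilde y)_{j,k}=\tilde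 y(x^{(j)}+x^{(k)})$, acting on $\ell^2(X)$. Its leading $s$-dimensional left singular space $\tilde U\subset\ell^2(X)$ (span of the left singular vectors of the $s$ largest singular values) is well-defined when $\sigma_s(H(\tilde y))>\sigma_{s+1}(H(\tilde y))$. MUSIC function. $\phi_\omega(x)=(2m+1)^{-d/2}e^{2\pi i\omega\cdot x}$, $x\in X$; $\tilde q(\omega)=\|(I-P_{\tilde U})\phi_\omega\|_{\ell^2(X)}^2$ for $\omega\in\mathbb T^d$, $P_{\tilde U}$ the orthogonal projection onto $\tilde U$. Mesh norm. For finite $G\subset\mathbb T^d$, $\mathrm{mesh}(G)=\max_{\omega\in\mathbb T^d}\min_{\omega_0\in G}|\omega-\omega_0|$. Gradient-MUSIC (input $P_{\tilde U}$; parameters: grid $G$, threshold $\alpha_1$, step size $h$, number of iterations $n$). Step 1: evaluate $\tilde q$ on $G$, let $G_1=\{\omega\in G:\tilde q(\omega)\le\alpha_1\}$, identify the connected clusters of $G_1$, and select one representative from each cluster, denoted $\theta_{1,0},\dots,\theta_{s,0}$. Step 2: for each $\ell$, run $\theta_{\ell,k+1}=\theta_{\ell,k}-h\nabla\tilde q(\theta_{\ell,k})$, $k=0,\dots,n-1$. Output (the $n$-th iterate): $\theta_\ell^\sharp=\theta_{\ell,n}$, $\ell=1,\dots,s$. The outputs are indexed so as to best match $\{\theta_\ell\}$, i.e. the error is the minimum over permutations of the maximal distance.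
   Formalization: In (b), that the singular space is well-defined is asserted only with probability at least 1−m^{-d} (it fails with positive probability, e.g. s=1 and σ supported at 0), and the bound on ‖σ‖ is multiplied out by |a|_∞√log m since log m = 0 at m = 1. *)

(* Defs.v *)
From HB Require Import structures.
From mathcomp Require Import all_boot all_order all_algebra finmap.
From mathcomp Require Import perm spectral complex.
From mathcomp Require Import all_classical all_reals all_analysis.

Set Implicit Arguments.
Unset Strict Implicit.
Unset Printing Implicit Defensive.

Import Order.TTheory GRing.Theory Num.Theory.
Import numFieldNormedType.Exports.

Local Open Scope classical_set_scope.
Local Open Scope ring_scope.

(* A point of T^d is given by any of its representatives in 'rV[R]_d; distances
   are taken modulo Z^d, and every function of a point of T^d used below is
   Z^d-periodic. *)
Section Torus.
Variables (R : realType) (d : nat).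
Implicit Types (w : 'rV[R]_d) (G : {fset 'rV[R]_d}).

(* The norm that the library puts on 'rV[R]_d is the sup norm. *)
Definition euclidean_norm w : R := Num.sqrt (\sum_(i < d) w 0 i ^+ 2).

Definition torus_norm w : R :=
  inf [set euclidean_norm (w + map_mx intr z) | z in [set: 'rV[int]_d]].

Definition torus_dist w w' : R := torus_norm (w - w').

(* Equal to +oo when s = 1. *)
Definition separation (s : nat) (theta : 'I_s -> 'rV[R]_d) : \bar R :=
  ereal_inf [set r | exists j k : 'I_s,
    j != k /\ r = (torus_dist (theta j) (theta k))%:E].

(* Equal to 0 when G is empty. *)
Definition mesh G : R :=
  sup [set inf [set torus_dist w w0 | w0 in [set` G]] | w in [set: 'rV[R]_d]].

Definition gradient (q : 'rV[R]_d -> R) w : 'rV[R]_d :=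
  \row_i 'D_(delta_mx 0 i) q w.

End Torus.

(* Indexes the points of {-m,...,m}^d, through cube_pt. *)
Definition cube (m d : nat) := {ffun 'I_d -> 'I_(2 * m).+1}.

Definition cube_pt (m d : nat) (x : cube m d) : 'rV[int]_d :=
  \row_i ((x i : nat)%:Z - m%:Z).

Section Signal.
Variables (R : realType) (d : nat).

Definition cabs (z : R[i]) : R := complex.Re `|z|.

Definition cexp (t : R) : R[i] :=
  Complex (cos (2 * pi * t)) (sin (2 * pi * t)).

Definition inner (w : 'rV[R]_d) (x : 'rV[int]_d) : R :=
  \sum_(i < d) w 0 i * (x 0 i)%:~R.

Definition exp_sum (s : nat) (a : 'I_s -> R[i]) (theta : 'I_s -> 'rV[R]_d)
    (x : 'rV[int]_d) : R[i] :=
  \sum_(l < s) a l * cexp (inner (theta l) x).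

Definition max_abs (s : nat) (a : 'I_s -> R[i]) : R :=
  \big[Num.max/0]_(l < s) cabs (a l).

(* The norm of the restriction of f to {-m,...,m}^d, for 1 <= p <= +oo. *)
Definition lp_norm (m : nat) (p : \bar R) (f : 'rV[int]_d -> R[i]) : R :=
  match p with
  | r%:E => (\sum_(x : cube m d) cabs (f (cube_pt x)) `^ r) `^ r^-1
  | _ => \big[Num.max/0]_(x : cube m d) cabs (f (cube_pt x))
  end.

(* m^(d/p), equal to 1 when p = +oo. *)
Definition size_pow (m : nat) (p : \bar R) : R :=
  m%:R `^ (d%:R * fine (p^-1)%E).

End Signal.

Section SingularValues.
Local Open Scope sesquilinear_scope.
Variables (R : realType) (N : nat).
Implicit Types (A U V : 'M[R[i]]_N) (S : 'rV[R]_N).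

Definition is_svd A U S V : Prop :=
  [/\ U \is unitarymx, V \is unitarymx,
      forall k, 0 <= S 0 k,
      forall j k : 'I_N, (j <= k)%N -> S 0 k <= S 0 j &
      A = U *m diag_mx (map_mx (fun r => Complex r 0) S) *m V ^t*].

Definition singular_values A : 'rV[R]_N :=
  xget 0 [set S | exists U V, is_svd A U S V].

(* The k-th largest singular value, k >= 1; it is 0 for k > N. *)
Definition sigma A (k : nat) : R :=
  [seq singular_values A 0 i | i <- enum 'I_N]`_k.-1.

(* As a row space: the left singular vectors are the columns of U. The value
   does not depend on the chosen decomposition when
   sigma A s.+1 < sigma A s. *)
Definition leading_left_space A (s : nat) : 'M[R[i]]_N :=
  xget 0 [set W | exists U S V,
    is_svd A U S V /\ W = (<<(pid_mx s : 'M[R[i]]_N) *m U^T>>)%MS].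

End SingularValues.

Section Music.
Variables (R : realType) (d m : nat).

Definition hankel (yt : 'rV[int]_d -> R[i]) : 'M[R[i]]_#|{: cube m d}| :=
  \matrix_(j, k) yt (cube_pt (enum_val j) + cube_pt (enum_val k)).

Definition steering (w : 'rV[R]_d) : 'rV[R[i]]_#|{: cube m d}| :=
  \row_j (Complex (Num.sqrt ((2 * m).+1%:R ^+ d))^-1 0
            * cexp (inner w (cube_pt (enum_val j)))).

Definition music (W : 'M[R[i]]_#|{: cube m d}|) (w : 'rV[R]_d) : R :=
  \sum_j cabs ((steering w - steering w *m proj_ortho W) 0 j) ^+ 2.

End Music.

Section GradientMusic.
Variables (R : realType) (d : nat).
Variables (q : 'rV[R]_d -> R) (G : {fset 'rV[R]_d}) (alpha1 h : R) (n : nat).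

Definition accepted : {fset 'rV[R]_d} := [fset w in G | q w <= alpha1]%fset.

(* Two points of the grid are adjacent when the balls of radius mesh G around
   them meet: a connected cluster is the trace on the grid of a connected
   component of the thickening of accepted by the resolution of the grid. *)
Definition adjacent : rel accepted :=
  fun u v => torus_dist (val u) (val v) <= 2 * mesh G.

Definition clusters : {set {set accepted}} :=
  equivalence_partition (connect adjacent) [set: accepted]%SET.

Definition cluster_representatives (rep : seq accepted) : Prop :=
  uniq rep /\ is_transversal [set:: rep]%SET clusters [set: accepted]%SET.

Definition gradient_step (w : 'rV[R]_d) : 'rV[R]_d := w - h *: gradient q w.

(* Any choice of representatives is allowed; out has one point per cluster. *)
Definition gradient_music_output (out : seq 'rV[R]_d) : Prop :=
  exists rep : seq accepted,
    cluster_representatives rep /\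
    out = [seq iter n gradient_step (val u) | u <- rep].

End GradientMusic.

(* out consists of s points which, in the best ordering, approximate theta up
   to err. *)
Definition matches_within (R : realType) (d s : nat)
    (theta : 'I_s -> 'rV[R]_d) (out : seq 'rV[R]_d) (err : R) : Prop :=
  size out = s /\
  exists tau : {perm 'I_s}, forall l, torus_dist (theta l) out`_(tau l) <= err.

(* With n1 and n2 the constants in n1 * L <= n <= n2 * L and L >= ln c^-1, this
   ensures that such an integer n exists. *)
Definition iteration_constants (R : realType) (c n1 n2 : R) : Prop :=
  [/\ 0 < n1, n1 < n2 & 1 <= (n2 - n1) * ln c^-1].

Section Gaussian.
Local Open Scope ereal_scope.
Context (R : realType) (dO : measure_display) (Om : measurableType dO).
Variable (P : probability Om R).

Definition mutually_independent (I : finType) (dT : measure_display)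
    (T : measurableType dT) (X : I -> Om -> T) : Prop :=
  forall (J : {set I}) (B : I -> set T), (forall i, measurable (B i)) ->
    P (\bigcap_(i in [set i | i \in J]) (X i @^-1` B i)) =
    \prod_(i in J) P (X i @^-1` B i).

Definition has_normal_law (X : Om -> R) (mean variance : R) : Prop :=
  measurable_fun [set: Om] X /\
  forall B : set R, measurable B ->
    P (X @^-1` B) = normal_prob mean (Num.sqrt variance) B.

Definition standard_complex_normal (Z : Om -> R[i]) : Prop :=
  [/\ has_normal_law (fun t => complex.Re (Z t)) 0%R 2^-1%R,
      has_normal_law (fun t => complex.Im (Z t)) 0%R 2^-1%R &
      mutually_independent
        (fun (b : bool) t => if b then complex.Im (Z t) else complex.Re (Z t))].

(* Independence of complex variables is that of the R * R-valued ones. *)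
Definition iid_standard_complex_normal (I : finType) (g : I -> Om -> R[i])
    : Prop :=
  (forall i, standard_complex_normal (g i)) /\
  mutually_independent
    (fun i t => (complex.Re (g i t), complex.Im (g i t)) : (R * R)%type).

Definition with_probability_at_least (r : R) (E : Om -> Prop) : Prop :=
  exists A : set Om,
    [/\ measurable A, r%:E <= P A & forall t, A t -> E t].

End Gaussian.

(* Main.v *)
(* Without noise the Hankel matrix is [N Phi^T diag(a) Phi], where the rows of [Phi]
   are the steering vectors of the sources and [N = (2m+1)^d]. Separation bounds the
   Gram matrix of [Phi] below by 1/2, so that the [s]-th singular value is at least
   [N/2] and noise of operator norm [nu N] turns the signal space by O(nu) only.
   Within O(1/m) of a source, the gradient of the MUSIC function is that of a
   quadratic form of curvature of order [m^2], up to O(nu m): gradient descent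
   contracts to within O(nu/m) of the source. A point where the MUSIC function is
   small lies near a source, and each accepted grid point descends through
   neighbouring grid points to within one mesh of its source, so that clusters
   correspond to sources.
   It remains to bound the norm of the Hankel matrix of the noise: by the Schur test
   and the power mean inequality in the adversarial case; in the Gaussian case by the
   largest value of its discrete Fourier transform on (Z/(4m+1))^d, through Chernoff
   bounds and a union bound. *)
Require Import Defs.
From HB Require Import structures.
From mathcomp Require Import all_boot all_order all_algebra finmap.
From mathcomp Require Import perm spectral complex.
From mathcomp Require Import all_classical all_reals all_analysis.
From mathcomp Require Import measurable_realfun.
From mathcomp Require Import ring lra zify.
Import Order.TTheory GRing.Theory Num.Theory.
Import numFieldNormedType.Exports.
Set Implicit Arguments.
Unset Strict Implicit.
Unset Printing Implicit Defensive.
Local Open Scope classical_set_scope.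
Local Open Scope ring_scope.
Local Notation Re := complex.Re.
Local Notation Im := complex.Im.

(** Two obstacles shape the estimates. First, step size and number of iterations must not depend on
    [d]. Near a source all errors are therefore measured in [r = m |e|] with absolute constants:
    [13/2] as Lipschitz constant of the steering vectors, [1/64] as radius of the linear regime,
    [7/8] as contraction factor. The dimension is absorbed by the separation, the mesh and the
    Gaussian constants. Second, inner products of steering vectors decay only like [1/(m |t|)] in
    each coordinate, and such products have no bounded sum over separated points; their squares do.
    Where squares of inner products occur, as in the interference of the other sources with the
    gradient, this is enough. In the Gram matrix they occur to the first power, and the square has
    to be produced by averaging over subcubes. In the clustering, the grid is arbitrary and noise
    spoils the monotonicity of the MUSIC function at distances of order [nu/m] from a source. The
    descent along the grid thus has two potentials: the MUSIC function far from the source, and the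
    distance to it close by, where every grid point is accepted. *)

Section ComplexNumbers.
Variable R : realType.
Implicit Types (x y z : R[i]) (t : R).

Definition rc t : R[i] := Complex t 0.

Lemma conjCE z : z^* = Complex (Re z) (- Im z).
Proof. by case: z. Qed.

Lemma ReD x y : Re (x + y) = Re x + Re y. Proof. by case: x; case: y. Qed.
Lemma ImD x y : Im (x + y) = Im x + Im y. Proof. by case: x; case: y. Qed.
Lemma ReN x : Re (- x) = - Re x. Proof. by case: x. Qed.
Lemma ReM x y : Re (x * y) = Re x * Re y - Im x * Im y.
Proof. by case: x; case: y. Qed.
Lemma ImM x y : Im (x * y) = Re x * Im y + Im x * Re y.
Proof. by case: x => a b; case: y => c e /=; ring. Qed.

Lemma Re_sum I (r : seq I) (P : pred I) (F : I -> R[i]) :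
  Re (\sum_(i <- r | P i) F i) = \sum_(i <- r | P i) Re (F i).
Proof. by elim/big_rec2: _ => // i a b _ <-; rewrite ReD. Qed.

Lemma Im_sum I (r : seq I) (P : pred I) (F : I -> R[i]) :
  Im (\sum_(i <- r | P i) F i) = \sum_(i <- r | P i) Im (F i).
Proof. by elim/big_rec2: _ => // i a b _ <-; rewrite ImD. Qed.

Lemma cabsE z : cabs z = Num.sqrt (Re z ^+ 2 + Im z ^+ 2).
Proof. by rewrite /cabs normc_def. Qed.

Lemma normE z : `|z| = rc (cabs z).
Proof. by rewrite normc_def cabsE. Qed.

Lemma cabs_ge0 z : 0 <= cabs z. Proof. by rewrite cabsE sqrtr_ge0. Qed.

Lemma cabs2 z : cabs z ^+ 2 = Re z ^+ 2 + Im z ^+ 2.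
Proof. by rewrite cabsE sqr_sqrtr ?addr_ge0 ?sqr_ge0. Qed.

Lemma cabsM x y : cabs (x * y) = cabs x * cabs y.
Proof. by rewrite /cabs normrM !normE /= mulr0 subr0. Qed.

Lemma cabsN x : cabs (- x) = cabs x. Proof. by rewrite /cabs normrN. Qed.

Lemma cabsD x y : cabs (x + y) <= cabs x + cabs y.
Proof.
have := ler_normD x y; rewrite !normE lecE /= => /andP[_].
exact.
Qed.

Lemma cabsB x y : cabs (x - y) <= cabs x + cabs y.
Proof. by rewrite (le_trans (cabsD _ _)) // cabsN. Qed.

Lemma cabs0 : cabs (0 : R[i]) = 0. Proof. by rewrite /cabs normr0. Qed.
Lemma cabs1 : cabs (1 : R[i]) = 1. Proof. by rewrite /cabs normr1. Qed.

Lemma cabs_eq0 z : (cabs z == 0) = (z == 0).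
Proof.
by rewrite -[RHS]normr_eq0 normE eq_complex /= eqxx andbT.
Qed.

Lemma cabsJ z : cabs z^* = cabs z.
Proof. by rewrite !cabsE conjCE /= sqrrN. Qed.

Lemma cabs_rc t : cabs (rc t) = `|t|.
Proof. by rewrite cabsE /= expr0n /= addr0 sqrtr_sqr. Qed.

Lemma cabsX z n : cabs (z ^+ n) = cabs z ^+ n.
Proof. by elim: n => [|n IH]; rewrite ?expr0 ?cabs1 // !exprS cabsM IH. Qed.

Lemma cabs_sum I (r : seq I) (P : pred I) (F : I -> R[i]) :
  cabs (\sum_(i <- r | P i) F i) <= \sum_(i <- r | P i) cabs (F i).
Proof.
elim/big_rec2: _ => [|i a b _ ih]; first by rewrite cabs0.
by rewrite (le_trans (cabsD _ _)) // lerD2l.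
Qed.

Lemma cabs_prod I (r : seq I) (P : pred I) (F : I -> R[i]) :
  cabs (\prod_(i <- r | P i) F i) = \prod_(i <- r | P i) cabs (F i).
Proof.
by elim/big_rec2: _ => [|i a b _ <-]; rewrite ?cabs1 // cabsM.
Qed.

Lemma Re_le_cabs z : `|Re z| <= cabs z.
Proof. by rewrite cabsE -sqrtr_sqr ler_wsqrtr // lerDl sqr_ge0. Qed.

Lemma Re_lec z : Re z <= cabs z.
Proof. by rewrite (le_trans (ler_norm _)) // Re_le_cabs. Qed.

Lemma cabs_le_ReIm z : cabs z <= `|Re z| + `|Im z|.
Proof.
rewrite -(@ler_pXn2r _ 2) ?nnegrE ?cabs_ge0 ?addr_ge0 // cabs2 sqrrD.
rewrite !real_normK ?num_real //.
by have := mulr_ge0 (normr_ge0 (Re z)) (normr_ge0 (Im z)); lra.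
Qed.

Lemma rcM s t : rc (s * t) = rc s * rc t.
Proof. by apply/eqP; rewrite eq_complex /= !mulr0 !mul0r subr0 addr0 !eqxx. Qed.
Lemma rcD s t : rc (s + t) = rc s + rc t.
Proof. by apply/eqP; rewrite eq_complex /= !addr0 !eqxx. Qed.

Lemma Re_rcM t z : Re (rc t * z) = t * Re z.
Proof. by rewrite ReM /= mul0r subr0. Qed.
Lemma Im_rcM t z : Im (rc t * z) = t * Im z.
Proof. by rewrite ImM /= mul0r addr0. Qed.

Lemma mulcJ z : z * z^* = rc (cabs z ^+ 2).
Proof.
rewrite cabs2 conjCE; case: z => a b; apply/eqP; rewrite eq_complex /=.
by apply/andP; split; apply/eqP; ring.
Qed.

Lemma rc_nat n : rc n%:R = n%:R.
Proof.
elim: n => [|n IH]; first by rewrite !mulr0n.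
by rewrite -natr1 rcD IH -natr1.
Qed.

End ComplexNumbers.

(** * Complex rows as a Hilbert space *)

Section Hilbert.
Variables (R : realType) (n : nat).
Implicit Types (u v w x y : 'rV[R[i]]_n) (t : R) (c : R[i]).

Definition hd u v : R[i] := \sum_j u 0 j * (v 0 j)^*.
(** The real part makes the complex rows a real Euclidean space with the same norm, and most
    estimates only need that structure. *)
Definition ip u v : R := Re (hd u v).
Definition nrm u : R := Num.sqrt (ip u u).

Lemma hdE u v : hd u v = (u *m map_mx Num.conj v^T) 0 0.
Proof. by rewrite /hd mxE; apply: eq_bigr => j _; rewrite !mxE. Qed.

Lemma hdDl u v w : hd (u + v) w = hd u w + hd v w.
Proof. by rewrite /hd -big_split; apply: eq_bigr => j _; rewrite mxE mulrDl. Qed.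
Lemma hdNl u w : hd (- u) w = - hd u w.
Proof. by rewrite /hd -sumrN; apply: eq_bigr => j _; rewrite mxE mulNr. Qed.
Lemma hdZl c u w : hd (c *: u) w = c * hd u w.
Proof. by rewrite /hd mulr_sumr; apply: eq_bigr => j _; rewrite mxE mulrA. Qed.
Lemma hd_conj u v : hd v u = (hd u v)^*.
Proof.
rewrite /hd rmorph_sum; apply: eq_bigr => j _.
by rewrite rmorphM /= conjCK mulrC.
Qed.
Lemma hdBl u v w : hd (u - v) w = hd u w - hd v w.
Proof. by rewrite hdDl hdNl. Qed.
Lemma hdDr u v w : hd w (u + v) = hd w u + hd w v.
Proof. by rewrite hd_conj hdDl rmorphD /= -!hd_conj. Qed.
Lemma hdZr c u w : hd w (c *: u) = c^* * hd w u.
Proof. by rewrite hd_conj hdZl rmorphM /= -!hd_conj. Qed.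
Lemma hd0l u : hd 0 u = 0.
Proof. by rewrite /hd big1 // => j _; rewrite mxE mul0r. Qed.
Lemma hd0r u : hd u 0 = 0.
Proof. by rewrite hd_conj hd0l rmorph0. Qed.
Lemma hd_sumr I (r : seq I) (P : pred I) (F : I -> 'rV[R[i]]_n) w :
  hd w (\sum_(i <- r | P i) F i) = \sum_(i <- r | P i) hd w (F i).
Proof. by elim/big_rec2: _ => [|i a b _ <-]; rewrite ?hd0r // hdDr. Qed.

Lemma hd_self u : hd u u = rc (\sum_j cabs (u 0 j) ^+ 2).
Proof.
rewrite /hd; elim/big_rec2: _ => [|i a b _ ->]; first by [].
by rewrite mulcJ -rcD.
Qed.

Lemma ip_self u : ip u u = \sum_j cabs (u 0 j) ^+ 2.
Proof. by rewrite /ip hd_self. Qed.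

Lemma ip_ge0 u : 0 <= ip u u.
Proof. by rewrite ip_self sumr_ge0 // => j _; rewrite sqr_ge0. Qed.

Lemma nrm_ge0 u : 0 <= nrm u. Proof. exact: sqrtr_ge0. Qed.
Lemma nrm2 u : nrm u ^+ 2 = ip u u.
Proof. by rewrite sqr_sqrtr ?ip_ge0. Qed.

Lemma ipC u v : ip u v = ip v u.
Proof. by rewrite /ip hd_conj conjCE. Qed.
Lemma ipDl u v w : ip (u + v) w = ip u w + ip v w.
Proof. by rewrite /ip hdDl ReD. Qed.
Lemma ipNl u w : ip (- u) w = - ip u w.
Proof. by rewrite /ip hdNl ReN. Qed.
Lemma ipBl u v w : ip (u - v) w = ip u w - ip v w.
Proof. by rewrite ipDl ipNl. Qed.
Lemma ipDr u v w : ip w (u + v) = ip w u + ip w v.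
Proof. by rewrite ![ip w _]ipC ipDl. Qed.
Lemma ipNr u w : ip w (- u) = - ip w u.
Proof. by rewrite ![ip w _]ipC ipNl. Qed.
Lemma ipBr u v w : ip w (u - v) = ip w u - ip w v.
Proof. by rewrite ipDr ipNr. Qed.
Lemma ip0l u : ip 0 u = 0. Proof. by rewrite /ip hd0l. Qed.
Lemma ipZl t u w : ip (rc t *: u) w = t * ip u w.
Proof. by rewrite /ip hdZl Re_rcM. Qed.
Lemma ipZr t u w : ip w (rc t *: u) = t * ip w u.
Proof. by rewrite ipC ipZl ipC. Qed.

Lemma nrmZ c u : nrm (c *: u) = cabs c * nrm u.
Proof.
rewrite /nrm /ip hdZl hdZr mulrA mulcJ Re_rcM sqrtrM ?sqr_ge0 //.
by rewrite sqrtr_sqr ger0_norm ?cabs_ge0.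
Qed.

Lemma nrm0 : nrm 0 = 0. Proof. by rewrite /nrm ip0l sqrtr0. Qed.
Lemma nrmN u : nrm (- u) = nrm u.
Proof. by rewrite /nrm ipNl ipNr opprK. Qed.

Lemma nrm_eq0 u : nrm u = 0 -> u = 0.
Proof.
move=> u0; have : ip u u = 0 by rewrite -nrm2 u0 expr0n.
rewrite ip_self => /eqP; rewrite psumr_eq0 => [/allP u00|j _]; last first.
  exact: sqr_ge0.
apply/rowP => j; rewrite mxE; apply/eqP; rewrite -cabs_eq0.
by have := u00 j (mem_index_enum _); rewrite expf_eq0 /=.
Qed.

Lemma cauchy_schwarz u v : `|ip u v| <= nrm u * nrm v.
Proof.
have [/nrm_eq0 ->|u0] := eqVneq (nrm u) 0; first by rewrite ip0l normr0 nrm0 mul0r.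
have up : 0 < nrm u by rewrite lt_def u0 nrm_ge0.
rewrite -(@ler_pXn2r _ 2) ?nnegrE ?mulr_ge0 ?nrm_ge0 // real_normK ?num_real //.
have := ip_ge0 (v - rc (ip u v / nrm u ^+ 2) *: u).
rewrite ipBl !ipBr ipZl !ipZr ipZl [ip v u]ipC -!nrm2.
set a := ip u v; set b := nrm u; set c := nrm v => h.
rewrite exprMn -ler_pdivrMl ?exprn_gt0 //.
have e : a / b ^+ 2 * (a / b ^+ 2 * b ^+ 2) = a / b ^+ 2 * a.
  by rewrite divfK // expf_neq0.
rewrite e in h.
have -> : (b ^+ 2)^-1 * a ^+ 2 = a / b ^+ 2 * a by rewrite expr2; ring.
lra.
Qed.

Lemma ip_le u v : ip u v <= nrm u * nrm v.
Proof. by rewrite (le_trans (ler_norm _)) // cauchy_schwarz. Qed.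

Lemma hd_le u v : cabs (hd u v) <= nrm u * nrm v.
Proof.
have [h0|h0] := eqVneq (cabs (hd u v)) 0.
  by rewrite h0 mulr_ge0 ?nrm_ge0.
have hp : 0 < cabs (hd u v) by rewrite lt_def h0 cabs_ge0.
(* Scaling [v] by [hd u v] makes the Hermitian product real and nonnegative, so that the real
   inequality yields the complex one. *)
have := ip_le u (hd u v *: v).
rewrite nrmZ /ip hdZr mulrC mulcJ /= expr2 mulrCA.
by rewrite ler_pM2l.
Qed.

Lemma nrmD u v : nrm (u + v) <= nrm u + nrm v.
Proof.
rewrite -(@ler_pXn2r _ 2) ?nnegrE ?addr_ge0 ?nrm_ge0 // nrm2 sqrrD !nrm2.
rewrite ipDl !ipDr [ip v u]ipC.
by have := ip_le u v; lra.
Qed.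

Lemma nrmB u v : nrm (u - v) <= nrm u + nrm v.
Proof. by rewrite (le_trans (nrmD _ _)) // nrmN. Qed.

Lemma nrm_gt0 u : u != 0 -> 0 < nrm u.
Proof.
move=> u0; rewrite lt_def nrm_ge0 andbT; apply: contra u0 => /eqP u0.
by rewrite (nrm_eq0 u0).
Qed.

Lemma nrm_le_sq u (b : R) : 0 <= b -> ip u u <= b ^+ 2 -> nrm u <= b.
Proof.
by move=> b0 h; rewrite -(@ler_pXn2r _ 2) ?nnegrE ?nrm_ge0 // nrm2.
Qed.

(** Duality, with [v = u] as test vector; it bounds an operator through its adjoint. *)
Lemma nrm_test u (b : R) : 0 <= b -> (forall v, ip u v <= b * nrm v) -> nrm u <= b.
Proof.
move=> b0 h; have := h u; rewrite -nrm2.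
have [->|u0] := eqVneq (nrm u) 0; first by [].
have up : 0 < nrm u by rewrite lt_def u0 nrm_ge0.
by rewrite expr2 ler_pM2r.
Qed.

End Hilbert.

(** * Orthogonal projections onto row spaces *)

Section Projection.
Variables (R : realType) (n : nat).
Implicit Types (u v w x y : 'rV[R[i]]_n).

Section OneSpace.
Variables (p : nat) (W : 'M[R[i]]_(p, n)).
Local Notation P := (proj_ortho W).

Lemma hd_proj v x : (x <= W)%MS -> hd (v - v *m P) x = 0.
Proof.
move=> xW; rewrite hdE.
have /orthomx1P -> // : (v - v *m P <= orthomx Num.conj (mx_of_hermitian (hermitian1mx _)) x)%MS.
  apply: submx_trans (proj_ortho_compl_sub W v) _.
  by rewrite submx_ortho.
by rewrite mxE.
Qed.

Lemma ip_proj v x : (x <= W)%MS -> ip (v - v *m P) x = 0.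
Proof. by move=> xW; rewrite /ip hd_proj. Qed.

Lemma proj_sub v : (v *m P <= W)%MS. Proof. exact: proj_ortho_sub. Qed.

Lemma pythagoras v x : (x <= W)%MS ->
  ip (v - x) (v - x) = ip (v - v *m P) (v - v *m P) + ip (v *m P - x) (v *m P - x).
Proof.
move=> xW; set a := v - v *m P; set b := v *m P - x.
have -> : v - x = a + b by rewrite /a /b addrA subrK.
have ab : ip a b = 0 by rewrite ip_proj // addmx_sub ?proj_sub // eqmx_opp.
by move: a b ab => a b ab; rewrite ipDl !ipDr [ip b a]ipC ab; ring.
Qed.

Lemma nrm_proj_dist v x : (x <= W)%MS -> nrm (v - v *m P) <= nrm (v - x).
Proof.
move=> xW; apply: nrm_le_sq; rewrite ?nrm_ge0 // nrm2 (pythagoras v xW) lerDl.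
exact: ip_ge0.
Qed.

Lemma nrm_proj v : nrm (v *m P) <= nrm v.
Proof.
apply: nrm_le_sq; rewrite ?nrm_ge0 // nrm2.
have := pythagoras v (sub0mx 1 W); rewrite !subr0 => ->.
by rewrite lerDr ip_ge0.
Qed.

Lemma nrm_compl v : nrm (v - v *m P) <= nrm v.
Proof. by have := nrm_proj_dist v (sub0mx 1 W); rewrite subr0. Qed.

Lemma ip_proj_sym v w : ip (v *m P) w = ip v (w *m P).
Proof.
have h1 := ip_proj v (proj_sub w); have h2 := ip_proj w (proj_sub v).
move: h1 h2; rewrite !ipBl [ip w _]ipC [ip (w *m P) _]ipC; lra.
Qed.

Lemma ip_compl v w : ip (v - v *m P) (w - w *m P) = ip (v - v *m P) w.
Proof. by rewrite [LHS]ipBr [X in _ - X]ip_proj ?proj_sub // subr0. Qed.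

End OneSpace.

(* P'v - Pv = P'(v - Pv) - (Pv - P'Pv), and the first term is controlled by the adjoint of (1 - P)P'. *)
Lemma nrm_proj_diff p p' (W : 'M[R[i]]_(p, n)) (W' : 'M[R[i]]_(p', n)) (a b : R) :
  0 <= a -> 0 <= b ->
  (forall x, (x <= W)%MS -> nrm (x - x *m proj_ortho W') <= a * nrm x) ->
  (forall x, (x <= W')%MS -> nrm (x - x *m proj_ortho W) <= b * nrm x) ->
  forall v, nrm (v *m proj_ortho W' - v *m proj_ortho W) <= (a + b) * nrm v.
Proof.
move=> a0 b0 ha hb v.
set P' := proj_ortho W'; set P := proj_ortho W.
have -> : v *m P' - v *m P = (v - v *m P) *m P' - (v *m P - v *m P *m P').
  by rewrite mulmxBl opprB addrA subrK.
rewrite (le_trans (nrmB _ _)) // addrC mulrDl lerD //.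
  apply: le_trans (ha _ (proj_sub _ _)) _.
  by rewrite ler_wpM2l // nrm_proj.
apply: nrm_test => [|w]; first by rewrite mulr_ge0 ?nrm_ge0.
rewrite ip_proj_sym -[w *m P'](subrK (w *m P' *m P)) ipDr.
rewrite [X in _ + X](ip_proj _ (proj_sub _ _)) addr0 -mulrA mulrC -mulrA.
rewrite (le_trans (ip_le _ _)) //.
apply: le_trans (ler_wpM2l (nrm_ge0 _) (hb _ (proj_sub _ _))) _.
rewrite (le_trans (ler_wpM2r _ (nrm_compl W v))) ?mulr_ge0 ?nrm_ge0 //.
rewrite ler_wpM2l ?nrm_ge0 // [leRHS]mulrC ler_wpM2l //.
exact: nrm_proj.
Qed.

End Projection.

Section RowAlgebra.
Local Open Scope sesquilinear_scope.
Variable R : realType.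
Local Notation C := R[i].

Lemma hd_mulmx p n (u : 'rV[C]_p) (A : 'M[C]_(p, n)) (v : 'rV[C]_n) :
  hd (u *m A) v = hd u (v *m A ^t*).
Proof. by rewrite !hdE trmx_mul map_mxM trmxCK mulmxA. Qed.

Lemma nrm_unitary p n (u : 'rV[C]_p) (A : 'M[C]_(p, n)) :
  A \is unitarymx -> nrm (u *m A) = nrm u.
Proof.
move=> /unitarymxP Au; rewrite /nrm /ip hd_mulmx -mulmxA Au mulmx1 //.
Qed.

Lemma nrm_conj n (u : 'rV[C]_n) : nrm (map_mx Num.conj u) = nrm u.
Proof.
by rewrite /nrm !ip_self; congr Num.sqrt; apply: eq_bigr => j _; rewrite mxE cabsJ.
Qed.

(** The bound on [d] is asked only where [c] does not vanish, so that it applies to vectors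
    supported on the leading or on the trailing singular directions. *)
Lemma nrm_diag_le n (c d : 'rV[C]_n) (b : R) : 0 <= b ->
  (forall j, c 0 j != 0 -> cabs (d 0 j) <= b) -> nrm (c *m diag_mx d) <= b * nrm c.
Proof.
move=> b0 h; apply: nrm_le_sq; first by rewrite mulr_ge0 ?nrm_ge0.
rewrite exprMn nrm2 !ip_self mulr_sumr; apply: ler_sum => j _.
rewrite mul_mx_diag mxE cabsM exprMn mulrC.
have [->|cj] := eqVneq (c 0 j) 0; first by rewrite cabs0 expr0n !mulr0.
by rewrite ler_wpM2r ?sqr_ge0 // lerXn2r ?nnegrE ?cabs_ge0 // h.
Qed.

Lemma nrm_diag_ge n (c d : 'rV[C]_n) (b : R) : 0 <= b ->
  (forall j, c 0 j != 0 -> b <= cabs (d 0 j)) -> b * nrm c <= nrm (c *m diag_mx d).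
Proof.
move=> b0 h; rewrite -(@ler_pXn2r _ 2) ?nnegrE ?mulr_ge0 ?nrm_ge0 //.
rewrite exprMn !nrm2 !ip_self mulr_sumr; apply: ler_sum => j _.
rewrite mul_mx_diag mxE cabsM exprMn mulrC.
have [->|cj] := eqVneq (c 0 j) 0; first by rewrite cabs0 expr0n !mul0r.
by rewrite ler_wpM2l ?sqr_ge0 // lerXn2r ?nnegrE ?cabs_ge0 // h.
Qed.

Lemma kernel_vector p q (K : 'M[C]_(p, q)) : (\rank K < p)%N ->
  exists2 c : 'rV[C]_p, c != 0 & c *m K = 0.
Proof.
move=> rK; have : kermx K != 0.
  by rewrite -mxrank_eq0 mxrank_ker subn_eq0 -ltnNge.
by move=> /rowV0Pn[c /sub_kermxP cK c0]; exists c.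
Qed.

Lemma sub_pid_mx n k (c : 'rV[C]_n) (j : 'I_n) : (c <= (pid_mx k : 'M[C]_n))%MS ->
  (k <= j)%N -> c 0 j = 0.
Proof.
move=> /submxP[x ->] kj; rewrite mxE big1 // => i _; rewrite mxE.
have [ij|_] := eqVneq (i : nat) j; rewrite ?mulr0 //= ij.
by rewrite ltnNge kj /= mulr0.
Qed.

(** The first [k] coordinates span a space of dimension [k], which meets a kernel of codimension at
    most [q < k]. This is the dimension count of the min-max principle. *)
Lemma kernel_vector_pid n q k (K : 'M[C]_(n, q)) : (k <= n)%N -> (q < k)%N ->
  exists c : 'rV[C]_n,
    [/\ c != 0, c *m K = 0 & forall j : 'I_n, (k <= j)%N -> c 0 j = 0].
Proof.
move=> kn qk; set A := (pid_mx k : 'M[C]_n).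
have rA : \rank A = k by rewrite rank_pid_mx.
have rAK : (0 < \rank (A :&: kermx K)%MS)%N.
  have := mxrank_sum_cap A (kermx K).
  rewrite rA mxrank_ker; have := rank_leq_col (A + kermx K)%MS.
  have := rank_leq_col K; have := rank_leq_row K; lia.
move: rAK; rewrite lt0n mxrank_eq0 => /rowV0Pn[c]; rewrite sub_capmx.
move=> /andP[cA /sub_kermxP cK] c0; exists c; split=> // j.
exact: sub_pid_mx.
Qed.

End RowAlgebra.

(** * Singular value decomposition *)

Section SVD.
Local Open Scope sesquilinear_scope.
Variable R : realType.
Local Notation C := R[i].

Lemma sorting_perm n (f : 'I_n -> R) :
  exists s : {perm 'I_n}, forall i j : 'I_n, (i <= j)%N -> f (s j) <= f (s i).
Proof.
pose leT := [rel i j : 'I_n | f j <= f i].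
pose e := sort leT (enum 'I_n).
have sze : size e = n by rewrite size_sort size_enum_ord.
have ue : uniq e by rewrite sort_uniq enum_uniq.
pose g i := nth i e i.
have g_inj : injective g.
  move=> i j; rewrite /g (set_nth_default j) ?sze // => /eqP.
  by rewrite nth_uniq ?sze // => /eqP/val_inj.
exists (perm g_inj) => i j ij; rewrite !permE /g (set_nth_default i) ?sze //.
have tot : total leT by move=> x y; rewrite /= le_total.
have srt : sorted leT e by apply: sort_sorted.
have trl : transitive leT by move=> x y z /= h1 h2; apply: le_trans h2 h1.
have rfl : reflexive leT by move=> x /=.
by apply: (sorted_leq_nth trl rfl i srt); rewrite ?inE ?sze.
Qed.

Lemma perm_mx_unitary n (s : {perm 'I_n}) : (perm_mx s : 'M[C]_n) \is unitarymx.
Proof.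
apply/unitarymxP; rewrite tr_perm_mx map_perm_mx -perm_mxM.
by rewrite mulgV perm_mx1.
Qed.

(* A family of pairwise orthogonal rows of decreasing norms is turned by the
   Gram-Schmidt process into its normalization, completed to a basis. *)
Lemma orthogonal_rows_factor n (A : 'M[C]_n) :
  (forall i j, i != j -> hd (row i A) (row j A) = 0) ->
  (forall i j : 'I_n, (i <= j)%N -> nrm (row j A) <= nrm (row i A)) ->
  exists2 Q : 'M[C]_n, Q \is unitarymx &
    A = diag_mx (\row_i rc (nrm (row i A))) *m Q.
Proof.
move=> oA dA; have Qu := schmidt_unitarymx A (leqnn n).
set Q := schmidt A in Qu; exists Q => //.
have hdQ i j : hd (row i Q) (row j Q) = (i == j)%:R.
  by move/row_unitarymxP: Qu => /(_ i j); rewrite dotmxE -hdE.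
suff rowA i : row i A = rc (nrm (row i A)) *: row i Q.
  apply/row_matrixP => i; rewrite rowA mul_diag_mx; apply/rowP => j.
  by rewrite !mxE.
have [k ik] := ubnP (i : nat); elim: k i ik => // k IH i ik.
have [n0|n0] := eqVneq (nrm (row i A)) 0.
  by rewrite n0 (nrm_eq0 n0) scale0r.
have np : 0 < nrm (row i A) by rewrite lt_def n0 nrm_ge0.
have hlt (j : 'I_n) : (j < i)%N -> hd (row i A) (row j Q) = 0.
  move=> ji; have := IH j (leq_trans ji ik).
  have njp : 0 < nrm (row j A) by apply: lt_le_trans np (dA _ _ (ltnW ji)).
  have rj0 : rc (nrm (row j A)) != 0.
    by rewrite eq_complex /= eqxx andbT gt_eqF.
  move=> /(congr1 (fun x => (rc (nrm (row j A)))^-1 *: x)).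
  rewrite scalerA mulVf // scale1r => <-; rewrite hdZr oA ?mulr0 //.
  by rewrite -(inj_eq val_inj) gtn_eqF.
have hgt (j : 'I_n) : (i < j)%N -> hd (row i A) (row j Q) = 0.
  move=> ij; rewrite hdE.
  have /orthomx1P -> : (row i A <= orthomx Num.conj (mx_of_hermitian (hermitian1mx _)) (row j Q))%MS.
    apply: submx_trans (row_schmidt_sub A i) _; apply/sumsmx_subP => l li.
    rewrite genmxE orthomx1E; apply/eqP/matrixP => x y; rewrite !ord1 -hdE hdQ mxE.
    by rewrite -(inj_eq val_inj) ltn_eqF // (leq_ltn_trans li).
  by rewrite mxE.
have exp : row i A = hd (row i A) (row i Q) *: row i Q.
  rewrite -{1}[row i A](mulmxKtV _ Qu) // -mulmxA.
  apply/rowP => l; rewrite mulmxA mxE (bigD1 i) //= big1 => [|j ji].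
    rewrite addr0 !mxE; congr (_ * _); apply: eq_bigr => x _; by rewrite !mxE.
  have -> : (row i A *m Q ^t*) 0 j = hd (row i A) (row j Q).
    by rewrite mxE; apply: eq_bigr => x _; rewrite !mxE.
  have [ij|ij|/val_inj ij] := ltngtP i j; last by rewrite ij eqxx in ji.
    by rewrite hgt ?mul0r.
  by rewrite hlt ?mul0r.
have pos : 0 <= hd (row i A) (row i Q).
  by have := form1_row_schmidt A i; rewrite dotmxE -hdE.
rewrite {1}exp; congr (_ *: _).
have nQ : nrm (row i Q) = 1.
  by rewrite /nrm /ip hdQ eqxx /= sqrtr1.
have := congr1 (@nrm _ _) exp; rewrite nrmZ nQ mulr1 => ->.
by rewrite -normE ger0_norm.
Qed.

(** The spectral theorem diagonalizes [A *m A ^t*] by a unitary [P], which makes the rows of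
    [P *m A] orthogonal. Sorted by norm, they are a nonnegative diagonal matrix times a unitary
    one. *)
Lemma svd_exists n (A : 'M[C]_n) : exists U S V, is_svd A U S V.
Proof.
set B := A *m A ^t*.
have Bn : B \is normalmx.
  apply/normalmxP; congr (_ *m _); rewrite /B ?trmx_mul ?map_mxM ?trmxCK //.
have BE := orthomx_spectralP Bn; have Pu := spectral_unitarymx B.
move: (spectralmx B) (spectral_diag B) BE Pu => P d BE Pu.
have [s sd] := sorting_perm (fun i => nrm (row i (P *m A))).
pose A1 := perm_mx s *m (P *m A).
have rowA1 i : row i A1 = row (s i) (P *m A) by rewrite /A1 -row_permE; apply/rowP => j; rewrite !mxE.
have oPA i j : i != j -> hd (row i (P *m A)) (row j (P *m A)) = 0.
  move=> ij; have : ((P *m A) *m (P *m A) ^t*) i j = 0.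
    rewrite trmx_mul map_mxM mulmxA -[P *m A *m _]mulmxA -/B BE invmx_unitary //.
    rewrite !mulmxA (unitarymxP Pu) mul1mx -mulmxA (unitarymxP Pu) mulmx1 mxE.
    by rewrite (negbTE ij) mulr0n.
  by move=> <-; rewrite /hd mxE; apply: eq_bigr => l _; rewrite !mxE.
have [||Q Qu A1E] := @orthogonal_rows_factor n A1.
- by move=> i j ij; rewrite !rowA1 oPA // (inj_eq perm_inj).
- by move=> i j ij; rewrite !rowA1 sd.
exists (P ^t* *m (perm_mx s) ^t*), (\row_i nrm (row i A1)), (Q ^t*); split.
- apply: mul_unitarymx; rewrite trmxC_unitary; [exact: Pu|exact: perm_mx_unitary].
- by rewrite trmxC_unitary.
- by move=> k; rewrite mxE nrm_ge0.
- by move=> j k jk; rewrite !mxE !rowA1 sd.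
rewrite trmxCK -!mulmxA.
have -> : map_mx (fun r => Complex r 0) (\row_i nrm (row i A1)) = \row_i rc (nrm (row i A1)).
  by apply/rowP => i; rewrite !mxE.
have tV (X : 'M[C]_n) : X \is unitarymx -> X ^t* *m X = 1%:M.
  by move=> /unitarymxP/mulmx1C.
rewrite -A1E /A1 [_ *m (perm_mx s *m _)]mulmxA (tV _ (perm_mx_unitary _)) mul1mx.
rewrite mulmxA (tV _ Pu) mul1mx; reflexivity.
Qed.

(** A Hankel matrix is symmetric rather than Hermitian, so the decomposition can be transposed. The
    columns of [U] thereby become rows, which suits row spaces and multiplication on the right. *)
Lemma svd_row_factor n (A U V : 'M[C]_n) (S : 'rV[R]_n) :
  is_svd A U S V -> A^T = A ->
  V^T *m A = diag_mx (map_mx (@rc R) S) *m U^T.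
Proof.
move=> [_ Vu _ _ AE] As; rewrite -[A in LHS]As AE.
rewrite !trmx_mul tr_diag_mx !mulmxA.
have -> : V^T *m (V ^t*)^T = 1%:M; last by rewrite mul1mx.
have /unitarymxP : V^T \is unitarymx by rewrite trmx_unitary.
by rewrite trmxK map_trmx trmxK.
Qed.

End SVD.

(** * Perturbation of the leading singular space *)

Section Perturbation.
Local Open Scope sesquilinear_scope.
Variables (R : realType) (N s : nat).
Local Notation C := R[i].
Variables (Phi : 'M[C]_(s, N)) (a : 'rV[C]_s) (E M1 M2 : 'M[C]_N) (S : 'rV[R]_N).
Variables (n lam e : R).
Hypotheses (n_gt0 : 0 < n) (lam_gt0 : 0 < lam) (e_ge0 : 0 <= e) (s_gt0 : (0 < s)%N).
Hypothesis Gram : forall c, lam * ip c c <= ip (c *m Phi) (c *m Phi).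
Hypothesis a_ge1 : forall l, 1 <= cabs (a 0 l).
Hypothesis E_le : forall z, nrm (z *m E) <= e * nrm z.
Hypotheses (M1u : M1 \is unitarymx) (M2u : M2 \is unitarymx).
Hypotheses (S_ge0 : forall k, 0 <= S 0 k).
Hypothesis S_decr : forall j k : 'I_N, (j <= k)%N -> S 0 k <= S 0 j.
(** The clean Hankel matrix, with [n] the number of points of the cube. The matrices [M1] and [M2]
    stand for [U^T] and [V^T] in a decomposition of the symmetric matrix [H0 + E]. *)
Let H0 := rc n *: (Phi^T *m diag_mx a *m Phi).
Hypothesis HE : M2 *m (H0 + E) = diag_mx (map_mx (@rc R) S) *m M1.
Hypothesis e_small : e < lam * n.

Let cPhi := map_mx Num.conj Phi.

Lemma Gram_nrm c : Num.sqrt lam * nrm c <= nrm (c *m Phi).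
Proof.
rewrite -(@ler_pXn2r _ 2) ?nnegrE ?mulr_ge0 ?nrm_ge0 ?sqrtr_ge0 //.
by rewrite exprMn sqr_sqrtr ?(ltW lam_gt0) // !nrm2; apply: Gram.
Qed.

Lemma Gram_conj c : Num.sqrt lam * nrm c <= nrm (c *m cPhi).
Proof.
have := Gram_nrm (map_mx Num.conj c); rewrite nrm_conj => /le_trans -> //.
by rewrite -(nrm_conj (c *m cPhi)) map_mxM map_mxCK.
Qed.

Lemma rank_steering : \rank Phi = s.
Proof.
apply/eqP; rewrite eqn_leq rank_leq_row /= leqNgt; apply/negP.
move=> /kernel_vector[c c0 cP]; have := Gram_nrm c.
have sl : 0 < Num.sqrt lam by rewrite sqrtr_gt0.
by rewrite cP nrm0 leNgt (mulr_gt0 sl (nrm_gt0 c0)).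
Qed.

Lemma leq_sources : (s <= N)%N.
Proof. by rewrite -rank_steering rank_leq_col. Qed.

(** The row space of [cPhi] is the orthogonal complement of the kernel of [z |-> z *m Phi^T]. On it
    each of the factors [Phi^T] and [Phi] costs at most [Num.sqrt lam], the first one by duality,
    and [diag_mx a] does not shrink norms. *)
Lemma clean_lower c : lam * n * nrm (c *m cPhi) <= nrm (c *m cPhi *m H0).
Proof.
set z := c *m cPhi; set b := z *m Phi^T.
have sl : 0 < Num.sqrt lam by rewrite sqrtr_gt0.
have zb : Num.sqrt lam * nrm z <= nrm b.
  have [->|z0] := eqVneq (nrm z) 0; first by rewrite mulr0 nrm_ge0.
  have zp : 0 < nrm z by rewrite lt_def z0 nrm_ge0.
  have h1 : nrm z ^+ 2 = ip b c.
    rewrite nrm2 [RHS]ipC /ip {1}/z hd_mulmx /b.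
    by rewrite map_trmx map_mxCK.
  have := Gram_conj c; rewrite -/z => h2; have h3 := ip_le b c.
  rewrite -(ler_pM2r zp) -mulrA -expr2 h1.
  apply: (@le_trans _ _ (Num.sqrt lam * (nrm b * nrm c))); first by rewrite ler_pM2l.
  by rewrite mulrCA ler_wpM2l ?nrm_ge0.
have -> : z *m H0 = rc n *: ((b *m diag_mx a) *m Phi).
  by rewrite /H0 -scalemxAr !mulmxA.
rewrite nrmZ cabs_rc gtr0_norm // [lam * n]mulrC -mulrA ler_pM2l //.
apply: le_trans (Gram_nrm _).
rewrite -{1}[lam](sqr_sqrtr (ltW lam_gt0)) expr2 -mulrA ler_pM2l //.
apply: le_trans zb _; rewrite -[X in X <= _]mul1r; apply: nrm_diag_ge => // j _.
Qed.

(* The row space of [H0] is that of [Phi], with a bounded right inverse: a vector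
   of the signal space is [z *m H0] with [z] small, hence close to [z *m (H0 + E)]. *)
Lemma clean_preimage x : (x <= Phi)%MS ->
  exists2 z, z *m H0 = x & lam * n * nrm z <= nrm x.
Proof.
move=> /submxP[b ->].
set T := rc n *: (cPhi *m Phi^T *m diag_mx a).
have TP c : c *m cPhi *m H0 = c *m T *m Phi.
  by rewrite /T /H0 -!scalemxAr -scalemxAl !mulmxA.
have Tu : T \in unitmx.
  rewrite -row_free_unit -kermx_eq0; apply/eqP/row_matrixP => i.
  rewrite row0; set c := row i _.
  have cT : c *m T = 0 by apply/sub_kermxP; rewrite row_sub.
  have := clean_lower c; rewrite TP cT mul0mx nrm0 => h.
  have h2 := Gram_conj c; apply: nrm_eq0; apply/eqP.
  rewrite eq_le nrm_ge0 andbT leNgt; apply/negP => cp.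
  have : 0 < nrm (c *m cPhi) by apply: lt_le_trans h2; rewrite mulr_gt0 // sqrtr_gt0.
  by move=> zp; move: h; rewrite leNgt !mulr_gt0.
exists (b *m invmx T *m cPhi); first by rewrite TP mulmxKV.
by apply: le_trans (clean_lower _) _; rewrite TP mulmxKV.
Qed.

Lemma noisy_coords (c : 'rV[C]_N) : c *m M2 *m (H0 + E) = c *m diag_mx (map_mx (@rc R) S) *m M1.
Proof. by rewrite -mulmxA HE mulmxA. Qed.

Lemma cabs_S j : cabs (map_mx (@rc R) S 0 j) = S 0 j.
Proof. by rewrite mxE cabs_rc ger0_norm. Qed.

(** Weyl's inequality: some combination of the first [s.+1] rows of [M2] is annihilated by [H0],
    which has rank at most [s]. Only [E] acts on it, while [H0 + E] stretches it by at least
    [S 0 i]. *)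
Lemma tail_singular_le (i : 'I_N) : (s <= i)%N -> S 0 i <= e.
Proof.
move=> si.
have [||c [c0 cK cj]] := @kernel_vector_pid _ _ _ s.+1 (M2 *m Phi^T).
- by rewrite (leq_ltn_trans si).
- by [].
have cp := nrm_gt0 c0.
have h1 : c *m M2 *m (H0 + E) = c *m M2 *m E.
  by rewrite mulmxDr /H0 -scalemxAr !mulmxA -[c *m M2 *m Phi^T]mulmxA cK !mul0mx scaler0 add0r.
have h2 : S 0 i * nrm c <= nrm (c *m M2 *m (H0 + E)).
  rewrite noisy_coords nrm_unitary //; apply: nrm_diag_ge => // j cj0.
  rewrite cabs_S; apply: S_decr; apply: leq_trans si.
  by rewrite -ltnS ltnNge; apply/negP => /cj /eqP; rewrite (negbTE cj0).
rewrite -(ler_pM2r cp); apply: le_trans h2 _; rewrite h1.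
by apply: le_trans (E_le _) _; rewrite nrm_unitary.
Qed.

(** The dual count: the row space of [cPhi] has dimension [s > i], so it contains a vector without
    components on the first [i] rows of [M2]. The noisy matrix stretches it by at most [S 0 i], the
    clean one by at least [lam * n]. *)
Lemma head_singular_ge (i : 'I_N) : (i < s)%N -> lam * n - e <= S 0 i.
Proof.
move=> is_; set K := cPhi *m M2 ^t* *m (pid_mx i : 'M[C]_N).
have [|c c0 cK] := @kernel_vector _ _ _ K.
  apply: leq_ltn_trans is_; apply: leq_trans (mxrankM_maxr _ _) _.
  by rewrite rank_pid_mx // ltnW.
set z := c *m cPhi; set c2 := z *m M2 ^t*.
have zE : z = c2 *m M2 by rewrite /c2 mulmxKtV.
have c2i (j : 'I_N) : (j < i)%N -> c2 0 j = 0.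
  move=> ji; have := congr1 (fun A : 'rV[C]_N => A 0 j) cK.
  rewrite /K !mulmxA -/z -/c2 [LHS]mxE [RHS]mxE (bigD1 j) //= big1 => [|k kj].
    by rewrite [pid_mx _ _ _]mxE eqxx ji /= mulr1 addr0.
  by rewrite [pid_mx _ _ _] mxE (inj_eq val_inj) (negbTE kj) /= mulr0.
have zp : 0 < nrm z.
  have sl : 0 < Num.sqrt lam by rewrite sqrtr_gt0.
  exact: lt_le_trans (mulr_gt0 sl (nrm_gt0 c0)) (Gram_conj c).
have h2 := clean_lower c; have h3 := E_le z.
rewrite -/z in h2; clearbody c2 z.
have h1 : nrm (z *m (H0 + E)) <= S 0 i * nrm z.
  rewrite zE noisy_coords [leLHS]nrm_unitary // [X in _ <= _ * X]nrm_unitary //.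
  apply: nrm_diag_le => // j cj; rewrite cabs_S; apply: S_decr.
  by rewrite leqNgt; apply/negP => /c2i/eqP; rewrite (negbTE cj).
rewrite -(ler_pM2r zp); apply: le_trans h1; rewrite mulrBl.
have h4 : nrm (z *m H0) <= nrm (z *m (H0 + E)) + nrm (z *m E).
  by rewrite mulmxDr -{1}[z *m H0](addrK (z *m E)) nrmB.
by rewrite lerBlDr (le_trans h2) // (le_trans h4) // lerD2l.
Qed.

Let W := (<<(pid_mx s : 'M[C]_N) *m M1>>)%MS.

Lemma signal_to_leading x : (x <= Phi)%MS ->
  nrm (x - x *m proj_ortho W) <= (2 * e / (lam * n)) * nrm x.
Proof.
move=> /clean_preimage[z zx hz].
have ln : 0 < lam * n by rewrite mulr_gt0.
set c := z *m M2 ^t*.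
have zE : z = c *m M2 by rewrite /c mulmxKtV.
clearbody c.
(* The part of [z *m (H0 + E)] in the leading space. What is cut off carries trailing singular
   values, at most [e]; passing from [H0] to [H0 + E] costs another [e * nrm z], whence the factor
   2. *)
pose y := c *m (pid_mx s : 'M[C]_N) *m diag_mx (map_mx (@rc R) S) *m M1.
have yW : (y <= W)%MS.
  rewrite /y genmxE.
  have -> : c *m (pid_mx s : 'M[C]_N) *m diag_mx (map_mx (@rc R) S) =
    c *m diag_mx (map_mx (@rc R) S) *m (pid_mx s : 'M[C]_N).
    rewrite -[LHS]mulmxA -[RHS]mulmxA; congr (_ *m _).
    by apply/matrixP => i j; rewrite mul_mx_diag mul_diag_mx !mxE;
      case: eqP => [/val_inj ->|_]; rewrite /= ?mulr0 ?mul0r // mulrC.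
  by rewrite -mulmxA submxMl.
apply: le_trans (nrm_proj_dist _ yW) _.
have d1 : nrm (z *m (H0 + E) - y) <= e * nrm z.
  have -> : nrm z = nrm c by rewrite zE nrm_unitary.
  rewrite zE noisy_coords /y -mulmxBl [leLHS]nrm_unitary // -mulmxBl.
  set d := c - _; have dj (j : 'I_N) : d 0 j = if (j < s)%N then 0 else c 0 j.
    rewrite !mxE (bigD1 j) //= big1 => [|k kj].
      by rewrite mxE eqxx /=; case: ifP; rewrite ?mulr1 ?mulr0 !addr0 ?subrr ?subr0.
    by rewrite mxE (inj_eq val_inj) (negbTE kj) /= mulr0.
  apply: (@le_trans _ _ (e * nrm d)).
    apply: nrm_diag_le => // j; rewrite dj; case: ltnP => [_|sj _].
      by rewrite eqxx.
    by rewrite cabs_S tail_singular_le.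
  rewrite ler_wpM2l // -(@ler_pXn2r _ 2) ?nnegrE ?nrm_ge0 // !nrm2 !ip_self.
  apply: ler_sum => j _; rewrite dj; case: ifP => // _.
  by rewrite cabs0 expr0n sqr_ge0.
have -> : x - y = (z *m (H0 + E) - y) - z *m E.
  by rewrite mulmxDr -zx addrAC addrK.
have hz2 : nrm z <= nrm x / (lam * n) by rewrite ler_pdivlMr // mulrC.
apply: le_trans (nrmB _ _) _.
have -> : 2 * e / (lam * n) * nrm x = e * (nrm x / (lam * n)) + e * (nrm x / (lam * n)).
  by ring.
apply: lerD; first by apply: le_trans d1 _; rewrite ler_wpM2l.
by apply: le_trans (E_le z) _; rewrite ler_wpM2l.
Qed.

(** Dividing the coordinates of [x] by the leading singular values, which are at least
    [lam * n - e], writes [x] as the image under [H0 + E] of a short vector. The image of this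
    vector under [H0] lies in the signal space and differs from [x] by its image under [E]. *)
Lemma leading_to_signal x : (x <= W)%MS ->
  nrm (x - x *m proj_ortho Phi) <= (e / (lam * n - e)) * nrm x.
Proof.
rewrite genmxE => /submxP[b xE].
have dp : 0 < lam * n - e by rewrite subr_gt0.
pose p := b *m (pid_mx s : 'M[C]_N).
have pj (j : 'I_N) : (s <= j)%N -> p 0 j = 0.
  by move=> sj; apply: (@sub_pid_mx _ _ s) => //; rewrite submxMl.
have xp : x = p *m M1 by rewrite xE mulmxA.
clearbody p.
pose c := p *m diag_mx (\row_j (map_mx (@rc R) S 0 j)^-1).
have Sj (j : 'I_N) : (j < s)%N -> 0 < S 0 j.
  by move=> js; apply: lt_le_trans dp (head_singular_ge js).
have cS : c *m diag_mx (map_mx (@rc R) S) = p.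
  apply/rowP => j; rewrite mul_mx_diag mxE /c mul_mx_diag !mxE; have [js|sj] := ltnP j s.
    by rewrite mulfVK // eq_complex /= eqxx andbT gt_eqF ?Sj.
  by rewrite pj // !mul0r.
have xz : c *m M2 *m (H0 + E) = x by rewrite noisy_coords cS xp.
have nc : nrm c <= (lam * n - e)^-1 * nrm p.
  apply: nrm_diag_le => [|j]; first by rewrite invr_ge0 ltW.
  have [js|sj] := ltnP j s; last by rewrite pj // eqxx.
  move=> _; rewrite mxE mxE -[(rc _)^-1]mul1r.
  have r0 : rc (S 0 j) != 0 by rewrite eq_complex /= eqxx andbT gt_eqF ?Sj.
  have : cabs (rc (S 0 j)) * cabs (rc (S 0 j))^-1 = 1.
    by rewrite -cabsM mulfV // cabs1.
  rewrite cabs_rc ger0_norm // mul1r => h.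
  have Sp := Sj j js.
  have -> : cabs (rc (S 0 j))^-1 = (S 0 j)^-1.
    by apply: (mulfI (lt0r_neq0 Sp)); rewrite h mulfV // gt_eqF.
  by rewrite lef_pV2 ?posrE // head_singular_ge.
have nx : nrm p = nrm x by rewrite xp nrm_unitary.
apply: (@le_trans _ _ (nrm (x - c *m M2 *m H0))).
  by apply: nrm_proj_dist; rewrite /H0 -scalemxAr scalemx_sub // !mulmxA submxMl.
rewrite -xz {1}mulmxDr addrAC subrr add0r xz.
apply: le_trans (E_le _) _; rewrite nrm_unitary // -mulrA ler_wpM2l //.
by rewrite -nx.
Qed.

End Perturbation.

(** * Trigonometric kernels *)

Section Trigonometry.
Variable R : realType.
Implicit Types (x y t : R).

Lemma is_derive_monomial (c : R) n x :
  is_derive x 1 (fun y : R => c * y ^+ n.+1) (c * (n.+1%:R * x ^+ n)).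
Proof.
have -> : (fun y : R => c * y ^+ n.+1) = cst c * (id ^+ n.+1 : R -> R).
  by apply/funext => y; rewrite /= !fctE.
apply: is_derive_eq.
by rewrite /GRing.scale /= !fctE /= mulr0 addr0 mulr1.
Qed.

Lemma nonneg_of_derive (f df : R -> R) :
  (forall x, is_derive x 1 f (df x)) -> (forall x, 0 <= x -> 0 <= df x) ->
  f 0 = 0 -> forall x, 0 <= x -> 0 <= f x.
Proof.
move=> fd df0 f0 x x0.
have fc : {within `[0, x], continuous f}.
  apply: continuous_subspaceT => y.
  by apply: differentiable_continuous; apply/derivable1_diffP; case: (fd y).
have [c] := @MVT_segment R f df 0 x x0 (fun y _ => fd y) fc.
rewrite f0 !subr0 => c0x ->; rewrite mulr_ge0 // df0 //.
by move: c0x; rewrite in_itv /= => /andP[].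
Qed.

(** First link of a chain with [cos_ge2], [sin_ge3] and [cos_le4]: in each, the derivative of the
    difference of the two sides is the difference of the preceding one. *)
Lemma sin_le x : 0 <= x -> sin x <= x.
Proof.
move=> x0; rewrite -subr_ge0.
apply: (@nonneg_of_derive (id - sin) (fun y => 1 - cos y)) => //.
by rewrite !fctE /= sin0 subr0.
Qed.

Lemma cos_ge2 x : 1 - x ^+ 2 / 2 <= cos x.
Proof.
wlog x0 : x / 0 <= x.
  by move=> h; have [/h//|/ltW] := leP 0 x; rewrite -oppr_ge0 => /h; rewrite sqrrN cosN.
rewrite -subr_ge0.
have := @nonneg_of_derive ((fun y => 2^-1 * y ^+ 2) + cos - cst 1) (fun y => 2^-1 * (2 * y ^+ 1) + - sin y - 0) _ _ _ _ x0.
rewrite !fctE /= => h.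
have -> : cos x - (1 - x ^+ 2 / 2) = 2^-1 * x ^+ 2 + cos x - 1 by ring.
apply: h => [y|y y0|].
- apply: is_deriveB; apply: is_deriveD; exact: is_derive_monomial.
- have := sin_le y0; rewrite expr1; lra.
by rewrite cos0; ring.
Qed.

Lemma sin_ge3 x : 0 <= x -> x - x ^+ 3 / 6 <= sin x.
Proof.
move=> x0; rewrite -subr_ge0.
have := @nonneg_of_derive (sin - id + (fun y => 6^-1 * y ^+ 3)) (fun y => cos y - 1 + 6^-1 * (3 * y ^+ 2)) _ _ _ _ x0.
rewrite !fctE /= => h.
have -> : sin x - (x - x ^+ 3 / 6) = sin x - x + 6^-1 * x ^+ 3 by ring.
apply: h => [y|y y0|].
- apply: is_deriveD; exact: is_derive_monomial.
- have := cos_ge2 y; lra.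
by rewrite sin0; ring.
Qed.

Lemma cos_le4 x : cos x <= 1 - x ^+ 2 / 2 + x ^+ 4 / 24.
Proof.
wlog x0 : x / 0 <= x.
  move=> h; have [/h//|/ltW] := leP 0 x; rewrite -oppr_ge0 => /h.
  by rewrite sqrrN cosN exprNn -signr_odd expr0 mul1r.
rewrite -subr_ge0.
have := @nonneg_of_derive (cst 1 - (fun y => 2^-1 * y ^+ 2) + (fun y => 24^-1 * y ^+ 4) - cos) (fun y => 0 - 2^-1 * (2 * y ^+ 1) + 24^-1 * (4 * y ^+ 3) - - sin y) _ _ _ _ x0.
rewrite !fctE /= => h.
have -> : 1 - x ^+ 2 / 2 + x ^+ 4 / 24 - cos x = 1 - 2^-1 * x ^+ 2 + 24^-1 * x ^+ 4 - cos x by ring.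
apply: h => [y|y y0|].
- apply: is_deriveB; apply: is_deriveD; [|exact: is_derive_monomial].
  apply: is_deriveB; exact: is_derive_monomial.
- have := sin_ge3 y0; rewrite expr1; lra.
by rewrite cos0; ring.
Qed.

Lemma sin_bound x : `|sin x - x| <= `|x| ^+ 3 / 6.
Proof.
wlog x0 : x / 0 <= x.
  move=> h; have [/h//|/ltW] := leP 0 x; rewrite -oppr_ge0 => /h.
  by rewrite sinN -opprD !normrN.
rewrite (ger0_norm x0) ler_norml.
by have := sin_le x0; have := sin_ge3 x0; have := exprn_ge0 3 x0; lra.
Qed.

(** The Taylor bounds are evaluated at the zero [pi / 2] of the cosine. With [u = (pi / 2)^2] the
    quartic one reads [u^2 - 12 u + 24 >= 0], and [u <= 4] puts [u] below the smaller root. *)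
Lemma pi2_bounds : 8 <= (pi : R) ^+ 2 <= 1016 / 100.
Proof.
have [/andP[h0 h2] hc] := @pihalf_02_cos_pihalf R.
have := cos_ge2 (pi / 2 : R); have := cos_le4 (pi / 2 : R); rewrite hc.
have -> : (pi : R) ^+ 2 = 4 * (pi / 2) ^+ 2 by field.
move: (pi / 2 : R) h0 h2 => p p0 p2.
have -> : p ^+ 4 = p ^+ 2 * p ^+ 2 by ring.
have u4 : p ^+ 2 <= 4 by rewrite expr2; nra.
have u0 := sqr_ge0 p; move: (p ^+ 2) u0 u4 => u u0 u4 h1 h3.
apply/andP; split; first lra.
rewrite leNgt; apply/negP => h; nra.
Qed.

Lemma pi_bounds : 28 / 10 <= (pi : R) <= 319 / 100.
Proof.
have /andP[h1 h2] := pi2_bounds; have p0 := @pi_ge0 R.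
by apply/andP; split; rewrite leNgt; apply/negP => h; move: h1 h2; rewrite expr2; nra.
Qed.

Lemma cexpD x y : cexp (x + y) = cexp x * cexp y :> R[i].
Proof.
apply/eqP; rewrite /cexp eq_complex /= mulrDr cosD sinD.
by rewrite eqxx addrC eqxx.
Qed.

Lemma cexp0 : cexp 0 = 1 :> R[i].
Proof. by rewrite /cexp mulr0 cos0 sin0. Qed.

Lemma cexpN x : cexp (- x) = (cexp x)^* :> R[i].
Proof. by rewrite /cexp conjCE /= mulrN cosN sinN. Qed.

Lemma cexp_sum I (r : seq I) (P : pred I) (F : I -> R) :
  cexp (\sum_(i <- r | P i) F i) = \prod_(i <- r | P i) cexp (F i).
Proof. by elim/big_rec2: _ => [|i a b _ <-]; rewrite ?cexp0 // cexpD. Qed.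

Lemma cabs_cexp x : cabs (cexp x) = 1.
Proof. by rewrite cabsE /= cos2Dsin2 sqrtr1. Qed.

Lemma cexp1 : cexp 1 = 1 :> R[i].
Proof. by rewrite /cexp mulr1 mulr_natl cos2pi sin2pi. Qed.

Lemma cexpM_nat x n : cexp (x * n%:R) = cexp x ^+ n :> R[i].
Proof.
elim: n => [|n IH]; first by rewrite mulr0 cexp0.
by rewrite -natr1 mulrDr mulr1 cexpD IH exprSr.
Qed.

Lemma cexp_int (z : int) : cexp z%:~R = 1 :> R[i].
Proof.
case: z => n; first by rewrite -[_%:~R]mul1r cexpM_nat cexp1 expr1n.
by rewrite NegzE mulrNz cexpN -[_%:~R]mul1r cexpM_nat cexp1 expr1n rmorph1.
Qed.

Lemma cexpDint x (z : int) : cexp (x + z%:~R) = cexp x :> R[i].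
Proof. by rewrite cexpD cexp_int mulr1. Qed.

Lemma chord2 t : cabs (1 - cexp t) ^+ 2 = 2 - 2 * cos (2 * pi * t).
Proof.
rewrite cabs2 /cexp /= add0r sqrrN sin2cos2; ring.
Qed.

Lemma chord_sin t : cabs (1 - cexp t) = 2 * `|sin (pi * t)|.
Proof.
apply: (@pexpIrn _ 2); rewrite ?nnegrE ?cabs_ge0 ?mulr_ge0 //.
rewrite chord2 exprMn real_normK ?num_real //.
have -> : 2 * pi * t = (pi * t) *+ 2 by ring.
rewrite cos_mulr2n sin2cos2 -mulr_natl; ring.
Qed.

Lemma chord_le t : cabs (1 - cexp t) <= 2 * pi * `|t|.
Proof.
rewrite chord_sin -mulrA ler_wpM2l //.
rewrite (_ : pi * `|t| = `|pi * t|); last by rewrite normrM (ger0_norm (@pi_ge0 R)).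
wlog t0 : t / 0 <= pi * t.
  move=> h; have [/h//|/ltW] := leP 0 (pi * t); rewrite -oppr_ge0 -mulrN => /h.
  by rewrite mulrN sinN !normrN.
rewrite [leRHS]ger0_norm // ler_norml sin_le // andbT.
have [t1|t1] := leP (pi * t) 1; last by have := sin_geN1 (pi * t); lra.
have := sin_ge3 t0; have : (pi * t) ^+ 3 <= pi * t.
  by rewrite exprS ler_piMr // exprn_ile1.
lra.
Qed.

(** The sharp constant is 4, by concavity of the sine. The cubic Taylor bound gives
    [2 * 2.82 * 0.57 > 3.2], which suffices. *)
Lemma chord_ge t : `|t| <= 1 / 2 -> 32 / 10 * `|t| <= cabs (1 - cexp t).
Proof.
rewrite chord_sin => t2.
have -> : `|sin (pi * t)| = `|sin (pi * `|t|)|.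
  by case: (ger0P t) => // _; rewrite mulrN sinN normrN.
move: (`|t|) (normr_ge0 t) t2 => {}t t0 t2.
apply: le_trans (ler_wpM2l _ (ler_norm _)) => //.
have /andP[p1 p2] := pi2_bounds; have /andP[q1 q2] := pi_bounds.
have pt : 0 <= pi * t by rewrite mulr_ge0 // pi_ge0.
apply: le_trans (ler_wpM2l _ (sin_ge3 pt)) => //.
have -> : 2 * (pi * t - (pi * t) ^+ 3 / 6) = 2 * (pi * t * (1 - pi ^+ 2 * t ^+ 2 / 6)).
  by ring.
have u : t ^+ 2 <= 1 / 4 by rewrite expr2; nra.
have v : pi ^+ 2 * t ^+ 2 <= 254 / 100.
  by apply: le_trans (ler_pM _ _ p2 u) _; rewrite ?sqr_ge0 //; lra.
have w : 57 / 100 <= 1 - pi ^+ 2 * t ^+ 2 / 6 by lra.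
have x : 282 / 100 <= (pi : R).
  by rewrite leNgt; apply/negP => h; move: p1; rewrite expr2; nra.
have y : 282 / 100 * t <= pi * t by rewrite ler_wpM2r.
apply: (@le_trans _ _ (2 * (282 / 100 * t * (57 / 100)))); first lra.
by apply: ler_wpM2l; first lra; apply: ler_pM; [lra|lra|exact: y|exact: w].
Qed.

End Trigonometry.

(** * Summation by parts *)

Section AbelSummation.
Variable R : realType.

Lemma abel_identity (p : nat -> R[i]) (z : R[i]) n :
  (1 - z) * \sum_(k < n.+1) p k * z ^+ k =
  p 0%N + \sum_(k < n) (p k.+1 - p k) * z ^+ k.+1 - p n * z ^+ n.+1.
Proof.
elim: n => [|n IH].
  by rewrite big_ord1 big_ord0 expr0 expr1; ring.
by rewrite big_ord_recr /= mulrDr IH [in RHS]big_ord_recr /= !exprS; ring.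
Qed.

(** General coefficients [p] are allowed so that shifts and differences of kernels can be moved into
    them; only their size and variation matter. *)
Lemma abel_bound (p : nat -> R[i]) (z : R[i]) n : cabs z = 1 ->
  cabs (\sum_(k < n.+1) p k * z ^+ k) * cabs (1 - z) <=
  cabs (p 0%N) + cabs (p n) + \sum_(k < n) cabs (p k.+1 - p k).
Proof.
move=> z1; rewrite mulrC -cabsM abel_identity.
apply: le_trans (cabsB _ _) _; rewrite cabsM cabsX z1 expr1n mulr1 addrAC lerD2r.
apply: le_trans (cabsD _ _) _; rewrite lerD2l.
apply: le_trans (cabs_sum _ _ _) _; apply: ler_sum => k _.
by rewrite cabsM cabsX z1 expr1n mulr1.
Qed.

End AbelSummation.

Section Kernels.
Variable R : realType.
Implicit Types (t e : R) (m n : nat).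

Definition geo n t : R[i] := \sum_(k < n) cexp (t * k%:R).

Lemma geo_le n t : cabs (geo n t) <= n%:R.
Proof.
apply: le_trans (cabs_sum _ _ _) _.
by rewrite (eq_bigr (fun=> 1)) => [|k _]; rewrite ?cabs_cexp // sumr_const card_ord.
Qed.

Lemma geo_chord n t : cabs (geo n t) * cabs (1 - cexp t) <= 2.
Proof.
case: n => [|n]; first by rewrite /geo big_ord0 cabs0 mul0r.
have := @abel_bound R (fun=> 1) (cexp t) n (cabs_cexp t).
rewrite cabs1 [\sum_(k < n) _]big1 => [|k _]; last by rewrite subrr cabs0.
rewrite addr0 -natr1 => h.
rewrite (_ : geo n.+1 t = \sum_(k < n.+1) 1 * cexp t ^+ k) //.
by apply: eq_bigr => k _; rewrite mul1r cexpM_nat.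
Qed.

Lemma geo_decay1 n t : `|t| <= 1 / 2 -> cabs (geo n t) * (32 / 10 * `|t|) <= 2.
Proof.
move=> t2; apply: le_trans (geo_chord n t).
by rewrite ler_wpM2l ?cabs_ge0 // chord_ge.
Qed.

(** Each kernel is at most its length and at most [1 / |t|]. The first bound serves the summand 1,
    the second the summand [y^2 t^2]: two kernels together give quadratic decay. *)
Lemma geo_decay n1 n2 t (y : R) : `|t| <= 1 / 2 -> 0 <= y ->
  cabs (geo n1 t) * cabs (geo n2 t) * (1 + y ^+ 2 * t ^+ 2) <= n1%:R * n2%:R + y ^+ 2.
Proof.
move=> t2 y0; rewrite mulrDr mulr1 lerD //.
  by rewrite ler_pM ?cabs_ge0 ?geo_le.
have h1 := geo_decay1 n1 t2; have h2 := geo_decay1 n2 t2.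
have h (n : nat) : cabs (geo n t) * (32 / 10 * `|t|) <= 2 -> cabs (geo n t) * `|t| <= 1.
  by rewrite mulrCA; lra.
have k1 := h _ h1; have k2 := h _ h2.
rewrite -(real_normK (num_real t)) mulrCA -[leRHS]mulr1 ler_wpM2l ?sqr_ge0 //.
rewrite expr2 mulrACA -[leRHS]mulr1 ler_pM ?mulr_ge0 ?cabs_ge0 //.
Qed.

Lemma odd_nat m : (2 * m).+1%:R = 2 * m%:R + 1 :> R.
Proof. by rewrite -natr1 natrM. Qed.

Lemma sum_nat_ord n : \sum_(k < n) (k%:R : R) = n%:R * (n%:R - 1) / 2.
Proof.
elim: n => [|n IH]; first by rewrite big_ord0; field.
by rewrite big_ord_recr /= IH -natr1; field.
Qed.

Lemma sum_sq_ord n : \sum_(k < n) (k%:R : R) ^+ 2 = n%:R * (n%:R - 1) * (2 * n%:R - 1) / 6.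
Proof.
elim: n => [|n IH]; first by rewrite big_ord0; field.
by rewrite big_ord_recr /= IH -natr1; field.
Qed.

Lemma geo_sq n t : cabs (geo n t) ^+ 2 =
  \sum_(a < n) \sum_(b < n) cos (2 * pi * (t * (a%:R - b%:R))).
Proof.
have : rc (cabs (geo n t) ^+ 2) = geo n t * (geo n t)^* by rewrite mulcJ.
move=> /(congr1 (fun z => Re z)) /= ->.
rewrite /geo rmorph_sum mulr_suml Re_sum; apply: eq_bigr => a _.
rewrite mulr_sumr Re_sum; apply: eq_bigr => b _.
by rewrite -[X in _ * X]/((cexp (t * b%:R))^*) -cexpN -cexpD -mulrBr.
Qed.

Lemma one_minus_cos_ge (y : R) : `|y| <= 66 / 100 -> y ^+ 2 <= 1 - cos (2 * pi * y).
Proof.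
move=> hy.
wlog y0 : y hy / 0 <= y.
  move=> h; have [/(h _ hy)//|/ltW] := leP 0 y; rewrite -oppr_ge0 => y0.
  by have := h (- y); rewrite normrN sqrrN mulrN cosN; apply.
rewrite ger0_norm // in hy.
have -> : 2 * pi * y = (pi * y) *+ 2 by ring.
rewrite cos_mulr2n -mulr_natl cos2sin2.
have py : 0 <= pi * y by rewrite mulr_ge0 ?pi_ge0.
have hs := sin_ge3 py; have /andP[p1 p2] := @pi2_bounds R.
set s := sin _ in hs *.
have -> : 1 - (2%:R * (1 - s ^+ 2) - 1) = 2 * s ^+ 2 by ring.
have y2 : y ^+ 2 <= 436 / 1000 by rewrite expr2; nra.
have q : (pi : R) ^+ 2 * y ^+ 2 <= 444 / 100.
  apply: (@le_trans _ _ (1016 / 100 * (436 / 1000))); last lra.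
  by apply: ler_pM; rewrite ?sqr_ge0.
(* A lower bound for [1 - pi^2 y^2 / 6], which is at least [1 - 4.44 / 6 = 0.26]. With [pi^2 >= 8],
   the bound [c^2 >= 1/16] makes the final constant [2 * 8 / 16 = 1]. *)
have [c [c0 c2 c1]] : exists c : R, [/\ 0 <= c, 1 / 16 <= c ^+ 2 & c <= 26 / 100].
  by exists (26 / 100); split; rewrite ?expr2; lra.
have h1 : pi * y * c <= s.
  apply: le_trans hs.
  have -> : pi * y - (pi * y) ^+ 3 / 6 = pi * y * (1 - pi ^+ 2 * y ^+ 2 / 6) by ring.
  by apply: (ler_wpM2l py); lra.
have h2 : (pi * y * c) ^+ 2 <= s ^+ 2.
  have h0 : 0 <= pi * y * c by apply: mulr_ge0.
  by rewrite lerXn2r // nnegrE // (le_trans h0).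
have h3 : 8 * y ^+ 2 <= (pi : R) ^+ 2 * y ^+ 2 by apply: ler_wpM2r; rewrite ?sqr_ge0.
have h4 : 8 * y ^+ 2 * (1 / 16) <= pi ^+ 2 * y ^+ 2 * c ^+ 2.
  by have y20 := sqr_ge0 y; apply: ler_pM => //; lra.
move: h2; rewrite !exprMn => h2; lra.
Qed.

(** Replacing every cosine of [geo_sq] by a parabola makes the double sum
    [n^2 - t^2 n^2 (n^2 - 1) / 6]. For [n >= 2], [(n^2 - 1) / 6] is at least [n^2 / 8]. *)
Lemma geo_gap n t : (2 <= n)%N -> n%:R * `|t| <= 66 / 100 ->
  cabs (geo n t) ^+ 2 <= n%:R ^+ 2 * (1 - (n%:R * t) ^+ 2 / 8).
Proof.
move=> n2 nt; rewrite geo_sq.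
have nn : 2 <= n%:R :> R by rewrite ler_nat.
apply: (@le_trans _ _ (\sum_(a < n) \sum_(b < n) (1 - (t * (a%:R - b%:R)) ^+ 2))).
  apply: ler_sum => a _; apply: ler_sum => b _.
  have : `|t * (a%:R - b%:R)| <= 66 / 100.
    apply: le_trans nt; rewrite normrM mulrC ler_wpM2r //.
    have ha : a%:R <= n%:R :> R by rewrite ler_nat ltnW.
    have hb : b%:R <= n%:R :> R by rewrite ler_nat ltnW.
    have ha0 := ler0n R a; have hb0 := ler0n R b.
    by rewrite ler_norml; apply/andP; split; lra.
  by move=> /one_minus_cos_ge; lra.
pose s1 := \sum_(k < n) (k%:R : R); pose s2 := \sum_(k < n) (k%:R : R) ^+ 2.
have inner (a : 'I_n) : \sum_(b < n) (1 - (t * (a%:R - b%:R)) ^+ 2) =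
   n%:R - t ^+ 2 * (n%:R * a%:R ^+ 2 - 2 * a%:R * s1 + s2).
  rewrite (eq_bigr (fun b : 'I_n => 1 - t ^+ 2 * a%:R ^+ 2 + (2 * t ^+ 2 * a%:R) * b%:R - t ^+ 2 * b%:R ^+ 2)); last first.
    by move=> b _; ring.
  rewrite sumrB big_split /= -!mulr_sumr sumr_const card_ord -/s1 -/s2 -mulr_natl.
  ring.
rewrite (eq_bigr _ (fun a _ => inner a)) sumrB -mulr_sumr sumr_const card_ord -mulr_natl.
rewrite big_split sumrB /= -!mulr_sumr -mulr_suml -mulr_sumr sumr_const card_ord -mulr_natl.
rewrite -/s1 -/s2 /s1 /s2 sum_nat_ord sum_sq_ord.
have q0 : 0 <= t ^+ 2 * n%:R ^+ 2 * (n%:R ^+ 2 - 4).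
  apply: mulr_ge0; first by apply: mulr_ge0; exact: sqr_ge0.
  by rewrite subr_ge0 expr2; nra.
rewrite -subr_ge0.
rewrite [leRHS](_ : _ = (t ^+ 2 * n%:R ^+ 2 * (n%:R ^+ 2 - 4)) / 24); last by field.
by apply: divr_ge0.
Qed.

Lemma geo_near n t (x : R) : (2 <= n)%N -> `|t| <= 1 / 2 -> x <= 1 / 20 ->
  n%:R * (1 - x) <= cabs (geo n t) -> (n%:R * t) ^+ 2 <= 16 * x.
Proof.
move=> n2 t2 xs hx.
have np : 0 < n%:R :> R by rewrite ltr0n (leq_trans _ n2).
have [nt|nt] := leP (n%:R * `|t|) (66 / 100).
  have h := geo_gap n2 nt.
  have : (n%:R * (1 - x)) ^+ 2 <= n%:R ^+ 2 * (1 - (n%:R * t) ^+ 2 / 8).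
    apply: le_trans h; rewrite lerXn2r // nnegrE ?cabs_ge0 //.
    by apply: mulr_ge0; [exact: ltW|lra].
  rewrite exprMn ler_pM2l ?exprn_gt0 // => k.
  have := sqr_ge0 x; move: k; rewrite sqrrB expr1n; lra.
(* Outside the range of [geo_gap] the kernel is too small: [2 / 3.2 = 0.625] is less than
   [0.66 * 19/20 = 0.627]. This fixes the constants [66 / 100] and [1 / 20]. *)
have h := geo_decay1 n t2; exfalso.
have h2 : n%:R * (1 - x) * (32 / 10 * `|t|) <= 2.
  apply: le_trans h; apply: ler_wpM2r => //; apply: mulr_ge0 => //; lra.
have : (n%:R * `|t|) * (1 - x) <= 2 / (32 / 10).
  by rewrite ler_pdivlMr; [rewrite (_ : _ * _ = n%:R * (1 - x) * (32 / 10 * `|t|)) //; ring|lra].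
have : 66 / 100 * (19 / 20) <= (n%:R * `|t|) * (1 - x).
  by apply: ler_pM; lra.
lra.
Qed.

Definition dker m t : R[i] :=
  rc (2 * m).+1%:R^-1 * \sum_(k < (2 * m).+1) cexp (t * (k%:R - m%:R)).

Lemma centered_le m (k : 'I_(2 * m).+1) : `|k%:R - m%:R| <= m%:R :> R.
Proof.
rewrite ler_norml lerBlDr lerBrDl subrr ler0n /= -natrD ler_nat addnn -mul2n.
by rewrite -ltnS.
Qed.

(** The trivial bound serves the summand 1, summation by parts the summand [m^2 t^2]. Since [m] is
    at most half the number of points, the constant [32 / 10] of [chord_ge] doubles to [64 / 10]. *)
Lemma average_decay m t (p : nat -> R[i]) (b B : R) : `|t| <= 1 / 2 ->
  (forall k, (k < (2 * m).+1)%N -> cabs (p k) <= b) ->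
  cabs (p 0%N) + cabs (p (2 * m)%N) + \sum_(k < 2 * m) cabs (p k.+1 - p k) <= B ->
  cabs (rc (2 * m).+1%:R^-1 * \sum_(k < (2 * m).+1) p k * cexp (t * (k%:R - m%:R))) ^+ 2
    * (1 + m%:R ^+ 2 * t ^+ 2) <= b ^+ 2 + (B / (64 / 10)) ^+ 2.
Proof.
move=> t2 pb pB.
have N0 : 0 < (2 * m).+1%:R :> R by rewrite ltr0n.
set N : R := (2 * m).+1%:R in N0 *.
have b0 : 0 <= b by apply: le_trans (pb 0%N _); rewrite ?cabs_ge0.
have B0 : 0 <= B.
  apply: le_trans pB; rewrite !addr_ge0 ?cabs_ge0 //.
  by apply: sumr_ge0 => k _; rewrite cabs_ge0.
rewrite cabsM cabs_rc gtr0_norm ?invr_gt0 //; set S := \sum_(k < _) _.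
have S1 : cabs S <= N * b.
  apply: le_trans (cabs_sum _ _ _) _.
  apply: (@le_trans _ _ (\sum_(k < (2 * m).+1) b)).
    by apply: ler_sum => k _; rewrite cabsM cabs_cexp mulr1 pb.
  by rewrite sumr_const card_ord -mulr_natl.
have S2 : cabs S * cabs (1 - cexp t) <= B.
  apply: le_trans pB; apply: le_trans (abel_bound p (2 * m)%N (cabs_cexp t)).
  rewrite ler_wpM2r ?cabs_ge0 //.
  have -> : S = cexp (- (t * m%:R)) * \sum_(k < (2 * m).+1) p k * cexp t ^+ k.
    rewrite mulr_sumr; apply: eq_bigr => k _.
    by rewrite mulrBr addrC cexpD cexpM_nat mulrCA.
  by rewrite cabsM cabs_cexp mul1r.
have S3 : cabs S * (32 / 10 * `|t|) <= B.
  by apply: le_trans S2; rewrite ler_wpM2l ?cabs_ge0 // chord_ge.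
move: (cabs S) (cabs_ge0 S) S1 S3 => {S S2} x x0 S1 S3.
have h1 : N^-1 * x <= b by rewrite ler_pdivrMl.
have N2m : 2 * m%:R <= N by rewrite /N odd_nat lerDl.
have h2 : N^-1 * x * (m%:R * `|t|) <= B / (64 / 10).
  rewrite -mulrA ler_pdivrMl //.
  have : x * (m%:R * `|t|) <= x * (N / 2 * `|t|).
    by apply: (ler_wpM2l x0); apply: ler_wpM2r => //; lra.
  move=> /le_trans; apply.
  have -> : x * (N / 2 * `|t|) = N * (x * (32 / 10 * `|t|) / (64 / 10)) by field.
  by apply: ler_wpM2l; [exact: ltW|apply: ler_wpM2r => //; rewrite invr_ge0; lra].
rewrite mulrDr mulr1; apply: lerD.
  by rewrite lerXn2r // nnegrE ?mulr_ge0 // invr_ge0 ltW.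
rewrite -(real_normK (num_real t)) -!exprMn lerXn2r // nnegrE.
  by rewrite !mulr_ge0 // ?invr_ge0 ltW.
by apply: divr_ge0 => //; lra.
Qed.

Lemma pi2_le : 2 * (pi : R) <= 64 / 10.
Proof. by have /andP[_ h] := @pi_bounds R; lra. Qed.

Lemma chord_le_num e : cabs (1 - cexp e) <= 64 / 10 * `|e|.
Proof. by apply: le_trans (chord_le e) _; apply: ler_wpM2r => //; exact: pi2_le. Qed.

Lemma phase_step e m k :
  cabs (cexp (e * (k.+1%:R - m%:R)) - cexp (e * (k%:R - m%:R))) <= 64 / 10 * `|e|.
Proof.
rewrite -natr1 addrAC mulrDr mulr1 cexpD -[X in _ - X]mulr1 -mulrBr cabsM cabs_cexp mul1r.
by rewrite -cabsN opprB chord_le_num.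
Qed.

(** The shift [e] is moved into the coefficients, whose variation is of order [m |e|]. The decay is
    then in [t], even if [t + e] leaves [[-1/2, 1/2]]. *)
Lemma dker_decay m t e : `|t| <= 1 / 2 -> m%:R * `|e| <= 1 / 64 ->
  cabs (dker m (t + e)) ^+ 2 * (1 + m%:R ^+ 2 * t ^+ 2) <= 2.
Proof.
move=> t2 me.
have := @average_decay m t (fun k => cexp (e * (k%:R - m%:R))) 1 (22 / 10) t2.
rewrite (_ : rc _ * _ = dker m (t + e)); last first.
  congr (_ * _); apply: eq_bigr => k _.
  by rewrite mulrDl cexpD mulrC.
move=> h; apply: le_trans (h _ _) _; last lra.
  by move=> k _; rewrite cabs_cexp.
rewrite !cabs_cexp.
apply: (@le_trans _ _ (1 + 1 + \sum_(k < 2 * m) (64 / 10 * `|e|))).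
  by rewrite lerD2l; apply: ler_sum => k _; exact: phase_step.
rewrite [X in _ + X](_ : _ = 128 / 10 * (m%:R * `|e|)).
  lra.
by rewrite sumr_const card_ord -[_ *+ (2 * m)]mulr_natl natrM; field.
Qed.

(** The difference is a kernel with coefficients [cexp (e * _) - 1], whose size and variation are
    both of order [m |e|]: a Lipschitz bound that keeps the decay, without derivatives. *)
Lemma dker_diff m t e : `|t| <= 1 / 2 ->
  cabs (dker m (t + e) - dker m t) ^+ 2 * (1 + m%:R ^+ 2 * t ^+ 2) <= 100 * (m%:R * e) ^+ 2.
Proof.
move=> t2; set x := m%:R * `|e|.
have := @average_decay m t (fun k => cexp (e * (k%:R - m%:R)) - 1) (64 / 10 * x) (256 / 10 * x) t2.
rewrite (_ : rc _ * _ = dker m (t + e) - dker m t); last first.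
  rewrite -mulrBr -sumrB; congr (_ * _); apply: eq_bigr => k _.
  by rewrite mulrBl mul1r -cexpD -mulrDl [e + t]addrC.
have pb k : (k < (2 * m).+1)%N -> cabs (cexp (e * (k%:R - m%:R)) - 1) <= 64 / 10 * x.
  move=> km; rewrite -cabsN opprB; apply: le_trans (chord_le_num _) _.
  apply: ler_wpM2l; first lra; rewrite normrM mulrC ler_wpM2r //.
  exact: (centered_le (Ordinal km)).
move=> h; apply: le_trans (h pb _) _.
  apply: (@le_trans _ _ (64 / 10 * x + 64 / 10 * x + \sum_(k < 2 * m) (64 / 10 * `|e|))).
    apply: lerD; first by apply: lerD; apply: pb.
    apply: ler_sum => k _; rewrite opprB addrA subrK; exact: phase_step.
  rewrite [X in _ + X](_ : _ = 128 / 10 * x).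
    have x0 : 0 <= x by rewrite mulr_ge0.
    lra.
  by rewrite sumr_const card_ord -[_ *+ (2 * m)]mulr_natl natrM /x; field.
have -> : (m%:R * e) ^+ 2 = x ^+ 2.
  by rewrite /x !exprMn real_normK ?num_real.
have -> : (64 / 10 * x) ^+ 2 + (256 / 10 * x / (64 / 10)) ^+ 2 = (4096 / 100 + 16) * x ^+ 2 by field.
by apply: ler_wpM2r; [exact: sqr_ge0|lra].
Qed.

End Kernels.

(** * The real Dirichlet kernel and its derivative near the origin *)

Section Dirichlet.
Variable R : realType.
Implicit Types (t e : R) (m n : nat).

Definition dk m t : R :=
  (2 * m).+1%:R^-1 * \sum_(k < (2 * m).+1) cos (2 * pi * (t * (k%:R - m%:R))).

(** Up to the factor [- 2 pi], the derivative of [dk]. *)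
Definition ddk m t : R :=
  (2 * m).+1%:R^-1 * \sum_(k < (2 * m).+1) (k%:R - m%:R) * sin (2 * pi * (t * (k%:R - m%:R))).

Lemma odd_sum m (F : R -> R) : (forall x, F (- x) = - F x) ->
  \sum_(k < (2 * m).+1) F (k%:R - m%:R) = 0.
Proof.
move=> Fodd; set S := \sum_(_ < _) _.
suff : S = - S by lra.
rewrite {1}/S (reindex_inj rev_ord_inj) /S -sumrN; apply: eq_bigr => k _.
rewrite -Fodd; congr F; rewrite /= subSS natrB; last by rewrite -ltnS.
rewrite natrM; lra.
Qed.

Lemma dkerE m t : dker m t = rc (dk m t).
Proof.
have N0 : rc (2 * m).+1%:R^-1 != 0 :> R[i].
  by rewrite eq_complex /= eqxx andbT invr_eq0 pnatr_eq0.
rewrite /dker /dk rcM; congr (_ * _); apply/eqP; rewrite eq_complex Re_sum Im_sum /=.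
rewrite eqxx (odd_sum m (F := fun x => sin (2 * pi * (t * x)))) ?eqxx // => x.
by rewrite !mulrN sinN.
Qed.

Lemma ddkE m t :
  rc (2 * m).+1%:R^-1 * \sum_(k < (2 * m).+1) rc (k%:R - m%:R) * cexp (t * (k%:R - m%:R))
  = Complex 0 (ddk m t) :> R[i].
Proof.
apply/eqP; rewrite eq_complex Re_rcM Im_rcM Re_sum Im_sum.
rewrite (eq_bigr (fun k : 'I__ => (k%:R - m%:R) * cos (2 * pi * (t * (k%:R - m%:R))))); last first.
  by move=> k _; rewrite Re_rcM.
rewrite (odd_sum m (F := fun x => x * cos (2 * pi * (t * x)))); last first.
  by move=> x; rewrite !mulrN cosN mulNr.
rewrite mulr0 eqxx /ddk /=; apply/eqP; congr (_ * _).
by apply: eq_bigr => k _; rewrite /= mul0r addr0.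
Qed.

Lemma average_le m (f : 'I_(2 * m).+1 -> R) b : (forall k, f k <= b) ->
  (2 * m).+1%:R^-1 * \sum_k f k <= b.
Proof.
move=> fb; rewrite ler_pdivrMl ?ltr0n //.
apply: (@le_trans _ _ (\sum_(k < (2 * m).+1) b)); first by apply: ler_sum => k _.
by rewrite sumr_const card_ord mulr_natl.
Qed.

Lemma average_ge m (f : 'I_(2 * m).+1 -> R) b : (forall k, b <= f k) ->
  b <= (2 * m).+1%:R^-1 * \sum_k f k.
Proof.
move=> fb; rewrite ler_pdivlMl ?ltr0n //.
apply: (@le_trans _ _ (\sum_(k < (2 * m).+1) b)); last by apply: ler_sum => k _.
by rewrite sumr_const card_ord mulr_natl.
Qed.

Lemma dk_le1 m t : dk m t <= 1.
Proof. by apply: average_le => k; exact: cos_le1. Qed.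

Lemma centered_sq m (k : 'I_(2 * m).+1) : (k%:R - m%:R) ^+ 2 <= m%:R ^+ 2 :> R.
Proof.
by rewrite -(real_normK (num_real _)) lerXn2r // ?nnegrE // centered_le.
Qed.

Lemma dk_ge m t : 1 - 21 * (m%:R * t) ^+ 2 <= dk m t.
Proof.
apply: average_ge => k; apply: le_trans (cos_ge2 _); rewrite lerD2l lerN2.
have /andP[_ p2] := @pi2_bounds R.
have -> : (2 * pi * (t * (k%:R - m%:R))) ^+ 2 / 2 = 2 * pi ^+ 2 * (t ^+ 2 * (k%:R - m%:R) ^+ 2) by field.
rewrite [(m%:R * t) ^+ 2]exprMn [_ ^+ 2 * t ^+ 2]mulrC; apply: ler_pM.
- by have := sqr_ge0 (pi : R); lra.
- by apply: mulr_ge0; exact: sqr_ge0.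
- lra.
by apply: ler_wpM2l; [exact: sqr_ge0 | exact: centered_sq].
Qed.

(** Minus the second derivative of [dk] at 0: [4 pi^2] times the second moment of the uniform law on
    [{-m, ..., m}]. *)
Definition mu m : R := 4 * pi ^+ 2 * (m%:R * (m%:R + 1) / 3).

Lemma second_moment m :
  (2 * m).+1%:R^-1 * \sum_(k < (2 * m).+1) (k%:R - m%:R) ^+ 2 = m%:R * (m%:R + 1) / 3 :> R.
Proof.
have N0 : (2 * m).+1%:R != 0 :> R by rewrite pnatr_eq0.
apply: (mulfI N0); rewrite mulVKf //.
rewrite (eq_bigr (fun k : 'I__ => k%:R ^+ 2 - 2 * m%:R * k%:R + m%:R ^+ 2)); last first.
  by move=> k _; ring.
rewrite big_split sumrB /= -mulr_sumr sum_nat_ord sum_sq_ord sumr_const card_ord.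
by rewrite -[_ *+ _.+1]mulr_natl odd_nat; field.
Qed.

Lemma ddk_approx m t : `|2 * pi * ddk m t - mu m * t| <= 280 * m%:R ^+ 4 * `|t| ^+ 3.
Proof.
have -> : 2 * pi * ddk m t - mu m * t = (2 * m).+1%:R^-1 * \sum_(k < (2 * m).+1)
   2 * pi * (k%:R - m%:R) * (sin (2 * pi * (t * (k%:R - m%:R))) - 2 * pi * (t * (k%:R - m%:R))).
  rewrite /mu -second_moment /ddk.
  rewrite [in RHS](eq_bigr (fun k : 'I__ => 2 * pi * ((k%:R - m%:R) * sin (2 * pi * (t * (k%:R - m%:R)))) - 4 * pi ^+ 2 * t * (k%:R - m%:R) ^+ 2)); last first.
    by move=> k _; ring.
  by rewrite sumrB -!mulr_sumr; ring.
apply: le_trans (_ : (2 * m).+1%:R^-1 * \sum_(k < (2 * m).+1) `|2 * pi * (k%:R - m%:R) * (sin (2 * pi * (t * (k%:R - m%:R))) - 2 * pi * (t * (k%:R - m%:R)))| <= _).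
  by rewrite normrM ger0_norm ?invr_ge0 ?ler0n // ler_wpM2l ?invr_ge0 ?ler0n // ler_norm_sum.
apply: average_le => k; rewrite normrM.
have /andP[p1 p2] := @pi2_bounds R; have p0 := @pi_ge0 R.
set c := k%:R - m%:R; have cm : `|c| <= m%:R by exact: centered_le.
apply: (@le_trans _ _ (`|2 * pi * c| * (`|2 * pi * (t * c)| ^+ 3 / 6))).
  by apply: ler_wpM2l => //; exact: sin_bound.
rewrite !normrM !(ger0_norm p0) (ger0_norm (_ : 0 <= 2)); last lra.
have -> : 2 * pi * `|c| * ((2 * pi * (`|t| * `|c|)) ^+ 3 / 6) =
  (8 / 3) * (pi ^+ 2 * pi ^+ 2) * (`|c| ^+ 4 * `|t| ^+ 3) by field.
rewrite -[leRHS]mulrA; apply: ler_pM.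
- by apply: mulr_ge0; [lra|apply: mulr_ge0; exact: sqr_ge0].
- by apply: mulr_ge0; apply: exprn_ge0.
- have : (pi : R) ^+ 2 * pi ^+ 2 <= 1016 / 100 * (1016 / 100).
    by apply: ler_pM; rewrite ?sqr_ge0.
  move: (_ * _) => x hx; lra.
by apply: ler_wpM2r; [exact: exprn_ge0|rewrite lerXn2r // nnegrE].
Qed.

Lemma mu_bounds m : (1 <= m)%N -> 10 * m%:R ^+ 2 <= mu m <= 28 * m%:R ^+ 2.
Proof.
move=> m1; have m1' : 1 <= m%:R :> R by rewrite ler1n.
have /andP[p1 p2] := @pi2_bounds R; rewrite /mu.
have h1 : m%:R ^+ 2 <= m%:R * (m%:R + 1) :> R by rewrite expr2; nra.
have h2 : m%:R * (m%:R + 1) <= 2 * m%:R ^+ 2 :> R by rewrite expr2; nra.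
have h0 := sqr_ge0 (m%:R : R).
move: (m%:R * (m%:R + 1)) (m%:R ^+ 2) h0 h1 h2 (pi ^+ 2) p1 p2 => a b b0 ab ab2 p p1 p2.
apply/andP; split.
  apply: (@le_trans _ _ (4 * 8 * (a / 3))); first lra.
  by apply: ler_wpM2r; lra.
apply: (@le_trans _ _ (4 * (1016 / 100) * (a / 3))); last lra.
by apply: ler_wpM2r; lra.
Qed.

End Dirichlet.

(** * The torus *)

Section TorusGeometry.
Variables (R : realType) (d : nat).
Implicit Types (w v : 'rV[R]_d) (z : 'rV[int]_d).

Local Notation en := (@euclidean_norm R d).
Local Notation iz := (map_mx (intr : int -> R)).

Lemma en_nrm w : en w = nrm (map_mx (@rc R) w).
Proof.
rewrite /nrm ip_self /euclidean_norm; congr Num.sqrt; apply: eq_bigr => i _.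
by rewrite mxE cabs_rc real_normK ?num_real.
Qed.

Lemma en_ge0 w : 0 <= en w. Proof. exact: sqrtr_ge0. Qed.
Lemma en2 w : en w ^+ 2 = \sum_i w 0 i ^+ 2.
Proof. by rewrite sqr_sqrtr // sumr_ge0 // => i _; rewrite sqr_ge0. Qed.

Lemma map_rcD w v : map_mx (@rc R) (w + v) = map_mx (@rc R) w + map_mx (@rc R) v.
Proof. by apply/rowP => i; rewrite !mxE rcD. Qed.

Lemma enD w v : en (w + v) <= en w + en v.
Proof. by rewrite !en_nrm map_rcD nrmD. Qed.

Lemma enN w : en (- w) = en w.
Proof. by rewrite /euclidean_norm; congr Num.sqrt; apply: eq_bigr => i _; rewrite mxE sqrrN. Qed.

Lemma enB w v : en (w - v) <= en w + en v.
Proof. by rewrite -(enN v) enD. Qed.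

Lemma enZ (t : R) w : en (t *: w) = `|t| * en w.
Proof.
rewrite -sqrtr_sqr /euclidean_norm -sqrtrM ?sqr_ge0 //; congr Num.sqrt.
by rewrite mulr_sumr; apply: eq_bigr => i _; rewrite mxE exprMn.
Qed.

Lemma en0 : en 0 = 0.
Proof. by rewrite -(scale0r (0 : 'rV[R]_d)) enZ normr0 mul0r. Qed.

Lemma en_eq0 w : en w = 0 -> w = 0.
Proof.
move=> h; have := en2 w; rewrite h expr0n /= => /esym/eqP.
rewrite psumr_eq0 => [/allP u|i _]; last exact: sqr_ge0.
apply/rowP => i; rewrite mxE; apply/eqP.
by have := u i (mem_index_enum _); rewrite expf_eq0.
Qed.

Lemma en_coord w i : `|w 0 i| <= en w.
Proof.
rewrite -sqrtr_sqr ler_wsqrtr // (bigD1 i) //= lerDl.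
by apply: sumr_ge0 => j _; rewrite sqr_ge0.
Qed.

Lemma en_le w v : (forall i, `|w 0 i| <= `|v 0 i|) -> en w <= en v.
Proof.
move=> h; apply: ler_wsqrtr; apply: ler_sum => i _.
by rewrite -[leLHS](real_normK (num_real _)) -[leRHS](real_normK (num_real _)) lerXn2r ?nnegrE.
Qed.

Lemma en_sum_le w : en w <= \sum_i `|w 0 i|.
Proof.
rewrite -(@ler_pXn2r _ 2) ?nnegrE ?en_ge0 ?sumr_ge0 // en2.
rewrite expr2 mulr_suml; apply: ler_sum => i _.
rewrite -(real_normK (num_real _)) expr2 ler_wpM2l //.
by rewrite (bigD1 i) //= lerDl sumr_ge0.
Qed.

Definition dot w v : R := \sum_i w 0 i * v 0 i.

Lemma dot_ip w v : dot w v = ip (map_mx (@rc R) w) (map_mx (@rc R) v).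
Proof.
rewrite /ip /hd Re_sum; apply: eq_bigr => i _.
by rewrite !mxE conjCE ReM /= mul0r subr0.
Qed.

Lemma dot_le w v : dot w v <= en w * en v.
Proof. by rewrite dot_ip !en_nrm ip_le. Qed.
Lemma dotC w v : dot w v = dot v w.
Proof. by apply: eq_bigr => i _; rewrite mulrC. Qed.
Lemma dotDl w w' v : dot (w + w') v = dot w v + dot w' v.
Proof. by rewrite /dot -big_split; apply: eq_bigr => i _; rewrite mxE mulrDl. Qed.
Lemma dotZl (t : R) w v : dot (t *: w) v = t * dot w v.
Proof. by rewrite /dot mulr_sumr; apply: eq_bigr => i _; rewrite mxE mulrA. Qed.
Lemma dot_self w : dot w w = en w ^+ 2.
Proof. by rewrite en2. Qed.
Lemma enD2 w v : en (w + v) ^+ 2 = en w ^+ 2 + 2 * dot w v + en v ^+ 2.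
Proof.
by rewrite -!dot_self dotDl ![dot _ (w + v)]dotC !dotDl [dot v w]dotC; ring.
Qed.

Definition rnd (x : R) : int := Num.floor (x + 1 / 2).

Lemma rnd_half x : `|x - (rnd x)%:~R| <= 1 / 2.
Proof.
have := Num.Theory.floor_le (x + 1 / 2); have := Num.Theory.floorD1_gt (x + 1 / 2).
rewrite -/(rnd x) intrD => h1 h2; rewrite ler_norml; apply/andP; split; lra.
Qed.

Lemma rnd_best x (z : int) : `|x - (rnd x)%:~R| <= `|x - z%:~R|.
Proof.
have [->//|zr] := eqVneq z (rnd x).
apply: le_trans (rnd_half x) _.
have : 1 <= `|(z - rnd x)%:~R : R|.
  by rewrite -intr_norm -[1]/(1%:~R) ler_int -gtz0_ge1 normr_gt0 subr_eq0.
rewrite intrB; have := rnd_half x.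
have -> : z%:~R - (rnd x)%:~R = (x - (rnd x)%:~R) - (x - z%:~R) :> R by ring.
have := ler_normB (x - (rnd x)%:~R) (x - z%:~R).
lra.
Qed.

Definition red w : 'rV[R]_d := w - iz (map_mx rnd w).

Lemma redE w i : red w 0 i = w 0 i - (rnd (w 0 i))%:~R.
Proof. by rewrite !mxE. Qed.

Lemma red_half w i : `|red w 0 i| <= 1 / 2.
Proof. by rewrite redE rnd_half. Qed.

Lemma torus_norm_le w z : torus_norm w <= en (w + iz z).
Proof.
apply: ge_inf; last by exists z.
by exists 0 => _ [x _ <-]; exact: en_ge0.
Qed.

(** The Euclidean norm is monotone in the absolute value of each coordinate, so rounding every
    coordinate attains the infimum. *)
Lemma torus_normE w : torus_norm w = en (red w).
Proof.
apply/eqP; rewrite eq_le; apply/andP; split.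
  rewrite /red; have -> : - iz (map_mx rnd w) = iz (- map_mx rnd w).
    by apply/rowP => i; rewrite !mxE intrN.
  exact: torus_norm_le.
apply: lb_le_inf; first by exists (en (w + iz 0)); exists 0.
move=> _ [z _ <-]; apply: en_le => i; rewrite redE mxE [iz z 0 i]mxE.
by have := rnd_best (w 0 i) (- z 0 i); rewrite intrN opprK.
Qed.

Lemma torus_lift w : exists z, torus_norm w = en (w + iz z).
Proof.
exists (- map_mx rnd w); rewrite torus_normE; congr en.
by apply/rowP => i; rewrite !mxE intrN.
Qed.

Lemma torus_normD w v : torus_norm (w + v) <= torus_norm w + torus_norm v.
Proof.
have [z ->] := torus_lift w; have [z' ->] := torus_lift v.
apply: le_trans (enD _ _).
have -> : w + iz z + (v + iz z') = w + v + iz (z + z').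
  by apply/rowP => i; rewrite !mxE intrD; ring.
exact: torus_norm_le.
Qed.

Lemma torus_normN w : torus_norm (- w) = torus_norm w.
Proof.
have h v : torus_norm (- v) <= torus_norm v.
  have [z ->] := torus_lift v; rewrite -enN.
  have -> : - (v + iz z) = - v + iz (- z).
    by apply/rowP => i; rewrite !mxE intrN; ring.
  exact: torus_norm_le.
by apply/eqP; rewrite eq_le h -{1}(opprK w) h.
Qed.

Lemma torus_dist_sym w v : torus_dist w v = torus_dist v w.
Proof. by rewrite /torus_dist -torus_normN opprB. Qed.

Lemma torus_dist_tri w v u : torus_dist w u <= torus_dist w v + torus_dist v u.
Proof.
rewrite /torus_dist; have -> : w - u = (w - v) + (v - u) by rewrite addrA subrK.
exact: torus_normD.
Qed.

Lemma torus_dist_ge0 w v : 0 <= torus_dist w v.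
Proof. by rewrite /torus_dist torus_normE en_ge0. Qed.

Lemma torus_norm_bounded w : torus_norm w <= d%:R.
Proof.
rewrite torus_normE (le_trans (en_sum_le _)) //.
apply: (@le_trans _ _ (\sum_(i < d) 1)).
  by apply: ler_sum => i _; apply: le_trans (red_half _ _) _; lra.
by rewrite sumr_const card_ord.
Qed.

End TorusGeometry.

(** * Separated points *)

Section Packing.
Variable R : realType.

Lemma sum_inv_sq K : \sum_(n < K.+1 | (0 < n)%N) (n%:R ^+ 2)^-1 <= 2 :> R.
Proof.
case: K => [|K]; first by rewrite big_mkcond big_ord1 /=.
apply: (@le_trans _ _ (2 - K.+1%:R^-1)); last by rewrite gerBl invr_ge0 ler0n.
elim: K => [|K IH].
  by rewrite big_mkcond !big_ord_recl big_ord0 /= expr1n invr1; lra.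
rewrite big_mkcond big_ord_recr /= -big_mkcond /=.
apply: le_trans (lerD IH (lexx _)) _.
have k0 : 0 < K.+1%:R :> R by rewrite ltr0n.
have -> : K.+2%:R = K.+1%:R + 1 :> R by rewrite natr1.
move: (K.+1%:R) k0 => x x0.
rewrite -subr_ge0 [leRHS](_ : _ = (x * (x + 1) ^+ 2)^-1).
  by rewrite invr_ge0 mulr_ge0 ?sqr_ge0 // ltW.
by field; rewrite !gt_eqF //; lra.
Qed.

Lemma sum_injection (I T : finType) (P : pred I) (Q : pred T) (h : I -> T) (F : T -> R) :
  {in P &, injective h} -> (forall i, P i -> Q (h i)) -> (forall t, Q t -> 0 <= F t) ->
  \sum_(i | P i) F (h i) <= \sum_(t | Q t) F t.
Proof.
move=> hinj hQ F0; pose A := [set i | P i]%SET.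
have -> : \sum_(i | P i) F (h i) = \sum_(i in A) F (h i).
  by apply: eq_bigl => i; rewrite inE.
rewrite -(@big_imset _ _ _ _ _ h A F) /=; last first.
  by move=> i j; rewrite !inE => iP jP; exact: hinj.
rewrite [leRHS](bigID (fun t => t \in h @: A)) /=.
rewrite (eq_bigl (fun t => Q t && (t \in h @: A)%SET)) => [|t].
  by rewrite lerDl sumr_ge0 // => t /andP[Qt _]; exact: F0.
apply/idP/andP => [tA|[] //]; split => //.
by case/imsetP: tA => i; rewrite inE => iP ->; exact: hQ.
Qed.

(** By convexity the power lies below its chord between [S = 0] and [S = 1]. *)
Lemma expr_convex (S : R) n : 0 <= S <= 1 -> (1 + S) ^+ n <= 1 + S * 2 ^+ n.
Proof.
move=> /andP[S0 S1]; suff : (1 + S) ^+ n <= 1 + S * (2 ^+ n - 1) by lra.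
elim: n => [|n IH]; first by rewrite !expr0; lra.
rewrite !exprS; apply: le_trans (ler_wpM2l _ IH) _; first lra.
have : 1 <= 2 ^+ n :> R by rewrite exprn_ege1 // ler1n.
move: (2 ^+ n) => a a1.
have : S * S * (a - 1) <= S * 1 * (a - 1) by apply: ler_wpM2r; [lra|apply: ler_wpM2l].
by rewrite mulr1 => h; rewrite -subr_ge0; nra.
Qed.

Variable d : nat.
Implicit Types (v w : 'rV[R]_d).

Definition decay (m : nat) v : R := \prod_(i < d) (1 + m%:R ^+ 2 * v 0 i ^+ 2)^-1.

Lemma decay_factor_gt0 m v i : 0 < 1 + m%:R ^+ 2 * v 0 i ^+ 2 :> R.
Proof. by rewrite ltr_pwDl // mulr_ge0 ?sqr_ge0. Qed.

Lemma decay_ge0 m v : 0 <= decay m v.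
Proof. by apply: prodr_ge0 => i _; rewrite invr_ge0 ltW // decay_factor_gt0. Qed.

(* Rounding [v j] to a cell of side of order [sep] is injective, and the weights of
   the nonzero cells sum to a multiple of a negative power of [sep]. *)
Lemma packing (kappa : R) : 0 < kappa -> exists2 sep0 : R, 0 < sep0 &
  forall (sep : R) (m : nat) (J : finType) (P : pred J) (v : J -> 'rV[R]_d),
  sep0 <= sep ->
  (forall j k, P j -> P k -> j != k -> sep <= m%:R * euclidean_norm (v j - v k)) ->
  (forall j, P j -> sep / 2 <= m%:R * euclidean_norm (v j)) ->
  \sum_(j | P j) decay m (v j) <= kappa.
Proof.
move=> k0; pose D : R := 4 ^+ d; have D0 : 0 < D by rewrite exprn_gt0.
(* The weights outside the cell of the origin will sum to at most [D * S] with [S <= 8 / L]. The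
   summand [8 * D / kappa] brings this below [kappa], the summand 8 ensures [S <= 1]. *)
pose L0 := 8 + 8 * D / kappa.
have L08 : 8 <= L0 by rewrite lerDl divr_ge0 ?mulr_ge0 // ltW.
exists (2 * d.+1%:R * L0) => [|sep m J P v seph vsep vorig].
  by apply: mulr_gt0; [apply: mulr_gt0; rewrite ?ltr0n|lra].
(* The side of the cells. Two points of one cell are at scaled distance at most
   [d.+1 * L = sep / 2], less than the separation; [d.+1] instead of [d] avoids a division by
   zero. *)
pose L := sep / (2 * d.+1%:R).
have dd0 : 0 < 2 * d.+1%:R :> R by apply: mulr_gt0; rewrite ?ltr0n.
have LL0 : L0 <= L by rewrite ler_pdivlMr // mulrC.
have L0' : 0 < L by lra.
have sepE : sep = 2 * d.+1%:R * L by rewrite /L mulrC divfK // gt_eqF.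
have enL w (b : R) : (forall i, `|w 0 i| <= b) -> 0 <= b -> euclidean_norm w <= d.+1%:R * b.
  move=> wb b0; apply: le_trans (en_sum_le _) _.
  apply: (@le_trans _ _ (\sum_(i < d) b)); first by apply: ler_sum.
  by rewrite sumr_const card_ord -[b *+ d]mulr_natl; apply: ler_wpM2r => //; rewrite ler_nat.
pose c j i : int := rnd (m%:R * v j 0 i / L).
have ch j i : `|m%:R * v j 0 i - L * (c j i)%:~R| <= L / 2.
  have := rnd_half (m%:R * v j 0 i / L); rewrite -/(c j i) => h.
  have -> : m%:R * v j 0 i - L * (c j i)%:~R = L * (m%:R * v j 0 i / L - (c j i)%:~R).
    by field; rewrite gt_eqF.
  by rewrite normrM gtr0_norm //; apply: le_trans (ler_wpM2l (ltW L0') h) _; lra.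
pose K := (\max_(j : J) \max_(i < d) `|c j i|%N)%N.
have cK j i : (`|c j i|%N < K.+1)%N.
  by rewrite ltnS; apply: leq_trans (leq_bigmax j); exact: (leq_bigmax i).
pose T := {ffun 'I_d -> 'I_K.+1 * bool}.
(* A finite code of the cell by absolute values and signs. A zero coordinate gets two codes, whence
   the factor 2 in [gsum] and [csum]. *)
pose code j : T := [ffun i => (inord `|c j i|%N, c j i < 0)].
pose g (n : nat) : R := if n == 0%N then 1 else 4 / L ^+ 2 * (n%:R ^+ 2)^-1.
have g0 n : 0 <= g n.
  rewrite /g; case: eqP => // _; apply: mulr_ge0; last by rewrite invr_ge0 sqr_ge0.
  by rewrite divr_ge0 ?sqr_ge0.
pose F (f : T) : R := \prod_i g (f i).1.
have F0 f : 0 <= F f by apply: prodr_ge0.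
have wt j i : (1 + m%:R ^+ 2 * v j 0 i ^+ 2)^-1 <= g `|c j i|%N.
  rewrite /g absz_eq0; have [c0|c0] := eqVneq (c j i) 0.
    by rewrite invf_le1 ?decay_factor_gt0 // lerDl mulr_ge0 ?sqr_ge0.
  have n1 : 1 <= `|c j i|%:R :> R by rewrite ler1n absz_gt0.
  set n : R := `|c j i|%:R in n1 *.
  have nE : n = `|(c j i)%:~R| by rewrite /n natr_absz intr_norm.
  have h : L * n / 2 <= `|m%:R * v j 0 i|.
    have := ch j i; have : L * n = `|L * (c j i)%:~R| by rewrite normrM nE gtr0_norm.
    have := ler_normB (m%:R * v j 0 i) (m%:R * v j 0 i - L * (c j i)%:~R).
    rewrite opprB addrC subrK => h1 h2 h3.
    have : L <= L * n by rewrite ler_peMr // ltW.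
    by move: h1 h3; rewrite h2; lra.
  have Ln0 : 0 < L * n by apply: mulr_gt0 => //; lra.
  have -> : 4 / L ^+ 2 * (n ^+ 2)^-1 = ((L * n / 2) ^+ 2)^-1.
    by field; rewrite !gt_eqF //; lra.
  rewrite lef_pV2 ?posrE ?decay_factor_gt0 ?exprn_gt0 //; last lra.
  rewrite -exprMn -(real_normK (num_real (_ * v j 0 i))).
  apply: (@le_trans _ _ (`|m%:R * v j 0 i| ^+ 2)); last by rewrite lerDr.
  by rewrite lerXn2r // nnegrE //; lra.
(* The cell of the origin, which has weight 1: no point is in it, since all points are at scaled
   distance at least [sep / 2] from the origin. Its contribution [2 ^+ d] is what [coreE]
   subtracts. *)
pose core (f : T) := [forall i, ((f i).1 : nat) == 0%N].
have codeE j i : ((code j i).1 : nat) = `|c j i|%N by rewrite ffunE /= inordK.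
apply: (@le_trans _ _ (\sum_(f : T | ~~ core f) F f)).
  apply: (@le_trans _ _ (\sum_(j | P j) F (code j))).
    apply: ler_sum => j _; apply: ler_prod => i _.
    by rewrite invr_ge0 ltW ?decay_factor_gt0 // codeE wt.
  apply: sum_injection => // [j k jP kP jk|j jP].
    apply/eqP; apply/negP => /negP njk; have := vsep j k jP kP njk.
    have -> : m%:R * euclidean_norm (v j - v k) = euclidean_norm (m%:R *: (v j - v k)).
      by rewrite enZ ger0_norm.
    have cE i : c j i = c k i.
      have := congr1 (fun f : T => (f i).2) jk; have : (code j i).1 = (code k i).1 by rewrite jk.
      rewrite !ffunE /= => /(congr1 val); rewrite /= !inordK // => h1 h2.
      by rewrite (intEsign (c j i)) (intEsign (c k i)) h1 h2.
    rewrite leNgt => /negP; apply; apply: (@le_lt_trans _ _ (d.+1%:R * L)).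
      apply: enL => [i|]; last exact: ltW.
      have := ch j i; have := ch k i; rewrite cE !mxE mulrBr => h1 h2.
      have := ler_normB (m%:R * v j 0 i - L * (c k i)%:~R) (m%:R * v k 0 i - L * (c k i)%:~R).
      rewrite opprB addrA subrK; lra.
    by rewrite sepE -mulrA ltr_pMl ?ltr1n // mulr_gt0 ?ltr0n.
  apply/negP => /forallP h; have := vorig j jP.
  have -> : m%:R * euclidean_norm (v j) = euclidean_norm (m%:R *: v j).
    by rewrite enZ ger0_norm.
  rewrite leNgt => /negP; apply; apply: (@le_lt_trans _ _ (d.+1%:R * (L / 2))).
    apply: enL => [i|]; last lra.
    have := h i; rewrite codeE absz_eq0 => /eqP c0; have := ch j i.
    by rewrite c0 mulr0 subr0 mxE.
  have dL : 0 < d.+1%:R * L by rewrite mulr_gt0 ?ltr0n.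
  rewrite sepE; lra.
pose S := \sum_(n < K.+1 | (0 < n)%N) 4 / L ^+ 2 * ((n : nat)%:R ^+ 2)^-1.
have gsum : \sum_(x : 'I_K.+1 * bool) g x.1 = 2 * (1 + S).
  rewrite -(pair_bigA _ (fun (n : 'I_K.+1) (b : bool) => g n)) /=.
  rewrite (eq_bigr (fun n : 'I_K.+1 => 2 * g n)) => [|n _]; last first.
    by rewrite sumr_const card_bool mulr_natl.
  rewrite -mulr_sumr (bigID (fun n : 'I_K.+1 => (n : nat) == 0%N)) /=; congr (2 * (_ + _)).
    rewrite (big_pred1 ord0) => [|n]; last by [].
    by [].
  by apply: eq_big => [n|n]; rewrite ?lt0n // => /negbTE n0; rewrite /g n0.
have csum : \sum_(x : 'I_K.+1 * bool | (x.1 : nat) == 0%N) g x.1 = 2.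
  transitivity (\sum_(n < K.+1 | (n : nat) == 0%N) \sum_(b : bool) g n).
    by rewrite pair_big; apply: eq_bigl => x; rewrite andbT.
  rewrite (big_pred1 ord0) => [|n]; last by [].
  by rewrite sumr_const card_bool.
have allE : \sum_(f : T) F f = (2 * (1 + S)) ^+ d.
  rewrite -(bigA_distr_bigA (fun (_ : 'I_d) (x : 'I_K.+1 * bool) => g x.1)).
  by rewrite gsum prodr_const card_ord.
have coreE : \sum_(f : T | core f) F f = 2 ^+ d.
  transitivity (\prod_(i < d) \sum_(x : 'I_K.+1 * bool | (x.1 : nat) == 0%N) g x.1); last first.
    by rewrite csum prodr_const card_ord.
  by rewrite (bigA_distr_big (fun x : 'I_K.+1 * bool => (x.1 : nat) == 0%N)).
have : \sum_(f : T | ~~ core f) F f = (2 * (1 + S)) ^+ d - 2 ^+ d.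
  by rewrite -allE [X in _ = X - _](bigID core) /= coreE addrAC subrr add0r.
move=> ->; rewrite exprMn.
have S8 : 0 <= S <= 8 / L ^+ 2.
  rewrite /S -mulr_sumr; have L2 : 0 < L ^+ 2 by rewrite exprn_gt0.
  apply/andP; split.
    apply: mulr_ge0; first by rewrite divr_ge0 // ltW.
    by apply: sumr_ge0 => n _; rewrite invr_ge0 sqr_ge0.
  apply: (@le_trans _ _ (4 / L ^+ 2 * 2)); last by rewrite mulrAC; lra.
  apply: ler_wpM2l; first by rewrite divr_ge0 // ltW.
  exact: sum_inv_sq.
have LL : 8 / L ^+ 2 <= 8 / L.
  apply: ler_wpM2l; first lra.
  by rewrite lef_pV2 ?posrE ?exprn_gt0 // expr2 ler_peMl ?ltW //; lra.
have L8 : 8 / L <= 1 by rewrite ler_pdivrMr //; lra.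
case/andP: S8 => S0 S8.
have := @expr_convex S d; rewrite S0 => /(_ _) h.
have {h}h : (1 + S) ^+ d <= 1 + S * 2 ^+ d by apply: h; lra.
have t0 : 0 < 2 ^+ d :> R by rewrite exprn_gt0.
apply: (@le_trans _ _ (2 ^+ d * (S * 2 ^+ d))).
  by apply: le_trans (_ : 2 ^+ d * (1 + S * 2 ^+ d) - 2 ^+ d <= _); [rewrite lerD2r ler_pM2l|lra].
have -> : 2 ^+ d * (S * 2 ^+ d) = S * D by rewrite /D mulrCA -exprMn -natrM.
have : S * D <= 8 / L * D by apply: ler_wpM2r; [exact: ltW|lra].
move=> /le_trans; apply; rewrite mulrAC ler_pdivrMr //.
apply: (@le_trans _ _ (kappa * L0)); last by rewrite ler_pM2l.
rewrite /L0 mulrDr [kappa * (8 * D / kappa)]mulrC divfK ?gt_eqF //.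
by rewrite lerDr mulr_ge0 // ltW.
Qed.

End Packing.

(** * Steering vectors *)

Section Steering.
Variables (R : realType) (d m : nat).
Implicit Types (w v e : 'rV[R]_d) (z : 'rV[int]_d) (x : cube m d).
Local Notation iz := (map_mx (intr : int -> R)).
Local Notation en := (@euclidean_norm R d).

Let N : R := (2 * m).+1%:R ^+ d.

Lemma size_gt0 : 0 < N. Proof. by rewrite exprn_gt0 // ltr0n. Qed.

Lemma sum_cube (V : nmodType) (F : cube m d -> V) :
  \sum_(j < #|{: cube m d}|) F (enum_val j) = \sum_(x : cube m d) F x.
Proof. by rewrite -(big_enum_val _ (A := {: cube m d})). Qed.

Lemma innerE w x : inner w (cube_pt x) = \sum_i w 0 i * ((x i : nat)%:R - m%:R).
Proof. by apply: eq_bigr => i _; rewrite !mxE intrB. Qed.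

Lemma innerDl w v (y : 'rV[int]_d) : inner (w + v) y = inner w y + inner v y.
Proof. by rewrite /inner -big_split; apply: eq_bigr => i _; rewrite mxE mulrDl. Qed.

Lemma innerNl w (y : 'rV[int]_d) : inner (- w) y = - inner w y.
Proof. by rewrite /inner -sumrN; apply: eq_bigr => i _; rewrite mxE mulNr. Qed.

Lemma cexp_inner_int z (y : 'rV[int]_d) : cexp (inner (iz z) y) = 1 :> R[i].
Proof.
rewrite /inner cexp_sum big1 // => i _.
by rewrite mxE -intrM cexp_int.
Qed.

Lemma cexp_inner_periodic w z (y : 'rV[int]_d) :
  cexp (inner (w + iz z) y) = cexp (inner w y) :> R[i].
Proof. by rewrite innerDl cexpD cexp_inner_int mulr1. Qed.

Lemma steering_periodic w z : steering m (w + iz z) = steering m w.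
Proof. by apply/rowP => j; rewrite !mxE cexp_inner_periodic. Qed.

Lemma sum_prod_cube (n : nat) (f : 'I_d -> 'I_n -> R[i]) :
  \sum_(x : {ffun 'I_d -> 'I_n}) \prod_i f i (x i) = \prod_i \sum_k f i k.
Proof. by rewrite bigA_distr_bigA. Qed.

Lemma cexp_inner_prod w x :
  cexp (inner w (cube_pt x)) = \prod_i cexp (w 0 i * ((x i : nat)%:R - m%:R)).
Proof. by rewrite innerE cexp_sum. Qed.

Lemma norm_const : rc (Num.sqrt N)^-1 * (rc (Num.sqrt N)^-1)^* = \prod_(i < d) rc (2 * m).+1%:R^-1.
Proof.
rewrite mulcJ cabs_rc real_normK ?num_real // exprVn sqr_sqrtr ?ltW ?size_gt0 //.
rewrite prodr_const card_ord /N -exprVn; elim: (d) => [|n IH]; first by rewrite !expr0.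
by rewrite !exprS rcM IH.
Qed.

Lemma hd_steering w v : hd (steering m w) (steering m v) = \prod_i dker m ((w - v) 0 i).
Proof.
rewrite /hd.
rewrite (eq_bigr (fun j => (fun x => rc (Num.sqrt N)^-1 * (rc (Num.sqrt N)^-1)^* * cexp (inner (w - v) (cube_pt x))) (enum_val j))).
  rewrite (sum_cube (fun x => _ * cexp (inner (w - v) (cube_pt x)))) -mulr_sumr norm_const.
  rewrite [X in _ * X](_ : _ = \prod_i \sum_(k < (2 * m).+1) cexp ((w - v) 0 i * (k%:R - m%:R))); last first.
    by rewrite -sum_prod_cube; apply: eq_bigr => x _; exact: cexp_inner_prod.
  rewrite -big_split /=.
  by apply: eq_bigr => i _.
move=> j _; rewrite !mxE rmorphM /= -cexpN innerDl innerNl cexpD -!/(rc _); ring.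
Qed.

Lemma dker_periodic t (n : int) : dker m (t + n%:~R) = dker m t :> R[i].
Proof.
congr (_ * _); apply: eq_bigr => k _; rewrite mulrDl cexpD.
rewrite [X in _ * X](_ : _ = 1) ?mulr1 //.
by rewrite -[k%:R]/((k : nat)%:Z%:~R) -[m%:R]/(m%:Z%:~R) -intrB -intrM cexp_int.
Qed.

Lemma geo_periodic n t (a : int) : geo n (t + a%:~R) = geo n t :> R[i].
Proof.
apply: eq_bigr => k _; rewrite mulrDl cexpD.
by rewrite -[k%:R]/((k : nat)%:Z%:~R) -intrM cexp_int mulr1.
Qed.

Lemma red_coord w i : w 0 i = red w 0 i + (rnd (w 0 i))%:~R.
Proof. by rewrite redE subrK. Qed.

Lemma dker0 : dker m 0 = 1 :> R[i].
Proof.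
rewrite /dker (eq_bigr (fun=> 1)) => [|k _]; last by rewrite mul0r cexp0.
by rewrite sumr_const card_ord -rc_nat -rcM mulVf ?pnatr_eq0.
Qed.

Lemma nrm_steering w : nrm (steering m w) = 1.
Proof.
rewrite /nrm /ip hd_steering subrr big1 ?sqrtr1 // => i _.
by rewrite mxE dker0.
Qed.

Lemma two_decay v : 2 ^+ d * decay m v = \prod_i (2 / (1 + m%:R ^+ 2 * v 0 i ^+ 2)).
Proof. by rewrite /decay -{1}[d]card_ord -prodr_const -big_split. Qed.

Lemma hd_steering_decay w v :
  cabs (hd (steering m w) (steering m v)) ^+ 2 <= 2 ^+ d * decay m (red (w - v)).
Proof.
rewrite hd_steering cabs_prod -prodrXl two_decay; apply: ler_prod => i _.
rewrite sqr_ge0 /= red_coord dker_periodic ler_pdivlMr ?decay_factor_gt0 //.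
rewrite -[X in dker m X]addr0; apply: dker_decay; first exact: red_half.
by rewrite normr0 mulr0; lra.
Qed.

(** The product is telescoped. Since each difference is measured relative to [p], the full product
    of the decay factors survives in every term. *)
Lemma prod_diff I (r : seq I) (a b : I -> R[i]) (p c : I -> R) :
  (forall i, cabs (a i) <= p i) -> (forall i, cabs (b i) <= p i) ->
  (forall i, cabs (a i - b i) <= c i * p i) ->
  cabs (\prod_(i <- r) a i - \prod_(i <- r) b i) <=
  (\sum_(i <- r) c i) * \prod_(i <- r) p i.
Proof.
move=> ap bp abp.
have p0 i : 0 <= p i by apply: le_trans (ap i); exact: cabs_ge0.
elim: r => [|i r IH]; first by rewrite !big_nil subrr cabs0 mul0r.
rewrite !big_cons.
have -> : a i * \prod_(j <- r) a j - b i * \prod_(j <- r) b j =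
  (a i - b i) * \prod_(j <- r) a j + b i * (\prod_(j <- r) a j - \prod_(j <- r) b j) by ring.
apply: le_trans (cabsD _ _) _; rewrite [leRHS]mulrDl !cabsM; apply: lerD.
  rewrite mulrA; apply: ler_pM; rewrite ?cabs_ge0 //.
  by rewrite cabs_prod; apply: ler_prod => j _; rewrite cabs_ge0 ap.
by rewrite mulrCA; apply: ler_pM; rewrite ?cabs_ge0.
Qed.

Lemma sq_le_abs (x y : R) : 0 <= x -> 0 <= y -> x ^+ 2 <= y ^+ 2 -> x <= y.
Proof. by move=> x0 y0; rewrite ler_pXn2r. Qed.

Lemma hd_steering_diff w v e : (forall i, m%:R * `|e 0 i| <= 1 / 64) ->
  cabs (hd (steering m (w + e)) (steering m v) - hd (steering m w) (steering m v)) ^+ 2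
  <= (100 * d%:R ^+ 2 * (m%:R * en e) ^+ 2) * (2 ^+ d * decay m (red (w - v))).
Proof.
move=> eh; set t := red (w - v).
have tE i : (w - v) 0 i = t 0 i + (rnd ((w - v) 0 i))%:~R by rewrite redE subrK.
have h1 : hd (steering m w) (steering m v) = \prod_i dker m (t 0 i).
  by rewrite hd_steering; apply: eq_bigr => i _; rewrite tE dker_periodic.
have h2 : hd (steering m (w + e)) (steering m v) = \prod_i dker m (t 0 i + e 0 i).
  rewrite hd_steering; apply: eq_bigr => i _.
  have -> : (w + e - v) 0 i = t 0 i + e 0 i + (rnd ((w - v) 0 i))%:~R.
    by have := tE i; rewrite !mxE => h; lra.
  by rewrite dker_periodic.
rewrite h1 h2.
pose p i := Num.sqrt (2 / (1 + m%:R ^+ 2 * t 0 i ^+ 2)).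
have q0 i : 0 <= 2 / (1 + m%:R ^+ 2 * t 0 i ^+ 2).
  by rewrite divr_ge0 // ltW // decay_factor_gt0.
have p2 i : p i ^+ 2 = 2 / (1 + m%:R ^+ 2 * t 0 i ^+ 2) by rewrite sqr_sqrtr.
have th i : `|t 0 i| <= 1 / 2 by exact: red_half.
have bnd := @prod_diff _ (index_enum 'I_d) (fun i => dker m (t 0 i + e 0 i)) (fun i => dker m (t 0 i)) p (fun i => 10 * (m%:R * `|e 0 i|)).
have {}bnd : cabs (\prod_i dker m (t 0 i + e 0 i) - \prod_i dker m (t 0 i)) <=
   (\sum_(i < d) 10 * (m%:R * `|e 0 i|)) * \prod_i p i.
  apply: bnd => i.
  - apply: sq_le_abs; rewrite ?cabs_ge0 ?sqrtr_ge0 // p2 ler_pdivlMr ?decay_factor_gt0 //.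
    exact: dker_decay.
  - apply: sq_le_abs; rewrite ?cabs_ge0 ?sqrtr_ge0 // p2 ler_pdivlMr ?decay_factor_gt0 //.
    rewrite -[X in dker m X]addr0; apply: dker_decay => //.
    by rewrite normr0 mulr0; lra.
  apply: sq_le_abs; rewrite ?cabs_ge0 // ?mulr_ge0 ?sqrtr_ge0 //.
  rewrite [leRHS]exprMn p2 [leRHS]mulrA ler_pdivlMr ?decay_factor_gt0 //.
  apply: le_trans (dker_diff _ _ (th i)) _.
  rewrite !exprMn real_normK ?num_real //.
  by have := mulr_ge0 (sqr_ge0 (m%:R : R)) (sqr_ge0 (e 0 i)); lra.
have pp : (\prod_i p i) ^+ 2 = 2 ^+ d * decay m t.
  by rewrite two_decay -prodrXl; apply: eq_bigr => i _; rewrite p2.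
have pp0 : 0 <= \prod_i p i by apply: prodr_ge0 => i _; rewrite sqrtr_ge0.
rewrite -pp.
apply: (@le_trans _ _ (((\sum_(i < d) 10 * (m%:R * `|e 0 i|)) * \prod_i p i) ^+ 2)).
  by rewrite lerXn2r // nnegrE ?cabs_ge0 // (le_trans (cabs_ge0 _) bnd).
rewrite [in leLHS]exprMn; apply: ler_wpM2r; first exact: sqr_ge0.
have sE : \sum_(i < d) 10 * (m%:R * `|e 0 i|) <= 10 * (d%:R * (m%:R * en e)).
  rewrite -mulr_sumr; apply: ler_wpM2l => //.
  apply: (@le_trans _ _ (\sum_(i < d) m%:R * en e)).
    by apply: ler_sum => i _; apply: ler_wpM2l => //; exact: en_coord.
  by rewrite sumr_const card_ord [leRHS]mulr_natl.
have s0 : 0 <= \sum_(i < d) 10 * (m%:R * `|e 0 i|).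
  by apply: sumr_ge0 => i _; rewrite !mulr_ge0.
have -> : 100 * d%:R ^+ 2 * (m%:R * en e) ^+ 2 = (10 * (d%:R * (m%:R * en e))) ^+ 2 by ring.
by rewrite lerXn2r // nnegrE // (le_trans s0).
Qed.

End Steering.

Lemma rcX (R : realType) (t : R) n : rc (t ^+ n) = rc t ^+ n.
Proof. by elim: n => [|n IH]; rewrite ?expr0 // !exprS rcM IH. Qed.

(** * Lower bounds for combinations of steering vectors *)

Section SubcubeAveraging.
Variables (R : realType) (d m : nat).
Implicit Types (w v e : 'rV[R]_d).
Local Notation en := (@euclidean_norm R d).
Let N : R := (2 * m).+1%:R ^+ d.

Lemma expr_prod_ord (x : R) n : x ^+ n = \prod_(i < n) x.
Proof. by rewrite prodr_const card_ord. Qed.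

Section Characters.
Variables (K : finType) (om : K -> 'rV[R]_d) (c : K -> R[i]) (L M : nat).
(** For [a < L] and [b < M] the sums [a + b] then range over exactly [0, ..., 2 m]: the translates
    of a cube of side [M] fill the whole cube. *)
Hypothesis LM : (L + M = (2 * m).+2)%N.
Hypotheses (L0 : (0 < L)%N) (M0 : (0 < M)%N).

Let f (y : 'I_d -> nat) : R[i] :=
  \sum_k c k * \prod_i cexp (om k 0 i * ((y i)%:R - m%:R)).

Lemma nrm_combination :
  ip (\sum_k c k *: steering m (om k)) (\sum_k c k *: steering m (om k)) =
  N^-1 * \sum_(x : cube m d) cabs (f (fun i => x i)) ^+ 2.
Proof.
rewrite ip_self.
rewrite (eq_bigr (fun j => (fun x : cube m d => N^-1 * cabs (f (fun i => x i)) ^+ 2) (enum_val j))).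
  by rewrite (sum_cube (fun x : cube m d => N^-1 * cabs (f (fun i => x i)) ^+ 2)) mulr_sumr.
move=> j _; rewrite summxE.
rewrite (eq_bigr (fun k => rc (Num.sqrt N)^-1 * (c k * \prod_i cexp (om k 0 i * ((enum_val j i)%:R - m%:R))))).
  rewrite -mulr_sumr cabsM exprMn cabs_rc real_normK ?num_real // exprVn.
  by rewrite sqr_sqrtr // ltW // size_gt0.
by move=> k _; rewrite !mxE cexp_inner_prod mulrCA.
Qed.

Lemma translate_bound (a : 'I_d -> 'I_L) :
  \sum_(b : {ffun 'I_d -> 'I_M}) cabs (f (fun i => (a i + b i)%N)) ^+ 2 <=
  \sum_(x : cube m d) cabs (f (fun i => x i)) ^+ 2.
Proof.
pose h (b : {ffun 'I_d -> 'I_M}) : cube m d := [ffun i => inord (a i + b i)].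
have hE b i : (h b i : nat) = (a i + b i)%N.
  rewrite ffunE inordK //; have := ltn_ord (a i); have := ltn_ord (b i); move: LM; lia.
apply: le_trans (_ : \sum_(b : {ffun 'I_d -> 'I_M}) cabs (f (fun i => h b i)) ^+ 2 <= _).
  apply: ler_sum => b _; rewrite le_eqVlt; apply/orP; left; apply/eqP.
  congr (cabs _ ^+ 2); apply: eq_bigr => k _; congr (_ * _); apply: eq_bigr => i _.
  by rewrite hE.
apply: (@sum_injection _ _ _ xpredT xpredT h (fun x : cube m d => cabs (f (fun i => x i)) ^+ 2)) => //.
- move=> b b' _ _ hh; apply/ffunP => i; apply/val_inj/eqP.
  by rewrite -(eqn_add2l (a i)) -!hE hh.
by move=> x _; rewrite sqr_ge0.
Qed.

(** The sum of a character over all [a + b] factors into one geometric sum in [a] and one in [b];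
    this product of two kernels is the source of the squared decay. *)
Let kap j k : R[i] :=
  \prod_i (cexp (- ((om j - om k) 0 i * m%:R)) * geo L ((om j - om k) 0 i) * geo M ((om j - om k) 0 i)).

Lemma double_sum :
  \sum_(a : {ffun 'I_d -> 'I_L}) \sum_(b : {ffun 'I_d -> 'I_M})
    cabs (f (fun i => (a i + b i)%N)) ^+ 2 =
  \sum_j \sum_k Re (c j * (c k)^* * kap j k).
Proof.
pose t j k i := (om j - om k) 0 i.
have sq (y : 'I_d -> nat) : cabs (f y) ^+ 2 =
   \sum_j \sum_k Re (c j * (c k)^* * \prod_i cexp (t j k i * ((y i)%:R - m%:R))).
  have : rc (cabs (f y) ^+ 2) = f y * (f y)^* by rewrite mulcJ.
  move=> /(congr1 (fun z => Re z)) /= ->.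
  rewrite {2}/f rmorph_sum mulr_suml Re_sum; apply: eq_bigr => j _.
  rewrite mulr_sumr Re_sum; apply: eq_bigr => k _; congr (Re _).
  rewrite /= rmorphM /= rmorph_prod mulrACA -big_split /=; congr (_ * _).
  apply: eq_bigr => i _.
  by rewrite -[X in _ * X]/((cexp _)^*) -cexpN -cexpD /t !mxE mulrBl.
under eq_bigr => a _ do under eq_bigr => b _ do rewrite sq.
under eq_bigr => a _ do rewrite exchange_big /=.
rewrite exchange_big /=; apply: eq_bigr => j _.
under eq_bigr => a _ do rewrite exchange_big /=.
rewrite exchange_big /=; apply: eq_bigr => k _.
under eq_bigr => a _ do rewrite -Re_sum.
rewrite -Re_sum; congr (Re _).
under eq_bigr => a _ do rewrite -mulr_sumr.
rewrite -mulr_sumr; congr (_ * _).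
transitivity (\sum_(a : {ffun 'I_d -> 'I_L}) (\prod_i (cexp (- (t j k i * m%:R)) * cexp (t j k i * (a i)%:R))) *
   \sum_(b : {ffun 'I_d -> 'I_M}) \prod_i cexp (t j k i * (b i)%:R)).
  apply: eq_bigr => a _; rewrite mulr_sumr; apply: eq_bigr => b _.
  rewrite -big_split; apply: eq_bigr => i _ /=.
  by rewrite natrD -!cexpD; congr cexp; ring.
rewrite -mulr_suml (sum_prod_cube (fun i (b : 'I_M) => cexp (t j k i * b%:R))).
rewrite (sum_prod_cube (fun i (a : 'I_L) => cexp (- (t j k i * m%:R)) * cexp (t j k i * a%:R))).
rewrite -big_split; apply: eq_bigr => i _ /=; rewrite -mulr_sumr.
by congr (_ * _ * _).
Qed.

Definition rker (n1 n2 : nat) v : R :=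
  \prod_i (cabs (geo n1 (v 0 i)) * cabs (geo n2 (v 0 i)) / (n1%:R * n2%:R)).

Lemma rker_ge0 n1 n2 v : 0 <= rker n1 n2 v.
Proof. by apply: prodr_ge0 => i _; rewrite divr_ge0 ?mulr_ge0 ?cabs_ge0. Qed.

(* The sum over the cube dominates the average of the sums over the translates of
   a subcube; averaging squares the decay of the kernel, which makes the
   off-diagonal part summable over separated sources. *)
Lemma subcube_lower :
  (M%:R ^+ d / N) * (\sum_k cabs (c k) ^+ 2 -
     \sum_j \sum_(k | k != j) cabs (c j) * cabs (c k) * rker L M (om j - om k)) <=
  ip (\sum_k c k *: steering m (om k)) (\sum_k c k *: steering m (om k)).
Proof.
rewrite nrm_combination mulrAC [leRHS]mulrC ler_pM2r ?invr_gt0 ?size_gt0 //.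
set T := \sum_(x : cube m d) _.
have Lp : 0 < L%:R :> R by rewrite ltr0n.
have Mp : 0 < M%:R :> R by rewrite ltr0n.
have Ld : 0 < L%:R ^+ d :> R by rewrite exprn_gt0.
rewrite -(ler_pM2l Ld).
have avg : \sum_j \sum_k Re (c j * (c k)^* * kap j k) <= L%:R ^+ d * T.
  rewrite -double_sum.
  apply: (@le_trans _ _ (\sum_(a : {ffun 'I_d -> 'I_L}) T)).
    by apply: ler_sum => a _; exact: translate_bound.
  by rewrite sumr_const card_ffun !card_ord -[T *+ _]mulr_natl natrX.
apply: le_trans avg; rewrite mulrA -exprMn.
have kapE j k : cabs (kap j k) = (L%:R * M%:R) ^+ d * rker L M (om j - om k).
  rewrite /kap cabs_prod /rker (expr_prod_ord _ d) -big_split.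
  apply: eq_bigr => i _ /=; rewrite !cabsM cabs_cexp mul1r mulrCA mulfV ?mulr1 //.
  by rewrite gt_eqF // mulr_gt0.
have kapD j : kap j j = rc ((L%:R * M%:R) ^+ d).
  rewrite /kap (eq_bigr (fun=> rc (L%:R * M%:R))) => [|i _].
    rewrite prodr_const card_ord; exact/esym/rcX.
  rewrite subrr mxE mul0r oppr0 cexp0 mul1r /geo.
  under eq_bigr => k _ do rewrite mul0r cexp0.
  under [in X in _ * X]eq_bigr => k _ do rewrite mul0r cexp0.
  by rewrite !sumr_const !card_ord -!rc_nat -rcM.
rewrite mulrBr !mulr_sumr -sumrB; apply: ler_sum => j _.
rewrite [leRHS](bigD1 j) //= kapD mulcJ -rcM /= [_ ^+ 2 * _]mulrC lerD2l.
rewrite -mulrN -sumrN mulr_sumr; apply: ler_sum => k kj.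
have := Re_le_cabs (c j * (c k)^* * kap j k).
rewrite !cabsM cabsJ kapE ler_norml => /andP[h _]; apply: le_trans h.
by rewrite mulrN lerN2 mulrCA.
Qed.

End Characters.

Lemma rkerN n1 n2 v : rker n1 n2 (- v) = rker n1 n2 v.
Proof.
apply: eq_bigr => i _; rewrite mxE.
have gN n (t : R) : cabs (geo n (- t)) = cabs (geo n t).
  rewrite -[RHS]cabsJ /geo rmorph_sum; congr cabs; apply: eq_bigr => k _.
  by rewrite -[RHS]/((cexp _)^*) -cexpN mulNr.
by rewrite !gN.
Qed.

Lemma rker_red n1 n2 v : rker n1 n2 v = rker n1 n2 (red v).
Proof. by apply: eq_bigr => i _; rewrite red_coord !geo_periodic. Qed.

Lemma rker_decay n1 n2 v : (0 < n1)%N -> (0 < n2)%N ->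
  rker n1 n2 v <= (1 + m%:R ^+ 2 / (n1%:R * n2%:R)) ^+ d * decay m (red v).
Proof.
move=> n10 n20; rewrite rker_red.
rewrite /decay (expr_prod_ord _ d) -big_split /=; apply: ler_prod => i _.
have p1 : 0 < n1%:R * n2%:R :> R by rewrite mulr_gt0 ?ltr0n.
rewrite divr_ge0 ?mulr_ge0 ?cabs_ge0 //=.
rewrite ler_pdivrMr // mulrAC ler_pdivlMr ?decay_factor_gt0 //.
apply: le_trans (geo_decay n1 n2 (red_half v i) (ler0n _ m)) _.
by rewrite mulrDl mul1r divfK ?gt_eqF.
Qed.

Lemma rker_geo n1 n2 v : (0 < n1)%N -> (0 < n2)%N ->
  rker n1 n2 v <= \prod_i (cabs (geo n2 (red v 0 i)) / n2%:R).
Proof.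
move=> n10 n20; rewrite rker_red; apply: ler_prod => i _.
have p1 : 0 < n1%:R :> R by rewrite ltr0n.
have p2 : 0 < n2%:R :> R by rewrite ltr0n.
rewrite divr_ge0 ?mulr_ge0 ?cabs_ge0 //=.
rewrite invfM mulrACA -[leRHS]mul1r; apply: ler_wpM2r.
  by rewrite divr_ge0 ?cabs_ge0.
by rewrite ler_pdivrMr // mul1r geo_le.
Qed.

(** From [x j * x k <= x j ^+ 2 / 2 + x k ^+ 2 / 2]; by symmetry of [r] both halves have the same
    sum. *)
Lemma schur_test (K : finType) (x : K -> R) (r : K -> K -> R) (kappa : R) :
  (forall j k, 0 <= r j k) -> (forall j k, r j k = r k j) ->
  (forall j, \sum_(k | k != j) r j k <= kappa) ->
  \sum_j \sum_(k | k != j) x j * x k * r j k <= kappa * \sum_j x j ^+ 2.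
Proof.
move=> r0 rC rk.
apply: (@le_trans _ _ (\sum_j \sum_(k | k != j) (x j ^+ 2 / 2 * r j k + x k ^+ 2 / 2 * r j k))).
  apply: ler_sum => j _; apply: ler_sum => k _; rewrite -mulrDl.
  by apply: ler_wpM2r => //; have := sqr_ge0 (x j - x k); rewrite sqrrB; lra.
under eq_bigr => j _ do rewrite big_split /=.
rewrite big_split /=.
rewrite (exchange_big_dep xpredT) //=.
have e1 : \sum_j \sum_(i | i != j) x i ^+ 2 / 2 * r j i = \sum_j \sum_(i | i != j) x j ^+ 2 / 2 * r j i.
  rewrite (exchange_big_dep xpredT) //=; apply: eq_bigr => j _.
  by apply: eq_big => [i|i _]; [rewrite eq_sym|rewrite rC].
have e2 : \sum_j \sum_(i | j != i) x i ^+ 2 / 2 * r i j = \sum_j \sum_(i | i != j) x j ^+ 2 / 2 * r j i.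
  by rewrite -e1; apply: eq_bigr => j _; apply: eq_big => [i|i _]; [rewrite eq_sym|rewrite rC].
rewrite e1 e2 -big_split mulr_sumr /=; apply: ler_sum => j _.
rewrite -mulr_sumr -mulrDl -splitr [leRHS]mulrC.
by apply: ler_wpM2l; [exact: sqr_ge0|exact: rk].
Qed.

End SubcubeAveraging.

(** * Separated sources *)

Section SeparatedSources.
Variables (R : realType) (d : nat).
Hypothesis d_gt0 : (0 < d)%N.
Implicit Types (w v e : 'rV[R]_d).
Local Notation en := (@euclidean_norm R d).

Lemma bernoulli_ineq (x : R) n : 0 <= x <= 1 -> 1 - n%:R * x <= (1 - x) ^+ n.
Proof.
move=> /andP[x0 x1]; elim: n => [|n IH]; first by rewrite mul0r subr0 expr0.
rewrite exprS -natr1; apply: le_trans (ler_wpM2l _ IH); last lra.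
by have := mulr_ge0 (ler0n R n) (mulr_ge0 x0 x0); lra.
Qed.

(* Of order [m / (10 d)], so that the subcubes keep a fixed share of the cube. *)
Definition sub_len (m : nat) := (m %/ (10 * d)).+1.
Definition sub_colen (m : nat) := ((2 * m).+2 - sub_len m)%N.

Lemma sub_len_le m : (sub_len m <= m.+1)%N.
Proof. by rewrite ltnS leq_div. Qed.

Lemma sub_lenD m : (sub_len m + sub_colen m = (2 * m).+2)%N.
Proof. by rewrite /sub_colen subnKC //; have := sub_len_le m; lia. Qed.

Lemma sub_colen_ge m : (m.+1 <= sub_colen m)%N.
Proof. by rewrite /sub_colen; have := sub_len_le m; lia. Qed.

Lemma sub_len_ratio m : m%:R ^+ 2 / ((sub_len m)%:R * (sub_colen m)%:R) <= 10 * d%:R :> R.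
Proof.
have p : 0 < (sub_len m)%:R * (sub_colen m)%:R :> R.
  by rewrite mulr_gt0 ?ltr0n //; have := sub_colen_ge m; lia.
rewrite ler_pdivrMr // mulrA expr2 -!natrM ler_nat.
have h : (m <= 10 * d * sub_len m)%N.
  rewrite mulnC; apply: ltnW; apply: ltn_ceil; lia.
by apply: leq_mul => //; have := sub_colen_ge m; lia.
Qed.

(** The side of the subcube is shorter by a fraction of at most [1 / (10 d)], so Bernoulli's
    inequality loses at most [1 / 10] over the [d] coordinates. *)
Lemma sub_volume m : 9 / 10 <= (sub_colen m)%:R ^+ d / (2 * m).+1%:R ^+ d :> R.
Proof.
rewrite -expr_div_n; set x : R := (m %/ (10 * d))%:R / (2 * m).+1%:R.
have n0 : 0 < (2 * m).+1%:R :> R by rewrite ltr0n.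
have -> : (sub_colen m)%:R / (2 * m).+1%:R = 1 - x :> R.
  apply: (mulIf (lt0r_neq0 n0)); rewrite mulrBl mul1r /x !divfK ?gt_eqF //.
  rewrite /sub_colen /sub_len subSS natrB //.
  by have := leq_div m (10 * d); lia.
have dx : d%:R * x <= 1 / 10.
  rewrite /x mulrA ler_pdivrMr // odd_nat.
  have : 10 * (d%:R * (m %/ (10 * d))%:R) <= m%:R :> R.
    by rewrite mulrA -!natrM ler_nat mulnC leq_trunc_div.
  have := ler0n R m; lra.
have x0 : 0 <= x by rewrite divr_ge0.
have x1 : x <= 1.
  have d1 : 1 <= d%:R :> R by rewrite ler1n.
  by have := ler_peMl x0 d1; lra.
apply: le_trans (bernoulli_ineq d _); first lra.
by rewrite x0 x1.
Qed.

(** The difference of two reduced vectors [red (w - theta _)] is a lift of a difference of sources,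
    so separation on the torus gives the Euclidean separation that [packing] asks for. *)
Lemma packing_torus (kappa : R) : 0 < kappa -> exists2 sep : R, 0 < sep &
  forall (m s : nat) (theta : 'I_s -> 'rV[R]_d), (1 <= m)%N ->
  ((sep / m%:R)%:E <= separation theta)%E ->
  forall w (P : pred 'I_s), (forall k, P k -> sep / (2 * m%:R) <= torus_dist w (theta k)) ->
  \sum_(k | P k) decay m (red (w - theta k)) <= kappa.
Proof.
move=> /(@packing R d)[sep sep0 h]; exists sep => // m s theta m1 hsep w P hP.
have m0 : 0 < m%:R :> R by rewrite ltr0n.
apply: (h sep m _ P (fun k => red (w - theta k))) => // [j k _ _ jk|k kP].
  have : sep / m%:R <= torus_dist (theta j) (theta k).
    rewrite -lee_fin; apply: le_trans hsep _; apply: ereal_inf_lbound.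
    by exists j, k.
  rewrite ler_pdivrMr // mulrC => /le_trans; apply; rewrite ler_pM2l //.
  rewrite torus_dist_sym.
  have -> : red (w - theta j) - red (w - theta k) = (theta k - theta j) +
      map_mx intr (map_mx (@rnd R) (w - theta k) - map_mx (@rnd R) (w - theta j)).
    by apply/rowP => i; rewrite !mxE intrB; ring.
  exact: torus_norm_le.
have := hP k kP; rewrite /torus_dist torus_normE invfM mulrA ler_pdivrMr //.
by rewrite [_ * m%:R]mulrC.
Qed.

Definition steering_mx (m s : nat) (theta : 'I_s -> 'rV[R]_d) : 'M[R[i]]_(s, #|{: cube m d}|) :=
  \matrix_(l, j) steering m (theta l) 0 j.

Lemma row_steering_mx m s (theta : 'I_s -> 'rV[R]_d) l :
  row l (steering_mx m theta) = steering m (theta l).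
Proof. by apply/rowP => j; rewrite !mxE. Qed.

Lemma steering_sub m s (theta : 'I_s -> 'rV[R]_d) l :
  (steering m (theta l) <= steering_mx m theta)%MS.
Proof. by rewrite -row_steering_mx row_sub. Qed.

Lemma mul_steering_mx m s (theta : 'I_s -> 'rV[R]_d) (c : 'rV[R[i]]_s) :
  c *m steering_mx m theta = \sum_l c 0 l *: steering m (theta l).
Proof. by rewrite mulmx_sum_row; apply: eq_bigr => l _; rewrite row_steering_mx. Qed.

Section Fixed.
Variables (m s : nat) (theta : 'I_s -> 'rV[R]_d) (sep kap : R).
Hypotheses (m_gt0 : (0 < m)%N) (sep_gt0 : 0 < sep) (kap_ge0 : 0 <= kap).
Hypothesis theta_sep : ((sep / m%:R)%:E <= separation theta)%E.
Hypothesis packed : forall w (P : pred 'I_s),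
  (forall k, P k -> sep / (2 * m%:R) <= torus_dist w (theta k)) ->
  \sum_(k | P k) decay m (red (w - theta k)) <= kap.

Hypothesis small_kap : (1 + 10 * d%:R) ^+ d * kap <= 1 / 10.

Local Notation L := (sub_len m).
Local Notation M := (sub_colen m).
Local Notation phi := (@steering R d m).
Local Notation Phi := (steering_mx m theta).
Let B : R := (1 + 10 * d%:R) ^+ d.

Lemma m_pos : 0 < m%:R :> R. Proof. by rewrite ltr0n. Qed.

Lemma theta_dist j k : j != k -> sep / m%:R <= torus_dist (theta j) (theta k).
Proof.
move=> jk; rewrite -lee_fin; apply: le_trans theta_sep _; apply: ereal_inf_lbound.
by exists j, k.
Qed.

Lemma theta_dist_half j k : j != k -> sep / (2 * m%:R) <= torus_dist (theta j) (theta k).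
Proof.
move=> /theta_dist; apply: le_trans; apply: ler_wpM2l; first exact: ltW.
by rewrite lef_pV2 ?posrE ?mulr_gt0 ?m_pos // ler_peMl ?ltW ?m_pos //; lra.
Qed.

Lemma B_ge0 : 0 <= B. Proof. by apply: exprn_ge0; have := ler0n R d; lra. Qed.

Lemma rker_packed w (P : pred 'I_s) :
  (forall k, P k -> sep / (2 * m%:R) <= torus_dist w (theta k)) ->
  \sum_(k | P k) rker L M (w - theta k) <= B * kap.
Proof.
move=> hP; apply: (@le_trans _ _ (\sum_(k | P k) B * decay m (red (w - theta k)))).
  apply: ler_sum => k _; apply: le_trans (rker_decay m _ _ _) _ => //.
    by have := sub_colen_ge m; lia.
  apply: ler_wpM2r; first exact: decay_ge0.
  apply: lerXn2r; rewrite ?nnegrE ?lerD2l ?sub_len_ratio //.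
by rewrite -mulr_sumr; apply: ler_wpM2l; [exact: B_ge0|exact: packed].
Qed.

Lemma nrm_sq_sum n (c : 'rV[R[i]]_n) : ip c c = \sum_k cabs (c 0 k) ^+ 2.
Proof. exact: ip_self. Qed.


Lemma Bkap_ge0 : 0 <= B * kap. Proof. by rewrite mulr_ge0 ?B_ge0. Qed.

Lemma colen_gt0 : (0 < M)%N. Proof. by have := sub_colen_ge m; lia. Qed.

Lemma offdiag_le (c : 'I_s -> R[i]) :
  \sum_j \sum_(k | k != j) cabs (c j) * cabs (c k) * rker L M (theta j - theta k) <=
  B * kap * \sum_k cabs (c k) ^+ 2.
Proof.
apply: (@schur_test R _ (fun k => cabs (c k)) (fun j k => rker L M (theta j - theta k))) => [j k|j k|j].
- exact: rker_ge0.
- by rewrite -rkerN opprB.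
by apply: rker_packed => k kj; apply: theta_dist_half; rewrite eq_sym.
Qed.

(** A share [9 / 10] of the volume, times the [9 / 10] left after the Schur test has bounded the
    off-diagonal part. *)
Lemma Gram_lower c : (1 / 2) * ip c c <= ip (c *m Phi) (c *m Phi).
Proof.
rewrite mul_steering_mx.
have := subcube_lower theta (fun k => c 0 k) (sub_lenD m) isT colen_gt0.
apply: le_trans; rewrite nrm_sq_sum.
have h := offdiag_le (fun k => c 0 k); have := sub_volume m.
set v := M%:R ^+ d / _; move: v => v V.
have S0 : 0 <= \sum_k cabs (c 0 k) ^+ 2 by apply: sumr_ge0 => k _; rewrite sqr_ge0.
move: h S0 small_kap Bkap_ge0; rewrite -/B.
move: (\sum_k _) (\sum_j _) (B * kap) => S T b h S0 b1 b0.
have h2 : 9 / 10 * S <= S - T by have := ler_wpM2r S0 b1; lra.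
apply: le_trans (ler_pM _ _ V h2); lra.
Qed.

Lemma sum_option_like (F : 'I_s.+1 -> 'I_s.+1 -> R) :
  \sum_j \sum_(k | k != j) F j k =
  \sum_k F ord0 (lift ord0 k) + \sum_j F (lift ord0 j) ord0 +
  \sum_j \sum_(k | k != j) F (lift ord0 j) (lift ord0 k).
Proof.
rewrite big_ord_recl big_mkcond big_ord_recl /= add0r -addrA; congr (_ + _).
rewrite -big_split; apply: eq_bigr => j _ /=.
rewrite big_mkcond big_ord_recl /=; congr (_ + _).
rewrite [RHS]big_mkcond; apply: eq_bigr => k _.
by rewrite (inj_eq lift_inj).
Qed.

(** The point [w] is adjoined to the sources with coefficient 1, and [subcube_lower] is applied to
    [s.+1] frequencies. Since [w] may be close to [theta l], their interaction stays in the result: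
    a small distance forces this kernel to be nearly 1. *)
Lemma distance_lower w l x (delta : R) :
  (forall k, k != l -> sep / (2 * m%:R) <= torus_dist w (theta k)) ->
  (x <= Phi)%MS -> ip (phi w - x) (phi w - x) <= delta ->
  9 / 10 * (1 - 2 * (B * kap) - rker L M (w - theta l)) <= delta.
Proof.
move=> hw /submxP[b ->]; rewrite mul_steering_mx => hd.
(* In the second case this quantity also multiplies the sum of the squared coefficients, which can
   then be dropped. *)
have [neg|pos] := leP (1 - 2 * (B * kap) - rker L M (w - theta l)) 0.
  by apply: (le_trans _ (le_trans (ip_ge0 _) hd)); lra.
apply: le_trans hd.
pose om (k : 'I_s.+1) := if unlift ord0 k is Some j then theta j else w.
pose c (k : 'I_s.+1) := if unlift ord0 k is Some j then - b 0 j else 1.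
have -> : phi w - \sum_l0 b 0 l0 *: phi (theta l0) = \sum_k c k *: steering m (om k).
  rewrite big_ord_recl /c /om unlift_none scale1r; congr (_ + _).
  by rewrite -sumrN; apply: eq_bigr => k _; rewrite liftK scaleNr.
have := subcube_lower om c (sub_lenD m) isT colen_gt0; apply: le_trans.
have cabsN_b : \sum_k cabs (- b 0 k) ^+ 2 = \sum_k cabs (b 0 k) ^+ 2.
  by apply: eq_bigr => k _; rewrite cabsN.
set rho := rker L M (w - theta l) in pos *.
have sE : \sum_k cabs (c k) ^+ 2 = 1 + \sum_k cabs (b 0 k) ^+ 2.
  rewrite big_ord_recl {1}/c unlift_none cabs1 expr1n; congr (_ + _).
  by apply: eq_bigr => k _; rewrite /c liftK cabsN.
have oE : \sum_j \sum_(k | k != j) cabs (c j) * cabs (c k) * rker L M (om j - om k) <=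
    rho * (1 + \sum_k cabs (b 0 k) ^+ 2) + B * kap + 2 * (B * kap) * \sum_k cabs (b 0 k) ^+ 2.
  rewrite sum_option_like.
  have cross : \sum_k cabs (b 0 k) * rker L M (w - theta k) <=
     rho / 2 * (1 + \sum_k cabs (b 0 k) ^+ 2) + B * kap / 2 + B * kap / 2 * \sum_k cabs (b 0 k) ^+ 2.
    rewrite (bigD1 l) //= -/rho.
    have r0 : 0 <= rho by exact: rker_ge0.
    have bl : cabs (b 0 l) ^+ 2 <= \sum_k cabs (b 0 k) ^+ 2.
      by rewrite (bigD1 l) //= lerDl sumr_ge0 // => k _; rewrite sqr_ge0.
    have bo : \sum_(k | k != l) cabs (b 0 k) ^+ 2 <= \sum_k cabs (b 0 k) ^+ 2.
      by rewrite [leRHS](bigD1 l) //= lerDr sqr_ge0.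
    have pk := rker_packed hw.
    have rk k : k != l -> rker L M (w - theta k) <= B * kap.
      move=> kl; apply: le_trans pk; rewrite (bigD1 k) //= lerDl.
      by apply: sumr_ge0 => j _; exact: rker_ge0.
    have h1 : cabs (b 0 l) * rho <= rho / 2 * (1 + \sum_k cabs (b 0 k) ^+ 2).
      rewrite mulrC -mulrA; apply: ler_wpM2l => //.
      have := sqr_ge0 (cabs (b 0 l) - 1); rewrite sqrrB expr1n; lra.
    have h2 : \sum_(k | k != l) cabs (b 0 k) * rker L M (w - theta k) <=
        B * kap / 2 + B * kap / 2 * \sum_(k | k != l) cabs (b 0 k) ^+ 2.
      apply: (@le_trans _ _ (\sum_(k | k != l) (rker L M (w - theta k) / 2 + B * kap / 2 * cabs (b 0 k) ^+ 2))).
        apply: ler_sum => k kl.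
        have h3 : cabs (b 0 k) ^+ 2 * rker L M (w - theta k) <= cabs (b 0 k) ^+ 2 * (B * kap).
          by apply: ler_wpM2l; [exact: sqr_ge0|exact: rk].
        have h4 : 0 <= (cabs (b 0 k) - 1) ^+ 2 * rker L M (w - theta k).
          by apply: mulr_ge0; [exact: sqr_ge0|exact: rker_ge0].
        move: h4; rewrite sqrrB expr1n; lra.
      rewrite big_split /= -mulr_suml -mulr_sumr lerD2r; lra.
    have := ler_wpM2l Bkap_ge0 bo; lra.
  have e1 : \sum_k cabs (c ord0) * cabs (c (lift ord0 k)) * rker L M (om ord0 - om (lift ord0 k)) =
      \sum_k cabs (b 0 k) * rker L M (w - theta k).
    by apply: eq_bigr => k _; rewrite /c /om !unlift_none !liftK cabs1 mul1r cabsN.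
  have e2 : \sum_k cabs (c (lift ord0 k)) * cabs (c ord0) * rker L M (om (lift ord0 k) - om ord0) =
      \sum_k cabs (b 0 k) * rker L M (w - theta k).
    by apply: eq_bigr => k _; rewrite /c /om !unlift_none !liftK cabs1 mulr1 cabsN -rkerN opprB.
  rewrite e1 e2.
  have e3 : \sum_j \sum_(k | k != j) cabs (c (lift ord0 j)) * cabs (c (lift ord0 k)) *
      rker L M (om (lift ord0 j) - om (lift ord0 k)) <= B * kap * \sum_k cabs (b 0 k) ^+ 2.
    rewrite -cabsN_b; apply: le_trans (offdiag_le (fun k => - b 0 k)).
    rewrite le_eqVlt; apply/orP; left; apply/eqP.
    apply: eq_bigr => j _; apply: eq_bigr => k _; by rewrite /c /om !liftK.
  lra.
rewrite sE; have := sub_volume m.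
set v := M%:R ^+ d / _; move: v => v V.
have S0 : 0 <= \sum_k cabs (b 0 k) ^+ 2 by apply: sumr_ge0 => k _; rewrite sqr_ge0.
move: oE S0 pos small_kap Bkap_ge0; rewrite -/B.
move: (\sum_k _) (\sum_j _) (B * kap) => S T b' h S0 pos b1 b0.
apply: ler_pM; [lra|lra|exact: V|].
have h5 : 0 <= (1 - 2 * b' - rho) * S by apply: mulr_ge0 => //; exact: ltW.
lra.
Qed.

End Fixed.

Lemma prod_le1 (I : finType) (P : pred I) (p : I -> R) : (forall i, 0 <= p i <= 1) ->
  \prod_(i | P i) p i <= 1.
Proof.
move=> hp; suff /andP[] : 0 <= \prod_(i | P i) p i <= 1 by [].
apply: (big_ind (fun x => 0 <= x <= 1)); first by rewrite ler01 lexx.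
  by move=> x y /andP[x0 x1] /andP[y0 y1]; rewrite mulr_ge0 // mulr_ile1.
by move=> i _; exact: hp.
Qed.

(** Each factor satisfies [p (1 + (1 - p)) <= 1]. A product close to 1 therefore has a small sum of
    deficits, with no loss in the number of factors. *)
Lemma prod_deficit n (p : 'I_n -> R) : (forall i, 0 <= p i <= 1) ->
  (\prod_i p i) * (1 + \sum_i (1 - p i)) <= 1.
Proof.
elim: n p => [|n IH] p hp; first by rewrite !big_ord0 addr0 mulr1.
rewrite !big_ord_recl.
have h := IH _ (fun i => hp (lift ord0 i)); have /andP[p0 p1] := hp ord0.
have P1 : \prod_i p (lift ord0 i) <= 1.
  by apply: prod_le1 => i; exact: hp.
have P0 : 0 <= \prod_i p (lift ord0 i).
  by apply: prodr_ge0 => i _; case/andP: (hp (lift ord0 i)).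
move: (\prod_i _) (\sum_i _) (p ord0) p0 p1 P0 P1 h => P S q q0 q1 P0 P1 h.
have a := ler_wpM2l q0 h.
have b : q * (1 - q) * P <= (1 - q) * 1.
  by rewrite mulrAC; apply: le_trans (_ : 1 * (1 - q) <= _); [apply: ler_wpM2r; [lra|rewrite mulr_ile1]|lra].
lra.
Qed.

Lemma prod_lower n (p : 'I_n -> R) : (forall i, 0 <= p i <= 1) ->
  1 - \sum_i (1 - p i) <= \prod_i p i.
Proof.
elim: n p => [|n IH] p hp; first by rewrite !big_ord0 subr0.
rewrite !big_ord_recl.
have h := IH _ (fun i => hp (lift ord0 i)); have /andP[p0 p1] := hp ord0.
have P1 : \prod_i p (lift ord0 i) <= 1.
  by apply: prod_le1 => i; exact: hp.
have P0 : 0 <= \prod_i p (lift ord0 i).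
  by apply: prodr_ge0 => i _; case/andP: (hp (lift ord0 i)).
move: (\prod_i _) (\sum_i _) (p ord0) p0 p1 P0 P1 h => P S q q0 q1 P0 P1 h.
have a : 0 <= (1 - q) * (1 - P) by apply: mulr_ge0; lra.
lra.
Qed.

(** The deficits of the factors sum to at most [2 x], and [geo_near] turns each deficit into 16
    times as much of a squared coordinate. The sum is a Euclidean bound free of [d]. *)
Lemma kernel_localization m v (x : R) : (0 < m)%N -> x <= 1 / 20 ->
  1 - x <= rker (sub_len m) (sub_colen m) v ->
  (m%:R * en (red v)) ^+ 2 <= 32 * x.
Proof.
move=> m0 x20 hx; have cl := sub_colen_ge m.
have M0 : (0 < sub_colen m)%N by lia.
have Mp : 0 < (sub_colen m)%:R :> R by rewrite ltr0n.
pose p i := cabs (geo (sub_colen m) (red v 0 i)) / (sub_colen m)%:R.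
have p01 i : 0 <= p i <= 1.
  by rewrite divr_ge0 ?cabs_ge0 //= ler_pdivrMr // mul1r geo_le.
have hp : 1 - x <= \prod_i p i by apply: le_trans hx _; exact: rker_geo.
have pi_ge i : 1 - x <= p i.
  apply: le_trans hp _; rewrite (bigD1 i) //= -[leRHS]mulr1; apply: ler_wpM2l.
    by case/andP: (p01 i).
  by apply: prod_le1 => j; exact: p01.
have hS : \sum_i (1 - p i) <= 2 * x.
  have h := prod_deficit p01.
  have S0 : 0 <= \sum_i (1 - p i) by apply: sumr_ge0 => i _; case/andP: (p01 i); lra.
  have P1 : \prod_i p i <= 1 by apply: prod_le1 => j; exact: p01.
  move: (\prod_i _) (\sum_i _) hp h S0 P1 => P S hp h S0 P1.
  have a : (1 - x) * (1 + S) <= 1 by apply: le_trans h; apply: ler_wpM2r => //; lra.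
  have x0 : 0 <= x by lra.
  have : 0 <= (1 / 20 - x) * S by apply: mulr_ge0 => //; lra.
  lra.
rewrite exprMn en2 mulr_sumr.
apply: (@le_trans _ _ (\sum_i 16 * (1 - p i))); last by rewrite -mulr_sumr; lra.
apply: ler_sum => i _; rewrite -exprMn.
apply: (@le_trans _ _ (((sub_colen m)%:R * red v 0 i) ^+ 2)).
  rewrite !exprMn; apply: ler_wpM2r; first exact: sqr_ge0.
  by apply: lerXn2r; rewrite ?nnegrE // ler_nat; lia.
apply: geo_near; [lia|exact: red_half| |].
  by have := pi_ge i; lra.
by rewrite subKr /p mulrC divfK // gt_eqF.
Qed.

End SeparatedSources.

(** * The MUSIC function near a source *)

Section LocalAnalysis.
Variables (R : realType) (d m : nat).
Implicit Types (w v u e : 'rV[R]_d).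
Local Notation en := (@euclidean_norm R d).
Local Notation phi := (@steering R d m).
Let N : R := (2 * m).+1%:R ^+ d.

Definition dphi u w : 'rV[R[i]]_#|{: cube m d}| :=
  \row_j (Complex 0 (2 * pi * inner u (cube_pt (enum_val j))) * phi w 0 j).

Lemma dphiZ (t : R) u w : dphi (t *: u) w = rc t *: dphi u w.
Proof.
apply/rowP => j; rewrite !mxE mulrA; congr (_ * _).
have -> : inner (t *: u) (cube_pt (enum_val j)) = t * inner u (cube_pt (enum_val j)).
  by rewrite /inner mulr_sumr; apply: eq_bigr => i _; rewrite mxE mulrA.
by apply/eqP; rewrite eq_complex /= !mul0r !mulr0 subr0 addr0 eqxx /=; apply/eqP; ring.
Qed.

Lemma dphi_periodic u w (z : 'rV[int]_d) : dphi u (w + map_mx intr z) = dphi u w.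
Proof. by rewrite /dphi steering_periodic. Qed.

Lemma inner_sum u (y : 'rV[int]_d) : inner u y = \sum_i u 0 i * inner (delta_mx 0 i : 'rV[R]_d) y.
Proof.
apply: eq_bigr => i _; congr (_ * _).
rewrite /inner (bigD1 i) //= big1 => [|j ji]; first by rewrite mxE !eqxx mul1r addr0.
by rewrite mxE (negbTE ji) andbF mul0r.
Qed.

Lemma dphi_sum u w : dphi u w = \sum_i rc (u 0 i) *: dphi (delta_mx 0 i) w.
Proof.
apply/rowP => j; rewrite summxE mxE inner_sum.
rewrite (eq_bigr (fun i => Complex 0 (2 * pi * (u 0 i * inner (delta_mx 0 i) (cube_pt (enum_val j)))) * phi w 0 j)).
  rewrite -mulr_suml; congr (_ * _); apply/eqP.
  by rewrite eq_complex Re_sum Im_sum /= -mulr_sumr big1 // !eqxx.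
move=> i _; rewrite !mxE mulrA; congr (_ * _).
by apply/eqP; rewrite eq_complex /= !mul0r !mulr0 subr0 addr0 eqxx /=; apply/eqP; ring.
Qed.

Lemma cexp_taylor (y : R) : 7 * `|y| <= 1 ->
  cabs (cexp y - 1 - Complex 0 (2 * pi * y)) <= 41 * y ^+ 2.
Proof.
move=> hy; apply: le_trans (cabs_le_ReIm _) _; rewrite /= subr0.
set z := 2 * pi * y.
have p := @pi_bounds R; have /andP[p1 p2] := p.
have z1 : `|z| <= 64 / 10 * `|y|.
  by rewrite /z normrM gtr0_norm ?mulr_gt0 ?pi_gt0 //; apply: ler_wpM2r => //; lra.
have z2 : z ^+ 2 <= 41 * y ^+ 2.
  rewrite -(real_normK (num_real z)) -(real_normK (num_real y)).
  have : `|z| ^+ 2 <= (64 / 10 * `|y|) ^+ 2.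
    by apply: lerXn2r; rewrite ?nnegrE ?mulr_ge0.
  by move=> /le_trans; apply; rewrite exprMn; apply: ler_wpM2r; [exact: sqr_ge0|lra].
apply: le_trans z2.
have c1 : `|cos z - 1| <= z ^+ 2 / 2.
  by rewrite ler_norml; have := cos_ge2 z; have := cos_le1 z; have := sqr_ge0 z; lra.
have s1 := sin_bound z.
have : `|z| ^+ 3 <= z ^+ 2.
  rewrite -(real_normK (num_real z)) exprS; apply: ler_piMl; first exact: sqr_ge0.
  lra.
by rewrite oppr0 addr0; have := sqr_ge0 z; lra.
Qed.

Lemma inner_le u (x : cube m d) : `|inner u (cube_pt x)| <= d%:R * (m%:R * en u).
Proof.
rewrite innerE; apply: le_trans (ler_norm_sum _ _ _) _.
apply: (@le_trans _ _ (\sum_(i < d) m%:R * en u)); last first.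
  by rewrite sumr_const card_ord [leRHS]mulr_natl.
apply: ler_sum => i _; rewrite normrM mulrC; apply: ler_pM => //.
  exact: centered_le.
exact: en_coord.
Qed.

Lemma nrm_mul_le n (c v : 'rV[R[i]]_n) (b : R) : 0 <= b ->
  (forall j, cabs (c 0 j) <= b) -> nrm (\row_j (c 0 j * v 0 j)) <= b * nrm v.
Proof.
move=> b0 cb; have -> : \row_j (c 0 j * v 0 j) = v *m diag_mx c.
  by rewrite mul_mx_diag; apply/rowP => j; rewrite !mxE mulrC.
exact: nrm_diag_le.
Qed.

Lemma steering_taylor w u : 7 * (d%:R * (m%:R * en u)) <= 1 ->
  nrm (phi (w + u) - phi w - dphi u w) <= 41 * d%:R ^+ 2 * (m%:R * en u) ^+ 2.
Proof.
move=> hu.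
pose c : 'rV[R[i]]_#|{: cube m d}| := \row_j
   (cexp (inner u (cube_pt (enum_val j))) - 1 - Complex 0 (2 * pi * inner u (cube_pt (enum_val j)))).
have -> : phi (w + u) - phi w - dphi u w = \row_j (c 0 j * phi w 0 j).
  apply/rowP => j; rewrite !mxE innerDl cexpD; ring.
rewrite -[leRHS]mulr1 -[X in _ <= _ * X](nrm_steering m w); apply: nrm_mul_le => [|j].
  by rewrite mulr_ge0 ?sqr_ge0 // mulr_ge0 ?sqr_ge0.
have hj := inner_le u (enum_val j).
rewrite mxE; apply: le_trans (cexp_taylor _) _; first lra.
rewrite -mulrA -exprMn; apply: ler_wpM2l => //.
rewrite -(real_normK (num_real (inner _ _))); apply: lerXn2r; rewrite ?nnegrE //.
by rewrite !mulr_ge0 ?en_ge0.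
Qed.

(** The inner product of two steering vectors at difference [e], real because the cube is symmetric
    about the origin. *)
Definition Kr e : R := \prod_i dk m (e 0 i).

Lemma hd_steering_shift w e : hd (phi (w + e)) (phi w) = rc (Kr e).
Proof.
rewrite hd_steering /Kr (_ : rc _ = \prod_i rc (dk m (e 0 i))).
  by apply: eq_bigr => i _; rewrite addrC addKr dkerE.
exact: (big_morph (@rc R) (@rcM R) (erefl _)).
Qed.

Lemma dk_range e i : m%:R * en e <= 1 / 64 -> 0 <= dk m (e 0 i) <= 1.
Proof.
move=> he; rewrite dk_le1 andbT; apply: le_trans (dk_ge _ _).
have h : `|m%:R * e 0 i| <= 1 / 64.
  by rewrite normrM ger0_norm //; apply: le_trans he; rewrite ler_wpM2l // en_coord.
have : `|m%:R * e 0 i| ^+ 2 <= (1 / 64) ^+ 2 by apply: lerXn2r; rewrite ?nnegrE //; lra.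
by rewrite real_normK ?num_real // [(1 / 64) ^+ 2]expr2; lra.
Qed.

Lemma Kr_range e (P : pred 'I_d) : m%:R * en e <= 1 / 64 ->
  1 - 21 * (m%:R * en e) ^+ 2 <= \prod_(i | P i) dk m (e 0 i) <= 1.
Proof.
move=> he; have dr i := dk_range i he; apply/andP; split; last first.
  by apply: prod_le1 => i; exact: dr.
rewrite big_mkcond.
apply: le_trans (prod_lower _) => [|i]; last first.
  by case: ifP => _; [exact: dr|rewrite ler01 lexx].
rewrite lerD2l lerN2 exprMn en2 mulr_sumr mulr_sumr; apply: ler_sum => i _.
rewrite -exprMn; case: ifP => _; first by have := dk_ge m (e 0 i); lra.
by have := sqr_ge0 (m%:R * e 0 i); lra.
Qed.

(** The square of the left side is [2 (1 - Kr e) <= 42 r^2], and [42 < (13/2)^2]. Entrywise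
    estimates would bring in [d]. *)
Lemma nrm_steering_diff w e : m%:R * en e <= 1 / 64 ->
  nrm (phi (w + e) - phi w) <= 13 / 2 * (m%:R * en e).
Proof.
move=> he; have r0 : 0 <= m%:R * en e by rewrite mulr_ge0 ?en_ge0.
apply: nrm_le_sq; first lra.
rewrite ipBl !ipBr [ip (phi w) (phi (w + e))]ipC -!nrm2 !nrm_steering.
rewrite /ip hd_steering_shift /= -/(Kr e).
have /andP[h _] := @Kr_range e xpredT he; rewrite -/(Kr e) in h.
rewrite expr1n [leRHS]exprMn [(13 / 2) ^+ 2]expr2.
by have := sqr_ge0 (m%:R * en e); lra.
Qed.

(** The bound [nrm_steering_diff] is applied to [t *: u] for a small [t]. The Taylor error depends
    on [d] but is quadratic in [t], so that it disappears in the limit. *)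
Lemma nrm_dphi u w : nrm (dphi u w) <= 13 / 2 * (m%:R * en u).
Proof.
apply/ler_addgt0Pr => eps eps0.
set r := m%:R * en u; have r0 : 0 <= r by rewrite mulr_ge0 ?en_ge0.
set C := 41 * d%:R ^+ 2 * r ^+ 2.
have C0 : 0 <= C by rewrite mulr_ge0 ?sqr_ge0 // mulr_ge0 ?sqr_ge0.
pose D := 1 + 64 * r + 7 * (d%:R * r) + C / eps.
have dr : 0 <= d%:R * r by rewrite mulr_ge0.
have Ce : 0 <= C / eps by rewrite divr_ge0 // ltW.
have D0 : 0 < D by rewrite /D; lra.
pose t := D^-1; have t0 : 0 < t by rewrite invr_gt0.
have enu : m%:R * en (t *: u) = t * r by rewrite enZ gtr0_norm // mulrCA.
have tD : t * D = 1 by rewrite mulVf // gt_eqF.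
have le1 (x : R) : x <= D -> t * x <= 1 by move=> xD; rewrite -tD ler_pM2l.
have c1 : 7 * (d%:R * (m%:R * en (t *: u))) <= 1.
  rewrite enu; have -> : 7 * (d%:R * (t * r)) = t * (7 * (d%:R * r)) by ring.
  by apply: le1; rewrite /D; lra.
have c2 : m%:R * en (t *: u) <= 1 / 64.
  have : t * (64 * r) <= 1 by apply: le1; rewrite /D; lra.
  by rewrite enu; lra.
have h1 := steering_taylor w c1; have h2 := nrm_steering_diff w c2.
have h3 : nrm (dphi (t *: u) w) <= 13 / 2 * (t * r) + 41 * d%:R ^+ 2 * (t * r) ^+ 2.
  rewrite -enu; apply: le_trans (lerD h2 h1).
  by apply: le_trans (nrmB _ _); rewrite opprB addrC subrK.
rewrite dphiZ nrmZ cabs_rc gtr0_norm // in h3.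
rewrite -(ler_pM2l t0); apply: le_trans h3 _.
rewrite mulrDr mulrCA lerD2l.
have -> : 41 * d%:R ^+ 2 * (t * r) ^+ 2 = t * (t * C) by rewrite /C; ring.
rewrite ler_pM2l //.
have -> : C = (C / eps) * eps by rewrite divfK // gt_eqF.
rewrite mulrA -[leRHS]mul1r; apply: ler_wpM2r; first exact: ltW.
by apply: le1; rewrite /D; lra.
Qed.

Lemma ip_phi_dphi u w : ip (phi w) (dphi u w) = 0.
Proof.
rewrite /ip /hd Re_sum big1 // => j _; rewrite [dphi _ _ _ _]mxE rmorphM /= mulrCA mulcJ.
by rewrite conjCE mulrC Re_rcM /= mulr0.
Qed.

(** The product rule: this is the partial derivative of [Kr] at [e] in coordinate [i]. *)
Lemma ip_dphi_center e w i :
  ip (phi w) (dphi (delta_mx 0 i) (w + e)) =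
  - (2 * pi * ddk m (e 0 i)) * \prod_(j | j != i) dk m (e 0 j).
Proof.
rewrite ipC /ip.
suff -> : hd (dphi (delta_mx 0 i) (w + e)) (phi w) =
   rc (- (2 * pi * ddk m (e 0 i)) * \prod_(j | j != i) dk m (e 0 j)) by [].
have ptE (x : cube m d) : inner (delta_mx 0 i : 'rV[R]_d) (cube_pt x) = (x i)%:R - m%:R.
  rewrite innerE (bigD1 i) //= big1 => [|j ji]; first by rewrite mxE !eqxx mul1r addr0.
  by rewrite mxE (negbTE ji) andbF mul0r.
pose f (j : 'I_d) (k : 'I_(2 * m).+1) : R[i] :=
  (if j == i then rc (k%:R - m%:R) else 1) * cexp (e 0 j * (k%:R - m%:R)).
rewrite /hd.
rewrite (eq_bigr (fun j => (fun x : cube m d => (Complex 0 (2 * pi) * \prod_(i < d) rc (2 * m).+1%:R^-1) * \prod_j f j (x j)) (enum_val j))); last first.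
  move=> j _; rewrite [dphi _ _ _ _]mxE ptE -[\prod_(i0 < d) rc _](@norm_const R d m).
  rewrite /f big_split /= (bigD1 i) //= eqxx big1 => [|k /negbTE ->] //.
  rewrite mulr1 -cexp_inner_prod !mxE rmorphM /= -!/(rc _).
  rewrite innerDl cexpD.
  have : cexp (inner w (cube_pt (enum_val j))) * (cexp (inner w (cube_pt (enum_val j))))^* = 1 :> R[i].
    by rewrite mulcJ cabs_cexp expr1n.
  move: (cexp (inner w _)) (cexp (inner e _)) (rc (Num.sqrt _)^-1) => a b s.
  have -> : Complex 0 (2 * pi * ((enum_val j i)%:R - m%:R)) = Complex 0 (2 * pi) * rc ((enum_val j i)%:R - m%:R) :> R[i].
    by apply/eqP; rewrite eq_complex /= !mul0r !mulr0 subr0 add0r !eqxx.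
  move: (Complex 0 _) (rc _) => p q aa.
  transitivity ((a * a^*) * (p * (s * s^*) * (q * b))); first by ring.
  by rewrite aa mul1r.
rewrite (sum_cube (fun x : cube m d => _ * \prod_j f j (x j))) -mulr_sumr sum_prod_cube -mulrA -big_split /=.
rewrite (bigD1 i) //=.
have -> : rc (2 * m).+1%:R^-1 * (\sum_k f i k) = Complex 0 (ddk m (e 0 i)).
  by rewrite -ddkE /f eqxx.
rewrite (eq_bigr (fun j => rc (dk m (e 0 j)))) => [|j /negbTE ji]; last first.
  by rewrite -dkerE /f ji; congr (_ * _); apply: eq_bigr => k _; rewrite mul1r.
have -> : \prod_(j | j != i) rc (dk m (e 0 j)) = rc (\prod_(j | j != i) dk m (e 0 j)).
  by elim/big_rec2: _ => [|j a b _ ->] //; rewrite rcM.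
rewrite mulrA rcM; congr (_ * _).
by apply/eqP; rewrite eq_complex /= !mul0r !mulr0 !add0r !eqxx.
Qed.

(** For a single source without noise the MUSIC function is [1 - Kr^2], with gradient [- 2 Kr] times
    that of [Kr]. Linearization leaves the relative error [(560 + 84 * 28) r^2], which is below 1
    for [r <= 1/64]. *)
Lemma main_gradient_coord e w i : (1 <= m)%N -> m%:R * en e <= 1 / 64 ->
  `|2 * ip (phi (w + e) - rc (Kr e) *: phi w) (dphi (delta_mx 0 i) (w + e)) - 2 * mu R m * e 0 i|
   <= m%:R ^+ 2 * `|e 0 i|.
Proof.
move=> m1 he; rewrite ipBl ip_phi_dphi ipZl ip_dphi_center sub0r.
have /andP[K0 K1] := @Kr_range e xpredT he; rewrite -/(Kr e) in K0 K1.
have /andP[P0 P1] := @Kr_range e (fun j => j != i) he.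
have /andP[mu0 mu1] := @mu_bounds R m m1.
have D := ddk_approx m (e 0 i).
move: (Kr e) (\prod_(j | _) _) K0 K1 P0 P1 => K P K0 K1 P0 P1.
set g := 2 * pi * ddk m (e 0 i) in D *.
set x := e 0 i in D *.
have xle : m%:R * `|x| <= m%:R * en e by rewrite ler_wpM2l // en_coord.
set r := m%:R * en e in he K0 P0 xle.
have r0 : 0 <= r by rewrite mulr_ge0 ?en_ge0.
have r2 : r ^+ 2 <= (1 / 64) ^+ 2 by apply: lerXn2r; rewrite ?nnegrE //; lra.
have r2' : 64 * (64 * r ^+ 2) <= 1 by move: r2; rewrite [(1 / 64) ^+ 2]expr2; lra.
have rr := sqr_ge0 r.
have KP1 : K * P <= 1 by rewrite mulr_ile1 //; lra.
have KP0 : 1 - 42 * r ^+ 2 <= K * P.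
  have : 0 <= (1 - K) * (1 - P) by apply: mulr_ge0; lra.
  lra.
have -> : 2 * - (K * (- g * P)) - 2 * mu R m * x =
  2 * (K * P) * (g - mu R m * x) - 2 * (1 - K * P) * (mu R m * x) by ring.
apply: le_trans (ler_normB _ _) _.
have x2 : m%:R ^+ 2 * `|x| ^+ 2 <= r ^+ 2.
  by rewrite -exprMn; apply: lerXn2r; rewrite ?nnegrE // mulr_ge0.
have mx0 : 0 <= m%:R ^+ 2 * `|x| by rewrite mulr_ge0 ?sqr_ge0.
have h1 : `|2 * (K * P) * (g - mu R m * x)| <= 560 * (m%:R ^+ 2 * `|x| * r ^+ 2).
  rewrite normrM; apply: (@le_trans _ _ (2 * (280 * m%:R ^+ 4 * `|x| ^+ 3))).
    by apply: ler_pM; [exact: normr_ge0|exact: normr_ge0|rewrite ger0_norm; lra|exact: D].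
  have -> : 2 * (280 * m%:R ^+ 4 * `|x| ^+ 3) = 560 * (m%:R ^+ 2 * `|x| * (m%:R ^+ 2 * `|x| ^+ 2)) by ring.
  apply: ler_wpM2l; first lra.
  by apply: ler_wpM2l.
have h2 : `|2 * (1 - K * P) * (mu R m * x)| <= 84 * r ^+ 2 * (28 * (m%:R ^+ 2 * `|x|)).
  rewrite normrM; apply: ler_pM; [exact: normr_ge0|exact: normr_ge0|rewrite ger0_norm; lra|].
  rewrite normrM mulrA ger0_norm; first by apply: ler_wpM2r.
  by apply: le_trans mu0; rewrite mulr_ge0 ?sqr_ge0.
have h3 := ler_wpM2l mx0 r2'.
lra.
Qed.

Section Projected.
Variable W : 'M[R[i]]_#|{: cube m d}|.
Local Notation P' := (proj_ortho W).
Local Notation q := (music W).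
Let Q (v : 'rV[R[i]]_#|{: cube m d}|) := v - v *m P'.

Lemma musicE w : q w = ip (Q (phi w)) (Q (phi w)).
Proof. by rewrite ip_self. Qed.

Lemma QD x y : Q (x + y) = Q x + Q y.
Proof. by rewrite /Q mulmxDl opprD addrACA. Qed.

(** Twice the constant [41 d^2] of [steering_taylor], plus a bound for [(13/2)^2]. *)
Definition Lam : R := 82 * d%:R ^+ 2 + 43.

(** Valid at every [w] and for every space [W]. It serves twice: to identify the gradient, and to
    show that steps to neighbouring grid points decrease the MUSIC function. *)
Lemma music_expand w u : 64 * (d.+1%:R * (m%:R * en u)) <= 1 ->
  `|q (w + u) - q w - 2 * ip (Q (phi w)) (dphi u w)| <= Lam * (m%:R * en u) ^+ 2.
Proof.
have c43 : (13 / 2) ^+ 2 <= 43 :> R by rewrite expr2; lra.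
move=> hu; set r := m%:R * en u in hu *; have r0 : 0 <= r by rewrite mulr_ge0 ?en_ge0.
have dr : 0 <= d%:R * r by rewrite mulr_ge0.
have dE : d.+1%:R * r = d%:R * r + r by rewrite -natr1 mulrDl mul1r.
have hu' : 64 * (d%:R * r + r) <= 1 by rewrite -dE.
have c1 : 7 * (d%:R * r) <= 1 by lra.
have c2 : r <= 1 / 64 by lra.
have r13 : 0 <= 13 / 2 * r by lra.
have h1 := steering_taylor w c1; have h2 := nrm_steering_diff w c2.
have qE : q (w + u) - q w - 2 * ip (Q (phi w)) (dphi u w) =
  2 * ip (Q (phi w)) (phi (w + u) - phi w - dphi u w) + ip (Q (phi (w + u) - phi w)) (Q (phi (w + u) - phi w)).
  rewrite !musicE.
  move: (phi (w + u)) (phi w) (dphi u w) => a b c.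
  have aE : a = b + (a - b) by rewrite addrC subrK.
  move: (a - b) aE => dl ->.
  have h : ip (Q b) (Q dl) = ip (Q b) dl := ip_compl W b dl.
  rewrite QD; move: (Q b) (Q dl) h => x y h.
  by rewrite ipDl !ipDr ipNr [ip y x]ipC h; ring.
rewrite qE; apply: le_trans (ler_normD _ _) _; rewrite /Lam [leRHS]mulrDl; apply: lerD.
  rewrite normrM gtr0_norm //.
  have : `|ip (Q (phi w)) (phi (w + u) - phi w - dphi u w)| <= 1 * (41 * d%:R ^+ 2 * r ^+ 2).
    apply: le_trans (cauchy_schwarz _ _) _; apply: ler_pM; rewrite ?nrm_ge0 //.
    by rewrite -(nrm_steering m w) nrm_compl.
  by move: `|_| => X hX; clear -hX; lra.
rewrite ger0_norm ?ip_ge0 // -nrm2.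
apply: (@le_trans _ _ ((13 / 2 * r) ^+ 2)).
  by apply: lerXn2r; rewrite ?nnegrE; [exact: nrm_ge0|exact: r13|exact: le_trans (nrm_compl W _) h2].
by rewrite exprMn; apply: ler_wpM2r; [exact: sqr_ge0|exact: c43].
Qed.

Lemma Lam_ge0 : 0 <= Lam.
Proof. by rewrite addr_ge0 // mulr_ge0 ?sqr_ge0. Qed.

Lemma gradientE w i : gradient q w 0 i = 2 * ip (Q (phi w)) (dphi (delta_mx 0 i) w).
Proof.
rewrite mxE /derive; set D := 2 * _.
apply: cvg_lim => //; apply/cvgrPdist_le => eps eps0.
pose r := m%:R * en (delta_mx 0 i); have r0 : 0 <= r by rewrite mulr_ge0 ?en_ge0.
(* For [|t| <= B^-1] the expansion applies, and its error divided by [|t|] is at most [eps]. *)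
pose B := 1 + 64 * (d.+1%:R * r) + Lam * r ^+ 2 / eps.
have dr0 : 0 <= d.+1%:R * r by rewrite mulr_ge0.
have Lr0 : 0 <= Lam * r ^+ 2 by rewrite mulr_ge0 ?Lam_ge0 ?sqr_ge0.
have Le0 : 0 <= Lam * r ^+ 2 / eps by rewrite divr_ge0 // ltW.
have B0 : 0 < B by rewrite /B; lra.
near=> t.
have t0 : t != 0 by near: t; exact: nbhs_dnbhs_neq.
have tB : `|t| <= B^-1.
  near: t; apply: dnbhs0_le; by rewrite invr_gt0.
have tB1 : `|t| * B <= 1 by rewrite -ler_pdivlMr // div1r.
have tp : 0 < `|t| by rewrite normr_gt0.
have enE : m%:R * en (t *: delta_mx 0 i) = `|t| * r by rewrite enZ mulrCA.
have c : 64 * (d.+1%:R * (m%:R * en (t *: delta_mx 0 i))) <= 1.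
  rewrite enE; apply: le_trans tB1.
  have -> : 64 * (d.+1%:R * (`|t| * r)) = `|t| * (64 * (d.+1%:R * r)) by ring.
  by apply: ler_wpM2l => //; rewrite /B; lra.
have := music_expand w c; rewrite enE dphiZ ipZr.
rewrite /shift /= [t *: _ + w]addrC.
set y := q (w + _) - q w => hy.
have -> : D - t^-1 *: y = - (t^-1 * (y - 2 * (t * ip (Q (phi w)) (dphi (delta_mx 0 i) w)))).
  rewrite /D -[t^-1 *: y]/(t^-1 * y); field; exact: t0.
rewrite normrN normrM normfV mulrC ler_pdivrMr //.
apply: le_trans hy _; rewrite exprMn expr2.
have -> : Lam * (`|t| * `|t| * r ^+ 2) = (`|t| * (Lam * r ^+ 2)) * `|t| by ring.
apply: ler_wpM2r => //.
have h : `|t| * (Lam * r ^+ 2 / eps) <= 1.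
  by apply: le_trans tB1; apply: ler_wpM2l => //; rewrite /B; lra.
by move: h; rewrite mulrA ler_pdivrMr // mul1r.
Unshelve. all: by end_near.
Qed.

Lemma dot_gradient w u : dot (gradient q w) u = 2 * ip (Q (phi w)) (dphi u w).
Proof.
rewrite dphi_sum /ip hd_sumr Re_sum mulr_sumr; apply: eq_bigr => i _.
by rewrite gradientE -/(ip _ (rc _ *: _)) ipZr mulrAC mulrA.
Qed.

End Projected.

End LocalAnalysis.

(** * Gradient, contraction and localization for a space close to the signal space *)

Section Core.
Variables (R : realType) (d m s : nat) (theta : 'I_s -> 'rV[R]_d).
Variables (sep kap sg nu : R).
Local Notation en := (@euclidean_norm R d).
Local Notation iz := (map_mx (intr : int -> R)).
Local Notation phi := (@steering R d m).
Local Notation Phi := (steering_mx m theta).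
Hypotheses (d_gt0 : (0 < d)%N) (m_gt0 : (0 < m)%N) (sep_gt0 : 0 < sep) (kap_ge0 : 0 <= kap).
Hypothesis theta_sep : ((sep / m%:R)%:E <= separation theta)%E.
Hypothesis packed : forall w (P : pred 'I_s),
  (forall k, P k -> sep / (2 * m%:R) <= torus_dist w (theta k)) ->
  \sum_(k | P k) decay m (red (w - theta k)) <= kap.
(** The scale of the threshold, which lies between [(sg / 2) ^+ 2] and [sg ^+ 2]. Of the next two
    bounds on the interference, the first is for [localization], the second for the gradient. *)
Hypothesis sgE : sg = 1 / 1024.
Hypothesis kap_small1 : (1 + 10 * d%:R) ^+ d * kap <= sg ^+ 2.
Hypothesis kap_small2 : 2 * ((200 * d%:R ^+ 2 + 86) * (2 ^+ d * kap)) <= (1 / 13) ^+ 2.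
Variable W : 'M[R[i]]_#|{: cube m d}|.
Hypotheses (nu_ge0 : 0 <= nu) (nu_small : nu <= sg / 256).
Hypothesis Phi_W : forall x, (x <= Phi)%MS -> nrm (x - x *m proj_ortho W) <= 4 * nu * nrm x.
Hypothesis W_Phi : forall x, (x <= W)%MS -> nrm (x - x *m proj_ortho Phi) <= 4 * nu * nrm x.
Local Notation q := (music W).

Let mp : 0 < m%:R :> R. Proof. by rewrite ltr0n. Qed.

Lemma sg_sq : sg ^+ 2 <= 1 / 10.
Proof. by rewrite sgE expr2; lra. Qed.

Lemma Gram_half c : (1 / 2) * ip c c <= ip (c *m Phi) (c *m Phi).
Proof.
apply: (Gram_lower d_gt0 m_gt0 sep_gt0 kap_ge0 theta_sep packed).
exact: le_trans kap_small1 sg_sq.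
Qed.

(** The interference of the other sources. The inner products of the displacement with their
    steering vectors are square summable by packing, and the Gram bound turns them into a bound on
    the projection. The constant [1 / 13] cancels the [13 / 2] of [nrm_dphi]: the effect on the
    gradient is [m^2 |e|]. *)
Lemma near_orthogonal l e : m%:R * en e <= 1 / 64 ->
  forall dl, dl = phi (theta l + e) - phi (theta l) ->
  nrm ((dl - hd dl (phi (theta l)) *: phi (theta l)) *m proj_ortho Phi) <=
    1 / 13 * (m%:R * en e).
Proof.
move=> he dl dlE; set r := m%:R * en e in he *.
have r0 : 0 <= r by rewrite mulr_ge0 ?en_ge0.
set c := hd dl (phi (theta l)); set d' := dl - c *: phi (theta l).
set y := d' *m proj_ortho Phi.
have /submxP[b yE] : (y <= Phi)%MS by exact: proj_sub.
pose hh k := hd d' (phi (theta k)).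
have hl : hh l = 0.
  rewrite /hh /d' hdBl hdZl hd_self -nrm_sq_sum -nrm2 nrm_steering expr1n.
  by rewrite (_ : rc 1 = 1) // mulr1 subrr.
have cr : cabs c ^+ 2 <= 42 * r ^+ 2 + 1 * r ^+ 2.
  have : cabs c <= 13 / 2 * r.
    apply: le_trans (hd_le _ _) _; rewrite nrm_steering mulr1 dlE; exact: nrm_steering_diff.
  move=> h; apply: (@le_trans _ _ ((13 / 2 * r) ^+ 2)).
    by apply: lerXn2r; rewrite ?nnegrE ?cabs_ge0 // (le_trans (cabs_ge0 _) h).
  by rewrite exprMn [(13 / 2) ^+ 2]expr2; have := sqr_ge0 r; lra.
have he1 i : m%:R * `|e 0 i| <= 1 / 64.
  by apply: le_trans he; apply: ler_wpM2l => //; exact: en_coord.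
have hk k : k != l -> cabs (hh k) ^+ 2 <=
    (200 * d%:R ^+ 2 + 86) * r ^+ 2 * 2 ^+ d * decay m (red (theta l - theta k)).
  move=> kl; have -> : hh k = hd dl (phi (theta k)) - c * hd (phi (theta l)) (phi (theta k)).
    by rewrite /hh /d' hdBl hdZl.
  have h1 : cabs (hd dl (phi (theta k))) ^+ 2 <= (100 * d%:R ^+ 2 * r ^+ 2) * (2 ^+ d * decay m (red (theta l - theta k))).
    by rewrite dlE hdBl; exact: hd_steering_diff.
  have h2 : cabs (c * hd (phi (theta l)) (phi (theta k))) ^+ 2 <= 43 * r ^+ 2 * (2 ^+ d * decay m (red (theta l - theta k))).
    rewrite cabsM exprMn; apply: ler_pM; rewrite ?sqr_ge0 //; first by lra.
    exact: hd_steering_decay.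
  rewrite -[leRHS]mulrA.
  have h3 := cabsB (hd dl (phi (theta k))) (c * hd (phi (theta l)) (phi (theta k))).
  move: (cabs_ge0 (hd dl (phi (theta k)) - c * hd (phi (theta l)) (phi (theta k)))) h1 h2 h3.
  move: (cabs_ge0 (hd dl (phi (theta k)))) (cabs_ge0 (c * hd (phi (theta l)) (phi (theta k)))).
  move: (cabs _) (cabs (c * _)) (cabs (_ - _)) (2 ^+ d * _) => x z t D x0 z0 t0 h1 h2 h3.
  have h4 : t ^+ 2 <= (x + z) ^+ 2 by apply: lerXn2r; rewrite ?nnegrE //; lra.
  apply: le_trans h4 _; have := sqr_ge0 (x - z); rewrite sqrrB sqrrD;  lra.
have H2 : \sum_k cabs (hh k) ^+ 2 <= (1 / 13 * r) ^+ 2 / 2.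
  rewrite (bigD1 l) //= hl cabs0 expr0n /= add0r.
  apply: (@le_trans _ _ (\sum_(k | k != l) (200 * d%:R ^+ 2 + 86) * r ^+ 2 * 2 ^+ d * decay m (red (theta l - theta k)))).
    by apply: ler_sum => k; exact: hk.
  rewrite -mulr_sumr.
  have pk : \sum_(k | k != l) decay m (red (theta l - theta k)) <= kap.
    by apply: packed => k kl; apply: (theta_dist_half m_gt0 sep_gt0 theta_sep); rewrite eq_sym.
  apply: le_trans (ler_wpM2l _ pk) _.
    by apply: mulr_ge0; [apply: mulr_ge0; [apply: addr_ge0; [apply: mulr_ge0; [lra|exact: sqr_ge0]|lra]|exact: sqr_ge0]|exact: exprn_ge0].
  rewrite [leRHS](_ : _ = (1 / 13) ^+ 2 * r ^+ 2 / 2); last by rewrite exprMn.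
  have := ler_wpM2r (sqr_ge0 r) kap_small2; move: (r ^+ 2) ((1 / 13) ^+ 2) => rr D h.
  rewrite ler_pdivlMr // [leLHS](_ : _ = 2 * ((200 * d%:R ^+ 2 + 86) * (2 ^+ d * kap)) * rr) //; ring.
have Y2 : nrm y ^+ 2 <= dot (\row_k cabs (b 0 k)) (\row_k cabs (hh k)).
  rewrite nrm2.
  have -> : ip y y = ip d' y.
    by have := ip_proj d' (proj_sub Phi d'); rewrite -/y ipBl => /eqP; rewrite subr_eq0 => /eqP ->.
  rewrite yE mul_steering_mx /ip hd_sumr Re_sum /dot; apply: ler_sum => k _.
  rewrite !mxE hdZr; apply: le_trans (Re_lec _) _; by rewrite cabsM cabsJ.
have B2 : euclidean_norm (\row_k cabs (b 0 k) : 'rV[R]_s) ^+ 2 <= 2 * nrm y ^+ 2.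
  have -> : euclidean_norm (\row_k cabs (b 0 k) : 'rV[R]_s) ^+ 2 = ip b b.
    by rewrite en2 nrm_sq_sum; apply: eq_bigr => k _; rewrite mxE.
  by have := Gram_half b; rewrite -yE -[ip y y]nrm2; lra.
have {}H2 : euclidean_norm (\row_k cabs (hh k) : 'rV[R]_s) ^+ 2 <= (1 / 13 * r) ^+ 2 / 2.
  by rewrite en2; under eq_bigr => k _ do rewrite mxE.
have {}Y2 := le_trans Y2 (dot_le _ _).
move: (euclidean_norm _) (euclidean_norm _) (en_ge0 (\row_k cabs (b 0 k) : 'rV[R]_s))
  (en_ge0 (\row_k cabs (hh k) : 'rV[R]_s)) Y2 B2 H2 => Z X X0 Z0 Y2 B2 H2.
move: (nrm y) (nrm_ge0 y) Y2 B2 => Y Y0 Y2 B2.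
have {r0}r0 : 0 <= 1 / 13 * r by lra.
move: (1 / 13 * r) r0 H2 => T T0 H2.
have [->//|Yn] := eqVneq Y 0.
have Yp : 0 < Y ^+ 2 by rewrite exprn_gt0 // lt_def Yn.
have h1 : (Y ^+ 2) ^+ 2 <= (X * Z) ^+ 2.
  by apply: lerXn2r; rewrite ?nnegrE ?sqr_ge0 ?mulr_ge0.
have h2 : X ^+ 2 * Z ^+ 2 <= (2 * Y ^+ 2) * (T ^+ 2 / 2).
  by apply: ler_pM; rewrite ?sqr_ge0.
apply: sq_le_abs => //; rewrite -(ler_pM2l Yp).
rewrite -[leLHS]expr2; apply: le_trans h1 _; rewrite [leLHS]exprMn; apply: le_trans h2 _; lra.
Qed.

Lemma en_test (n : nat) (x : 'rV[R]_n) (b : R) : 0 <= b ->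
  (forall u, dot x u <= b * euclidean_norm u) -> euclidean_norm x <= b.
Proof.
move=> b0 h; have := h x; rewrite dot_self.
have [->//|x0] := eqVneq (euclidean_norm x) 0.
by rewrite expr2 ler_pM2r // lt_def x0 en_ge0.
Qed.

Lemma ip_sub3 n (a b c x : 'rV[R[i]]_n) : ip (a - b - c) x = ip a x - ip b x - ip c x.
Proof. by rewrite !ipBl. Qed.

Lemma compl_split n (P : 'M[R[i]]_n) (p t : 'rV[R[i]]_n) :
  p - p *m P = (t - t *m P) + ((p - t) - (p - t) *m P).
Proof.
rewrite mulmxBl; move: (p *m P) (t *m P) => a b.
by apply/rowP => j; rewrite !mxE; ring.
Qed.

Lemma proj_close v : nrm (v *m proj_ortho W - v *m proj_ortho Phi) <= 8 * nu * nrm v.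
Proof.
have n4 : 0 <= 4 * nu by rewrite mulr_ge0.
by have := nrm_proj_diff n4 n4 Phi_W W_Phi v; rewrite -mulrDl -natrD.
Qed.

(* Up to the noise, the gradient is that of a quadratic form of curvature [2 mu]. *)
Lemma gradient_estimate l e z : m%:R * en e <= 1 / 64 ->
  en (gradient q (theta l + e + iz z) - (2 * mu R m) *: e) <=
  2 * m%:R ^+ 2 * en e + 104 * nu * m%:R.
Proof.
move=> he; apply: en_test => [|u].
  by rewrite addr_ge0 ?mulr_ge0 ?en_ge0 ?sqr_ge0.
set w := theta l + e.
rewrite dotDl dot_gradient dphi_periodic steering_periodic -/w.
set dl := phi w - phi (theta l).
have hn := near_orthogonal he (erefl dl); rewrite -/w in hn.
set y := (_ *m proj_ortho Phi) in hn.
set v := phi w *m proj_ortho W - phi w *m proj_ortho Phi.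
have vn : nrm v <= 8 * nu by have := proj_close (phi w); rewrite nrm_steering mulr1.
have cE : hd dl (phi (theta l)) = rc (Kr m e) - 1.
  by rewrite /dl hdBl hd_steering_shift hd_self -nrm_sq_sum -nrm2 nrm_steering expr1n.
(* The residual of a single source, the interference [y] and the effect [v] of the noise. Their
   contributions to the final bound are [m^2 |e|], [m^2 |e|] and [104 nu m]. *)
have QE : phi w - phi w *m proj_ortho W = (phi w - rc (Kr m e) *: phi (theta l)) - y - v.
  have : phi w *m proj_ortho Phi = rc (Kr m e) *: phi (theta l) + y.
    have pf : phi (theta l) *m proj_ortho Phi = phi (theta l).
      by rewrite proj_ortho_id // steering_sub.
    rewrite /y cE mulmxBl /dl mulmxBl -scalemxAl pf.
    move: (phi w *m _) (phi (theta l)) => a b.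
    by apply/rowP => j; rewrite !mxE; ring.
  have gen (p A K y' : 'rV[R[i]]_#|{: cube m d}|) : p - A = (p - K) - y' - (A - (K + y')).
    by apply/rowP => j; rewrite !mxE; ring.
  by rewrite /v => ->; exact: gen.
rewrite QE ip_sub3.
clearbody v y; clear QE cE.
have hm : 2 * ip (phi w - rc (Kr m e) *: phi (theta l)) (dphi m u w) + dot (- (2 * mu R m *: e)) u <=
    m%:R ^+ 2 * en e * en u.
  have -> : 2 * ip (phi w - rc (Kr m e) *: phi (theta l)) (dphi m u w) + dot (- (2 * mu R m *: e)) u =
    dot (\row_i (2 * ip (phi w - rc (Kr m e) *: phi (theta l)) (dphi m (delta_mx 0 i) w) - 2 * mu R m * e 0 i)) u.
    rewrite dphi_sum {1}/ip hd_sumr Re_sum mulr_sumr -big_split; apply: eq_bigr => i _ /=.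
    by rewrite !mxE -/(ip _ (rc _ *: _)) ipZr; ring.
  apply: le_trans (dot_le _ _) _; apply: ler_wpM2r; first exact: en_ge0.
  rewrite -[m%:R ^+ 2](ger0_norm (sqr_ge0 _)) -enZ; apply: en_le => i.
  rewrite mxE [in leRHS]mxE normrM (ger0_norm (sqr_ge0 (m%:R : R))).
  exact: main_gradient_coord.
have dn := nrm_dphi m u w.
have hy : - ip y (dphi m u w) <= 1 / 13 * (m%:R * en e) * (13 / 2 * (m%:R * en u)).
  rewrite -ipNl; apply: le_trans (ip_le _ _) _; rewrite nrmN.
  by apply: ler_pM => //; exact: nrm_ge0.
have hv : - ip v (dphi m u w) <= 8 * nu * (13 / 2 * (m%:R * en u)).
  rewrite -ipNl; apply: le_trans (ip_le _ _) _; rewrite nrmN.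
  by apply: ler_pM => //; exact: nrm_ge0.
move: (ip _ _) (ip y _) (ip v _) (dot _ u) hm hy hv => a1 a2 a3 a4 hm hy hv.
move: (en e) (en u) hm hy hv => ee eu hm hy hv.
 lra.
Qed.

Lemma gradient_lower l e z : m%:R * en e <= 1 / 64 ->
  18 * m%:R ^+ 2 * en e - 104 * nu * m%:R <= en (gradient q (theta l + e + iz z)).
Proof.
move=> he; have h := gradient_estimate l z he.
set g := gradient q _ in h *.
have h2 : en ((2 * mu R m) *: e) <= en g + en (g - (2 * mu R m) *: e).
  by apply: le_trans (enB _ _); rewrite opprB addrC subrK.
have /andP[mu0 _] := @mu_bounds R m m_gt0.
have mup : 0 <= mu R m by apply: le_trans mu0; rewrite mulr_ge0 ?sqr_ge0.
rewrite enZ ger0_norm in h2; last by rewrite mulr_ge0.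
have h3 := ler_wpM2r (en_ge0 e) mu0.
lra.
Qed.

Lemma music_upper l e z : m%:R * en e <= 1 / 64 ->
  q (theta l + e + iz z) <= (4 * nu + 13 / 2 * (m%:R * en e)) ^+ 2.
Proof.
move=> he; rewrite musicE steering_periodic -nrm2.
have e0 : 0 <= m%:R * en e by rewrite mulr_ge0 ?en_ge0.
apply: lerXn2r; rewrite ?nnegrE ?nrm_ge0 //; first by rewrite addr_ge0 // mulr_ge0.
set w := theta l + e.
rewrite (compl_split _ _ (phi (theta l))).
apply: le_trans (nrmD _ _) _; apply: lerD.
  by apply: le_trans (Phi_W (steering_sub _ _ _)) _; rewrite nrm_steering mulr1.
by apply: le_trans (nrm_compl _ _) _; exact: nrm_steering_diff.
Qed.

Section Step.
Variable h : R.
Hypothesis h_range : 1 / 128 / m%:R ^+ 2 <= h <= 1 / 64 / m%:R ^+ 2.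

(** With [y = h m^2] in [[1/128, 1/64]], a step multiplies the error by at most
    [1 - 20 y + 2 y <= 7/8] and adds [104 nu y <= 2 nu]. Since [2 h mu <= 56 y < 1], the step does
    not overshoot. The shift [z] stays the same, so the iterates never change their lift. *)
Lemma contraction l e z : m%:R * en e <= 1 / 64 ->
  exists2 e', gradient_step q h (theta l + e + iz z) = theta l + e' + iz z &
    m%:R * en e' <= 7 / 8 * (m%:R * en e) + 2 * nu.
Proof.
have nu0 := nu_ge0; move=> he; set g := gradient q (theta l + e + iz z).
exists (e - h *: g); first by rewrite /gradient_step -/g addrA [RHS]addrAC.
have hg := gradient_estimate l z he; rewrite -/g in hg.
have -> : e - h *: g = (1 - 2 * (h * mu R m)) *: e - h *: (g - (2 * mu R m) *: e).
  by apply/rowP => i; rewrite !mxE; ring.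
have /andP[mu0 mu1] := @mu_bounds R m m_gt0.
have m2 : 0 < m%:R ^+ 2 :> R by rewrite exprn_gt0.
move/andP: h_range => [hl hu].
have hl' : 1 / 128 <= h * m%:R ^+ 2 by rewrite -ler_pdivrMr.
have hu' : h * m%:R ^+ 2 <= 1 / 64 by rewrite -ler_pdivlMr.
have h0 : 0 <= h by apply: le_trans hl; rewrite divr_ge0 // ltW.
have a1 : 10 * (h * m%:R ^+ 2) <= h * mu R m by have := ler_wpM2l h0 mu0; lra.
have a2 : h * mu R m <= 28 * (h * m%:R ^+ 2) by have := ler_wpM2l h0 mu1; lra.
have b1 : en ((1 - 2 * (h * mu R m)) *: e) <= (1 - 20 * (h * m%:R ^+ 2)) * en e.
  rewrite enZ; apply: ler_wpM2r; first exact: en_ge0.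
  move: (h * mu R m) (h * m%:R ^+ 2) a1 a2 hl' hu' => x y a1 a2 hl' hu'.
  by rewrite ger0_norm;  lra.
have b2 : en (h *: (g - (2 * mu R m) *: e)) <= 2 * (h * m%:R ^+ 2) * en e + 104 * nu * (h * m%:R).
  rewrite enZ ger0_norm //; apply: le_trans (ler_wpM2l h0 hg) _.
  by rewrite le_eqVlt; apply/orP; left; apply/eqP; ring.
have b3 := le_trans (enB _ _) (lerD b1 b2).
apply: le_trans (ler_wpM2l (ltW mp) b3) _.
have -> : m%:R * ((1 - 20 * (h * m%:R ^+ 2)) * en e + (2 * (h * m%:R ^+ 2) * en e + 104 * nu * (h * m%:R)))
   = (1 - 18 * (h * m%:R ^+ 2)) * (m%:R * en e) + 104 * (nu * (h * m%:R ^+ 2)) by ring.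
have e0 : 0 <= m%:R * en e by rewrite mulr_ge0 ?en_ge0.
have c1 := ler_wpM2r e0 hl'; have c2 := ler_wpM2l nu_ge0 hu'.
move: (h * m%:R ^+ 2) (m%:R * en e) c1 c2 e0 => y x c1 c2 e0.
by  lra.
Qed.

(** The number [16 nu] is the fixed point of [x |-> 7/8 x + 2 nu]. Smallness of [nu] keeps the
    iterates in the linear regime. *)
Lemma iterates l e z n : m%:R * en e <= 1 / 64 ->
  exists e', [/\ iter n (gradient_step q h) (theta l + e + iz z) = theta l + e' + iz z,
    m%:R * en e' <= 1 / 64 & m%:R * en e' <= (7 / 8) ^+ n + 16 * nu].
Proof.
have nu0 := nu_ge0; have nus := nu_small; rewrite sgE in nus.
move=> he; elim: n => [|n [e' [itE he' hn]]].
  exists e; split => //; rewrite expr0;  lra.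
have [e2 sE h2] := contraction l z he'.
exists e2; split; first by rewrite iterS itE.
  lra.
rewrite exprS;  lra.
Qed.

End Step.

Lemma seq_argmin (T : eqType) (r : seq T) (F : T -> R) : r != [::] ->
  exists2 x, x \in r & forall y, y \in r -> F x <= F y.
Proof.
elim: r => // a r IH _; have [->|r0] := eqVneq r [::].
  by exists a; rewrite ?mem_head // => y; rewrite inE => /eqP ->.
have [x xr hx] := IH r0.
have [ax|xa] := leP (F a) (F x).
  exists a; first by rewrite mem_head.
  by move=> y; rewrite inE => /orP[/eqP ->//|/hx]; exact: le_trans.
exists x; first by rewrite inE xr orbT.
by move=> y; rewrite inE => /orP[/eqP ->|/hx //]; exact: ltW.
Qed.

Lemma localization_arith (rho K S : R) :
  9 / 10 * (1 - 2 * K - rho) <= 2 * S -> K <= S -> 0 <= S -> 1 - 5 * S <= rho.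
Proof. lra. Qed.

Lemma nearest_arith (x y D S T : R) :
  x < T -> y <= x -> S <= D -> D <= x + y -> S = T + T -> False.
Proof. lra. Qed.

(* If [q w] is small, then [phi w] is close to the signal space, and so to one of
   its generators. *)
Lemma localization w : (0 < s)%N -> q w <= sg ^+ 2 ->
  exists l, m%:R * torus_dist w (theta l) <= 1 / 64.
Proof.
move=> s0 qw; have nu0 := nu_ge0; have nus := nu_small.
have sg0 : 0 <= sg by rewrite sgE; lra.
have n4 : 0 <= 4 * nu by lra.
have sn0 : 0 <= sg + 4 * nu by lra.
have sn2 : (sg + 4 * nu) ^+ 2 <= 2 * sg ^+ 2.
  apply: (@le_trans _ _ ((65 / 64 * sg) ^+ 2)); first by apply: lerXn2r; rewrite ?nnegrE; lra.
  by rewrite exprMn; apply: ler_wpM2r; [exact: sqr_ge0|rewrite expr2; lra].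
have s5 : 5 * sg ^+ 2 <= 1 / 20 by rewrite sgE expr2; lra.
(* This inequality dictates the size of [sg]: the deficit [5 sg^2] of the kernel must place [w] in
   the linear regime. *)
have s6 : 32 * (5 * sg ^+ 2) <= (1 / 64) ^+ 2 by rewrite sgE !expr2; lra.
have c64 : 0 <= 1 / 64 :> R by lra.
(* All sources except the nearest one are at least half a separation away from [w]. *)
have [|l _ hl] := @seq_argmin _ (enum 'I_s) (fun l => torus_dist w (theta l)).
  by rewrite -size_eq0 size_enum_ord -lt0n.
have far k : k != l -> sep / (2 * m%:R) <= torus_dist w (theta k).
  move=> kl; rewrite leNgt; apply/negP => hk.
  have h3 := torus_dist_tri (theta k) w (theta l).
  rewrite [torus_dist (theta k) w]torus_dist_sym in h3.
  apply: (nearest_arith hk (hl k (mem_enum _ _)) (theta_dist theta_sep kl) h3).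
  by field; rewrite gt_eqF.
exists l.
(* Projecting to [W] and then to the clean signal space reaches a point [x] at distance at most
   [sg + 4 nu] from [phi w], to which [distance_lower] applies. *)
set xt := phi w *m proj_ortho W.
have xtW : nrm (xt - xt *m proj_ortho Phi) <= 4 * nu.
  apply: le_trans (W_Phi (proj_sub _ _)) _; rewrite -[leRHS]mulr1.
  apply: ler_wpM2l; first exact: n4.
  by apply: le_trans (nrm_proj _ _) _; rewrite nrm_steering.
set x := xt *m proj_ortho Phi.
have xP : (x <= Phi)%MS by exact: proj_sub.
have n1 : nrm (phi w - xt) <= sg.
  by apply: sq_le_abs; rewrite ?nrm_ge0 // nrm2 -musicE.
have n2 : nrm (phi w - x) <= sg + 4 * nu.
  have -> : phi w - x = (phi w - xt) + (xt - x) by rewrite addrA subrK.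
  by apply: le_trans (nrmD _ _) _; exact: lerD.
have ip2 : ip (phi w - x) (phi w - x) <= 2 * sg ^+ 2.
  rewrite -nrm2; apply: le_trans sn2; apply: lerXn2r; [|exact: sn0|exact: n2].
  exact: nrm_ge0.
have dk := distance_lower d_gt0 m_gt0 sep_gt0 kap_ge0 theta_sep packed
  (le_trans kap_small1 sg_sq) far xP ip2.
have hx := localization_arith dk kap_small1 (sqr_ge0 _).
have k1 := kernel_localization d_gt0 m_gt0 s5 hx.
rewrite /torus_dist torus_normE; apply: sq_le_abs; [|exact: c64|exact: le_trans k1 s6].
by rewrite mulr_ge0 ?en_ge0.
Qed.

(** For a unit vector [n], the condition on [dot v n] puts [v] in the ball of radius [b] about
    [- b n]. The first-order decrease is then quadratic in [v], like the error term, and wins if the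
    gradient is large compared to [b]. *)
Lemma music_descent w v n (b : R) : 0 < b ->
  64 * (d.+1%:R * (m%:R * en v)) <= 1 -> v != 0 -> gradient q w = en (gradient q w) *: n ->
  dot v n <= - (en v ^+ 2 / (2 * b)) ->
  2 * b * (Lam R d * m%:R ^+ 2) < en (gradient q w) -> q (w + v) < q w.
Proof.
move=> b0 hv v0 gn hvn hg.
have := music_expand W w hv; rewrite -dot_gradient gn dotZl [dot n v]dotC exprMn.
rewrite ler_norml => /andP[_ h1].
have ev : 0 < en v ^+ 2.
  rewrite exprn_gt0 // lt_def en_ge0 andbT; apply: contra v0 => /eqP/en_eq0 ->; by rewrite eqxx.
have h2 := ler_wpM2l (en_ge0 (gradient q w)) hvn.
have h3 : Lam R d * m%:R ^+ 2 * en v ^+ 2 < en (gradient q w) * (en v ^+ 2 / (2 * b)).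
  rewrite mulrA ltr_pdivlMr ?mulr_gt0 // mulrAC ltr_pM2r //.
  by rewrite mulrC.
rewrite mulrN in h2; rewrite mulrA in h1.
move: (q (w + v)) (q w) (Lam R d * m%:R ^+ 2 * en v ^+ 2) (en (gradient q w) * (en v ^+ 2 / (2 * b)))
  (en (gradient q w) * dot v n) h1 h2 h3 => a1 a2 a3 a4 a5 h1 h2 h3.
 lra.
Qed.

End Core.

(** * Clusters of accepted grid points *)

Section Grid.
Variables (R : realType) (d : nat).
Local Notation en := (@euclidean_norm R d).
Local Notation iz := (map_mx (intr : int -> R)).
Implicit Types (G : {fset 'rV[R]_d}) (w u v n : 'rV[R]_d).

Lemma mesh_cover G w : 0 < mesh G -> exists2 g, g \in G & torus_dist w g <= mesh G.
Proof.
move=> G0.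
(* On the empty grid all the infima are 0 and so is the mesh; its positivity thus provides a grid
   point. *)
have Gn : enum_fset G != [::].
  apply/negP => /eqP G_; move: G0.
  have -> : mesh G = 0; last by rewrite ltxx.
  rewrite /mesh (_ : [set _ | _ in _] = [set 0 : R]) ?sup1 //.
  have e0 x : [set torus_dist x w0 | w0 in [set` G]] = set0.
    apply/seteqP; split => // y [g /= gG _].
    by have : g \in enum_fset G by []; rewrite G_.
  apply/seteqP; split => [y [x _ <-]|y ->] /=; first by rewrite e0 inf0.
  by exists 0 => //; rewrite e0 inf0.
have [g gG gm] := @seq_argmin R _ (enum_fset G) (torus_dist w) Gn.
exists g => //.
have h1 : torus_dist w g <= inf [set torus_dist w w0 | w0 in [set` G]].
  apply: lb_le_inf; first by exists (torus_dist w g); exists g.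
  by move=> _ [y yG <-]; exact: gm.
apply: le_trans h1 _; apply: ub_le_sup; last by exists w.
exists d%:R => _ [x _ <-].
have [y yG] : exists y, y \in G by exists g.
apply: le_trans (torus_norm_bounded (x - y)); apply: ge_inf.
  by exists 0 => _ [z _ <-]; exact: torus_dist_ge0.
by exists y.
Qed.

(** Finitely many values leave a gap above [b], so a strict enlargement of a bound on distances to
    grid points can be undone. *)
Lemma seq_gap (T : eqType) (r : seq T) (F : T -> R) (b : R) :
  exists2 eps, 0 < eps & forall x, x \in r -> F x <= b + eps -> F x <= b.
Proof.
elim: r => [|a r [eps e0 he]]; first by exists 1.
have [ab|ba] := leP (F a) b.
  by exists eps => // x; rewrite inE => /orP[/eqP -> //|]; exact: he.
pose e2 := Num.min eps ((F a - b) / 2).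
have e20 : 0 < e2 by rewrite lt_min e0 /=; lra.
exists e2 => // x; rewrite inE => /orP[/eqP ->|xr] h.
  have : e2 <= (F a - b) / 2 by rewrite ge_min lexx orbT.
  lra.
have : e2 <= eps by rewrite ge_min lexx.
by move=> h2; apply: he => //; lra.
Qed.

(* The open ball of radius [mesh G + eps0] centred at [u - (mesh G + eps0) n]
   contains a lift of a grid point. *)
Lemma grid_descent G u n (eps0 : R) : 0 < mesh G -> en n = 1 -> 0 < eps0 ->
  exists g v z, [/\ g \in G, g = u + v + iz z, v != 0, torus_dist u g <= 2 * mesh G &
    en v <= 2 * mesh G + eps0 /\ dot v n <= - (en v ^+ 2 / (2 * (mesh G + eps0)))].
Proof.
move=> G0 n1 e0; set r := mesh G in G0 *.
have [e1 e10 he1] := seq_gap (enum_fset G) (torus_dist u) (2 * r).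
(* The centre of the ball is farther than the mesh from [u], which excludes [v = 0]. The bound
   [eps <= e1] brings the distance back to exactly [2 * mesh G], the radius of adjacency. *)
pose eps := Num.min eps0 e1.
have ep : 0 < eps by rewrite lt_min e0.
have ee0 : eps <= eps0 by rewrite ge_min lexx.
have ee1 : eps <= e1 by rewrite ge_min lexx orbT.
set p := u - (r + eps) *: n.
have [g gG hg] := mesh_cover p G0.
rewrite torus_dist_sym in hg.
have [z hz] := torus_lift (g - p); set t := g - p + iz z in hz.
have tr : en t <= r by rewrite -hz.
pose v := t - (r + eps) *: n.
have re0 : 0 < r + eps by lra.
have tE : t = v + (r + eps) *: n by rewrite /v subrK.
have gE : g = u + v + iz (- z).
  by apply/rowP => i; rewrite /v /t /p !mxE intrN; ring.
have env : en v <= 2 * r + eps.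
  apply: le_trans (enB _ _) _; rewrite enZ n1 mulr1 gtr0_norm //; lra.
have dn : dot v n <= - (en v ^+ 2 / (2 * (r + eps))).
  have : en t ^+ 2 <= r ^+ 2 by apply: lerXn2r; rewrite ?nnegrE ?en_ge0 // ltW.
  rewrite tE enD2 dotC dotZl enZ n1 mulr1 gtr0_norm // [dot n v]dotC => h.
  have rr : r ^+ 2 <= (r + eps) ^+ 2 by apply: lerXn2r; rewrite ?nnegrE; lra.
  by rewrite -mulNr ler_pdivlMr ?mulr_gt0 //; lra.
have udg : torus_dist u g <= 2 * r + eps.
  rewrite torus_dist_sym; apply: le_trans env.
  have -> : v = g - u + iz z by apply/rowP => i; rewrite gE !mxE intrN; ring.
  exact: torus_norm_le.
exists g, v, (- z); split => //.
- apply/eqP => v0; move: tr; rewrite tE v0 add0r enZ n1 mulr1 gtr0_norm //; lra.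
- by apply: he1 => //; lra.
split; first lra.
apply: le_trans dn _; rewrite lerN2; apply: ler_wpM2l; first exact: sqr_ge0.
by rewrite lef_pV2 ?posrE; lra.
Qed.

End Grid.

Section Transversal.
Variables (T : finType) (s : nat) (e : rel T) (lbl : T -> 'I_s) (rep : seq T).
Hypothesis eE : forall x y, e x y = (lbl x == lbl y).
Hypothesis lbl_onto : forall l, exists x, lbl x = l.
Hypothesis rep_uniq : uniq rep.
Hypothesis rep_tr : is_transversal [set:: rep]%SET (equivalence_partition e [set: T]%SET) [set: T]%SET.

Lemma rep_block x : exists2 y, y \in rep & lbl y = lbl x /\ forall z, z \in rep -> lbl z = lbl x -> z = y.
Proof.
move: rep_tr => /and3P[_ _ /forallP h].
pose B := [set y in [set: T] | e x y]%SET.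
have BP : B \in equivalence_partition e [set: T]%SET by apply/imsetP; exists x; rewrite ?inE.
move: (h B); rewrite BP /= => /cards1P[y yB].
have : y \in ([set:: rep] :&: B)%SET by rewrite yB inE.
rewrite !inE /= eE => /andP[yr /eqP xy].
exists y => //; split => // z zr zx.
by apply/set1P; rewrite -yB !inE zr eE zx eqxx.
Qed.

(** The blocks are the classes of equal label and every label occurs, so the labels of the
    representatives list ['I_s] without repetition; the permutation is the position in this list. *)
Lemma transversal_labels (x0 : T) : size rep = s /\
  exists tau : {perm 'I_s}, forall l, lbl (nth x0 rep (tau l)) = l.
Proof.
have inj : {in rep &, injective lbl}.
  move=> x y xr yr xy; have [z zr [_ hz]] := rep_block x.
  by rewrite (hz x xr erefl) (hz y yr (esym xy)).
have um : uniq (map lbl rep) by rewrite map_inj_in_uniq.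
have all_in l : l \in map lbl rep.
  have [x <-] := lbl_onto l; have [y yr [yx _]] := rep_block x.
  by rewrite -yx map_f.
have sz : size rep = s.
  rewrite -(size_map lbl) -[RHS]size_enum_ord; apply: perm_size.
  by apply: uniq_perm => //; [exact: enum_uniq|move=> l; rewrite all_in mem_enum].
split=> //.
have lt l : (index l (map lbl rep) < s)%N by have := all_in l; rewrite -index_mem size_map sz.
pose f l := Ordinal (lt l).
have f_inj : injective f.
  move=> l l' /(congr1 val) /= h.
  by rewrite -(nth_index l (all_in l)) h (nth_index l (all_in l')).
exists (perm f_inj) => l; rewrite permE /= -[LHS](nth_map x0 l lbl) ?sz //.
exact: nth_index.
Qed.

End Transversal.

Section Clusters.
Variables (R : realType) (d m s : nat) (theta : 'I_s -> 'rV[R]_d).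
Variables (sep kap sg nu : R).
Local Notation en := (@euclidean_norm R d).
Local Notation iz := (map_mx (intr : int -> R)).
Local Notation phi := (@steering R d m).
Local Notation Phi := (steering_mx m theta).
Hypotheses (d_gt0 : (0 < d)%N) (m_gt0 : (0 < m)%N) (sep_gt0 : 0 < sep) (kap_ge0 : 0 <= kap).
Hypothesis theta_sep : ((sep / m%:R)%:E <= separation theta)%E.
Hypothesis packed : forall w (P : pred 'I_s),
  (forall k, P k -> sep / (2 * m%:R) <= torus_dist w (theta k)) ->
  \sum_(k | P k) decay m (red (w - theta k)) <= kap.
Hypothesis sgE : sg = 1 / 1024.
Hypothesis kap_small1 : (1 + 10 * d%:R) ^+ d * kap <= sg ^+ 2.
Hypothesis kap_small2 : 2 * ((200 * d%:R ^+ 2 + 86) * (2 ^+ d * kap)) <= (1 / 13) ^+ 2.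
Variable W : 'M[R[i]]_#|{: cube m d}|.
Hypotheses (nu_ge0 : 0 <= nu) (nu_small : nu <= sg / 256).
Hypothesis Phi_W : forall x, (x <= Phi)%MS -> nrm (x - x *m proj_ortho W) <= 4 * nu * nrm x.
Hypothesis W_Phi : forall x, (x <= W)%MS -> nrm (x - x *m proj_ortho Phi) <= 4 * nu * nrm x.
Local Notation q := (music W).
Variables (G : {fset 'rV[R]_d}) (alpha1 h : R).
Hypotheses (s_gt0 : (0 < s)%N) (sep_ge1 : 1 <= sep) (mesh_gt0 : 0 < mesh G).
Hypothesis mesh_le : m%:R * mesh G <= sg / (32 * Lam R d).
Hypothesis alpha_range : (sg / 2) ^+ 2 <= alpha1 <= sg ^+ 2.
Hypothesis h_range : 1 / 128 / m%:R ^+ 2 <= h <= 1 / 64 / m%:R ^+ 2.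

Local Notation T := (accepted q G alpha1).
Local Notation near u l := (m%:R * torus_dist u (theta l) <= 1 / 64).
(** The border between the two regimes. Beyond it the gradient exceeds the noise, as
    [18 * 6 nu >= 104 nu]. Within it the MUSIC function stays below the threshold, as
    [4 nu + 13/2 rho1 <= sg / 2]. *)
Let rho1 : R := sg / 32 + 6 * nu.

Lemma lift_point u l : exists e z, u = theta l + e + iz z /\ en e = torus_dist u (theta l).
Proof.
have [z hz] := torus_lift (u - theta l).
exists (u - theta l + iz z), (- z); split; last by rewrite -hz.
by apply/rowP => i; rewrite !mxE intrN; ring.
Qed.

Lemma accepted_in (u : T) : val u \in G /\ q (val u) <= alpha1.
Proof. by have := fsvalP u; rewrite /accepted !inE => /andP[]. Qed.

Lemma accepted_point g : g \in G -> q g <= alpha1 -> exists u : T, val u = g.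
Proof.
move=> gG qg; have h0 : g \in T by rewrite /accepted !inE gG.
by exists [` h0]%fset.
Qed.

Lemma accepted_near (u : T) : exists l, near (val u) l.
Proof.
have [_ qu] := accepted_in u; have /andP[_ a2] := alpha_range.
apply: (localization d_gt0 m_gt0 sep_gt0 kap_ge0 theta_sep packed sgE kap_small1 nu_ge0 nu_small W_Phi s_gt0).
exact: le_trans qu a2.
Qed.

Lemma Lam_ge : 1 <= Lam R d /\ d.+1%:R <= Lam R d.
Proof.
have d1 : 1 <= d%:R :> R by rewrite ler1n.
have d2 : d%:R <= d%:R ^+ 2 :> R by rewrite expr2 ler_peMl.
rewrite /Lam -[d.+1%:R]natr1; split; lra.
Qed.

Lemma mesh_small : m%:R * mesh G <= sg / 32.
Proof.
apply: le_trans mesh_le _; have [L1 _] := Lam_ge.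
have L0 : 0 < Lam R d by lra.
have s0 : 0 <= sg by rewrite sgE; lra.
rewrite invfM mulrA ler_pdivrMr //.
have := ler_wpM2l (divr_ge0 s0 (ler0n R 32)) L1; rewrite mulr1; exact.
Qed.

Lemma mesh_Lam : Lam R d * (m%:R * mesh G) <= sg / 32.
Proof.
have [L1 _] := Lam_ge; have L0 : 0 < Lam R d by lra.
by rewrite mulrC -ler_pdivlMr //; have := mesh_le; rewrite invfM mulrA.
Qed.

(** Two radii [1/64] and two meshes are together shorter than the separation, at least 1 in units of
    [1/m]. Hence adjacency cannot lead from one source to another. *)
Lemma near_unique u v l l' : torus_dist u v <= 2 * mesh G ->
  near u l -> near v l' -> l = l'.
Proof.
move=> uv ul vl'; apply/eqP; apply/negP => /negP ll'.
have h1 := theta_dist theta_sep ll'.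
have mp : 0 < m%:R :> R by rewrite ltr0n.
rewrite ler_pdivrMr // mulrC in h1.
have h2 : torus_dist (theta l) (theta l') <= torus_dist u (theta l) + torus_dist u v + torus_dist v (theta l').
  apply: le_trans (torus_dist_tri _ v _) _; rewrite lerD2r.
  by apply: le_trans (torus_dist_tri _ u _) _; rewrite torus_dist_sym.
have h3 := ler_wpM2l (ltW mp) h2; have h4 := ler_wpM2l (ltW mp) uv.
have h5 := mesh_small; rewrite sgE in h5; have h6 := sep_ge1.
move: (m%:R * torus_dist (theta l) _) h1 h3 => D h1 h3.
rewrite !mulrDr in h3; lra.
Qed.

Lemma rho1_small : 0 <= rho1 /\ rho1 <= 1 / 64 /\ (4 * nu + 13 / 2 * rho1) ^+ 2 <= (sg / 2) ^+ 2.
Proof.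
have n0 := nu_ge0; have n1 := nu_small; have s0 : 0 <= sg by rewrite sgE; lra.
split; first by rewrite /rho1; lra.
split; first by rewrite /rho1; rewrite sgE in n1 *; lra.
by apply: lerXn2r; rewrite ?nnegrE /rho1; lra.
Qed.

Lemma close_accepted g l : g \in G -> m%:R * torus_dist g (theta l) <= rho1 ->
  exists u : T, val u = g.
Proof.
move=> gG gl; apply: accepted_point => //.
have [e [z [gE ee]]] := lift_point g l; have [r0 [r1 r2]] := rho1_small.
have he : m%:R * en e <= 1 / 64 by rewrite ee; exact: le_trans gl r1.
have /andP[a1 _] := alpha_range; apply: le_trans a1; apply: le_trans r2.
rewrite gE; apply: le_trans (music_upper nu_ge0 Phi_W l z he) _.
have n0 := nu_ge0; have e0 : 0 <= m%:R * en e by rewrite mulr_ge0 ?en_ge0.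
apply: lerXn2r; rewrite ?nnegrE.
- by apply: addr_ge0; apply: mulr_ge0 => //; lra.
- by apply: addr_ge0; apply: mulr_ge0 => //; lra.
by rewrite lerD2l; apply: ler_wpM2l; [lra|rewrite ee].
Qed.

(** The gradient is larger than [(18/32) sg m], which beats the second-order error over a few
    meshes. The neighbour has a smaller value and so is accepted as well. *)
Lemma descend_far (u : T) l : near (val u) l -> rho1 < m%:R * torus_dist (val u) (theta l) ->
  exists v : T, torus_dist (val u) (val v) <= 2 * mesh G /\ q (val v) < q (val u).
Proof.
move=> ul far; have [uG qu] := accepted_in u.
have [e [z [uE ee]]] := lift_point (val u) l.
have mp : 0 < m%:R :> R by rewrite ltr0n.
have he : m%:R * en e <= 1 / 64 by rewrite ee.
have hfar : rho1 < m%:R * en e by rewrite ee.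
have gl := gradient_lower d_gt0 m_gt0 sep_gt0 kap_ge0 theta_sep packed sgE kap_small1
  kap_small2 nu_ge0 Phi_W W_Phi l z he.
rewrite -uE in gl; set g := gradient q (val u) in gl.
have s0 : 0 < sg by rewrite sgE; lra.
have gm : m%:R * (18 / 32 * sg) < en g.
  apply: lt_le_trans gl.
  have -> : 18 * m%:R ^+ 2 * en e - 104 * nu * m%:R = m%:R * (18 * (m%:R * en e) - 104 * nu) by ring.
  have n0 := nu_ge0; rewrite ltr_pM2l //; rewrite /rho1 in hfar; lra.
have g0 : 0 < en g by apply: le_lt_trans gm; rewrite mulr_ge0 // mulr_ge0 ?ltW //; lra.
have n1 : en ((en g)^-1 *: g) = 1 by rewrite enZ gtr0_norm ?invr_gt0 // mulVf // gt_eqF.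
(* The slack is taken equal to the mesh, so the ball has radius [2 * mesh G] and [w] has length at
   most [3 * mesh G]. *)
have [v [w [z' [vG vE w0 uv [env dn]]]]] := grid_descent (val u) mesh_gt0 n1 mesh_gt0.
have ms := mesh_small; have [L1 L2] := Lam_ge; have mL := mesh_Lam.
have qd : q (val u + w) < q (val u).
  apply: (music_descent (b := mesh G + mesh G) (n := (en g)^-1 *: g)) => //.
  - by rewrite addr_gt0.
  - have ev : m%:R * en w <= 3 * (m%:R * mesh G) by have := ler_wpM2l (ltW mp) env; lra.
    have e0 : 0 <= m%:R * en w by rewrite mulr_ge0 ?en_ge0.
    have : d.+1%:R * (m%:R * en w) <= Lam R d * (3 * (m%:R * mesh G)) by apply: ler_pM.
    rewrite sgE in mL; lra.
  - by rewrite -/g scalerA mulfV ?gt_eqF // scale1r.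
  rewrite -/g; apply: le_lt_trans gm.
  have -> : 2 * (mesh G + mesh G) * (Lam R d * m%:R ^+ 2) = m%:R * (4 * (Lam R d * (m%:R * mesh G))) by ring.
  rewrite ler_pM2l //; lra.
have qv : q v < q (val u) by rewrite vE musicE steering_periodic -musicE.
have [x xE] := accepted_point vG (le_trans (ltW qv) qu).
by exists x; rewrite xE.
Qed.

(** Here the noise may dominate the gradient, so the step aims at the source itself. By
    [close_accepted] a grid point closer to the source is accepted whatever its exact value. *)
Lemma descend_close (u : T) l : m%:R * torus_dist (val u) (theta l) <= rho1 ->
  mesh G < torus_dist (val u) (theta l) ->
  exists v : T, torus_dist (val u) (val v) <= 2 * mesh G /\
    torus_dist (val v) (theta l) < torus_dist (val u) (theta l).
Proof.
move=> ur far; have [uG qu] := accepted_in u.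
have [e [z [uE ee]]] := lift_point (val u) l.
have mp : 0 < m%:R :> R by rewrite ltr0n.
have g0 := mesh_gt0.
rewrite -ee in far.
have e0 : 0 < en e by lra.
have n1 : en ((en e)^-1 *: e) = 1 by rewrite enZ gtr0_norm ?invr_gt0 // mulVf // gt_eqF.
(* With this slack the ball that touches [u] has radius less than [en e] and its centre lies between
   [u] and the source, so all its other points are strictly closer to the source. *)
have eps0 : 0 < (en e - mesh G) / 2 by lra.
have [v [w [z' [vG vE w0 uv [env dn]]]]] := grid_descent (val u) mesh_gt0 n1 eps0.
have ew0 : 0 < en w ^+ 2.
  by rewrite exprn_gt0 // lt_def en_ge0 andbT; apply: contra w0 => /eqP/en_eq0 ->.
have lt_e : en (e + w) < en e.
  rewrite -(@ltr_pXn2r _ 2) ?nnegrE ?en_ge0 // enD2.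
  have : en e * dot w ((en e)^-1 *: e) = dot e w.
    by rewrite dotC dotZl mulrA mulfV ?gt_eqF // mul1r.
  have := ler_wpM2l (ltW e0) dn; set b := mesh G + _.
  move=> h1 h2; rewrite h2 in h1.
  have b0 : 0 < b by rewrite /b; lra.
  have h3 : en w ^+ 2 / 2 < en e * (en w ^+ 2 / (2 * b)).
    rewrite mulrA ltr_pdivlMr ?mulr_gt0 //.
    rewrite (_ : en w ^+ 2 / 2 * (2 * b) = en w ^+ 2 * b); last by field.
    by rewrite [X in _ < X]mulrC ltr_pM2l // /b; lra.
  rewrite mulrN in h1.
  move: (dot e w) (en w ^+ 2) (en e * _) (en e ^+ 2) h1 h3 => a1 a2 a3 a4 h1 h3; lra.
have vl : torus_dist v (theta l) < torus_dist (val u) (theta l).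
  rewrite -ee; apply: le_lt_trans lt_e.
  have -> : e + w = v - theta l + iz (- (z + z')).
    by apply/rowP => i; rewrite vE uE !mxE intrN intrD; ring.
  exact: torus_norm_le.
have [x xE] : exists x : T, val x = v.
  apply: (@close_accepted v l) => //; apply: le_trans ur.
  by rewrite ler_pM2l // ltW.
by exists x; rewrite xE.
Qed.

Local Notation adj := (@Defs.adjacent R d q G alpha1).
Local Notation l0 := (Ordinal s_gt0).
(** By [accepted_near] the default value is never taken. *)
Definition lbl (u : T) : 'I_s := odflt l0 [pick l | near (val u) l].

Lemma lblP u : near (val u) (lbl u).
Proof.
rewrite /lbl; case: pickP => //= none.
by have [l ul] := accepted_near u; rewrite none in ul.
Qed.

Lemma adj_lbl u v : adj u v -> lbl u = lbl v.
Proof. by move=> uv; apply: (near_unique uv); exact: lblP. Qed.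

Lemma adj_sym : connect_sym adj.
Proof. by apply: sym_connect_sym => u v; rewrite /Defs.adjacent torus_dist_sym. Qed.

Lemma connect_lbl u v : connect adj u v -> lbl u = lbl v.
Proof.
move=> /connectP[p]; elim: p u => [|x p IH] u /=; first by move=> _ ->.
by move=> /andP[ux xp] /IH <- //; exact: adj_lbl.
Qed.

(* Far from the source the MUSIC function decreases along some grid neighbour;
   near it, the distance to the source does. Minimizing each in turn over the
   cluster ends within [mesh G] of the source. *)
Lemma to_center u : exists2 v, connect adj u v & torus_dist (val v) (theta (lbl u)) <= mesh G.
Proof.
have neqn (P : pred T) x : P x -> enum P != [::].
  by move=> Px; apply/eqP => e0; have := mem_enum P x; rewrite e0 in_nil [RHS]Px.
have [v] := @seq_argmin R _ (enum (connect adj u)) (fun x => q (val x)) (neqn _ u (connect0 _ u)).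
rewrite mem_enum => uv vmin.
have [vfar|vclose] := ltP rho1 (m%:R * torus_dist (val v) (theta (lbl u))).
  have [|x [vx xq]] := descend_far _ vfar; first by rewrite (connect_lbl uv) lblP.
  have ux : connect adj u x by apply: connect_trans uv (connect1 _).
  by have := vmin x; rewrite mem_enum => /(_ ux); rewrite leNgt xq.
pose P := [pred x | connect adj u x & m%:R * torus_dist (val x) (theta (lbl u)) <= rho1].
have Pv : P v by apply/andP.
have [x] := @seq_argmin R _ (enum P) (fun x => torus_dist (val x) (theta (lbl u))) (neqn _ v Pv).
rewrite mem_enum => /andP[ux xc] xmin.
exists x => //; rewrite leNgt; apply/negP => far.
have [y [xy yl]] := descend_close xc far.
have Py : P y.
  apply/andP; split; first by apply: connect_trans ux (connect1 _).
  by apply: le_trans xc; rewrite ler_wpM2l // ltW.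
by have := xmin y; rewrite mem_enum => /(_ Py); rewrite leNgt yl.
Qed.

(** Two points with the same label each descend to within one mesh of the common source; the two end
    points are at distance at most [2 * mesh G], hence adjacent. *)
Lemma connectE u v : connect adj u v = (lbl u == lbl v).
Proof.
apply/idP/eqP => [|uv]; first exact: connect_lbl.
have [x ux xc] := to_center u; have [y vy yc] := to_center v.
apply: connect_trans ux _; rewrite adj_sym; apply: connect_trans vy _.
apply: connect1; rewrite /Defs.adjacent.
rewrite -uv in yc; rewrite torus_dist_sym in xc.
rewrite (_ : 2 * mesh G = mesh G + mesh G); last by rewrite mulr_natl mulr2n.
exact: le_trans (torus_dist_tri _ (theta (lbl u)) _) (lerD yc xc).
Qed.

Lemma lbl_onto l : exists u, lbl u = l.
Proof.
have [g gG hg] := mesh_cover (theta l) mesh_gt0.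
rewrite torus_dist_sym in hg.
have mp : 0 <= m%:R :> R by [].
have [r0 [r1 _]] := rho1_small.
have gr : m%:R * torus_dist g (theta l) <= rho1.
  apply: le_trans (ler_wpM2l mp hg) _; have := mesh_small.
  by have n0 := nu_ge0; rewrite /rho1; lra.
have [u uE] := close_accepted gG gr.
exists u; apply: (@near_unique (val u) (val u)); [|exact: lblP|by rewrite uE; exact: le_trans gr r1].
rewrite /torus_dist subrr torus_normE.
have -> : red (0 : 'rV[R]_d) = 0.
  apply/rowP => i; rewrite redE !mxE sub0r; have := rnd_best (0 : R) 0.
  by rewrite !sub0r !oppr0 normr0 normr_le0 => /eqP.
rewrite en0; have := mesh_gt0; lra.
Qed.

Lemma core_output n out : gradient_music_output q G alpha1 h n out ->
  matches_within theta out (((7 / 8) ^+ n + 16 * nu) / m%:R).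
Proof.
move=> [rep [[rep_uniq rep_tr] ->]].
have [x0 _] := lbl_onto l0.
have [sz [tau ht]] := transversal_labels connectE lbl_onto rep_uniq rep_tr x0.
split; first by rewrite size_map.
exists tau => l; rewrite (nth_map x0) ?sz //.
set u := nth x0 rep (tau l); have ul : near (val u) l by rewrite -(ht l) -/u lblP.
have [e [z [uE ee]]] := lift_point (val u) l.
have he : m%:R * en e <= 1 / 64 by rewrite ee.
rewrite uE; have [e' [-> _ hn]] := iterates d_gt0 m_gt0 sep_gt0 kap_ge0 theta_sep packed sgE kap_small1
  kap_small2 nu_ge0 nu_small Phi_W W_Phi h_range l z n he.
have mp : 0 < m%:R :> R by rewrite ltr0n.
rewrite torus_dist_sym ler_pdivlMr // mulrC; apply: le_trans hn.
rewrite ler_pM2l //.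
have eE : theta l + e' + iz z - theta l + iz (- z) = e'.
  by apply/rowP => i; rewrite !mxE intrN; ring.
by have := torus_norm_le (theta l + e' + iz z - theta l) (- z); rewrite eE.
Qed.

End Clusters.

(** * Deterministic error bound *)

Section SingularValues.
Local Open Scope sesquilinear_scope.
Variables (R : realType) (N : nat).
Implicit Types (A : 'M[R[i]]_N).

Lemma sigma_nth A (i : 'I_N) : sigma A i.+1 = singular_values A 0 i.
Proof. by rewrite /sigma /= (nth_map i) ?size_enum_ord // nth_ord_enum. Qed.

Lemma sigma_default A k : (N <= k)%N -> sigma A k.+1 = 0.
Proof. by move=> Nk; rewrite /sigma nth_default // size_map size_enum_ord. Qed.

Lemma singular_values_svd A : exists U V, is_svd A U (singular_values A) V.
Proof.
have [U [S [V h]]] := svd_exists A.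
by apply: (@xgetPex _ 0 [set S | exists U V, is_svd A U S V]); exists S, U, V.
Qed.

Lemma leading_left_space_svd A s : exists U S V,
  is_svd A U S V /\ leading_left_space A s = (<<(pid_mx s : 'M[R[i]]_N) *m U^T>>)%MS.
Proof.
have [U [S [V h]]] := svd_exists A.
apply: (@xgetPex _ 0 [set W | exists U S V,
    is_svd A U S V /\ W = (<<(pid_mx s : 'M[R[i]]_N) *m U^T>>)%MS]).
by exists (<<(pid_mx s : 'M[R[i]]_N) *m U^T>>)%MS, U, S, V.
Qed.

End SingularValues.

Section Hankel.
Local Open Scope sesquilinear_scope.
Variables (R : realType) (d m : nat).
Local Notation N := ((2 * m).+1%:R ^+ d : R).

Lemma hankelD (f g : 'rV[int]_d -> R[i]) :
  hankel m (fun x => f x + g x) = hankel m f + hankel m g.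
Proof. by apply/matrixP => j k; rewrite !mxE. Qed.

Lemma hankel_sym (f : 'rV[int]_d -> R[i]) : (hankel m f)^T = hankel m f.
Proof. by apply/matrixP => j k; rewrite !mxE addrC. Qed.

Lemma hankel_exp_sum s (a : 'I_s -> R[i]) (theta : 'I_s -> 'rV[R]_d) :
  hankel m (exp_sum a theta) =
  rc N *: ((steering_mx m theta)^T *m diag_mx (\row_l a l) *m steering_mx m theta).
Proof.
apply/matrixP => j k; rewrite !mxE /exp_sum mulr_sumr; apply: eq_bigr => l _.
rewrite mul_mx_diag !mxE.
have -> : inner (theta l) (cube_pt (enum_val j) + cube_pt (enum_val k)) =
  inner (theta l) (cube_pt (enum_val j)) + inner (theta l) (cube_pt (enum_val k)).
  rewrite /inner -big_split; apply: eq_bigr => i _ /=.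
  by rewrite mxE intrD mulrDr.
rewrite cexpD.
have NE : rc N * (rc (Num.sqrt N)^-1 * rc (Num.sqrt N)^-1) = 1.
  rewrite -!rcM -invfM -expr2 sqr_sqrtr ?(ltW (size_gt0 R d m)) //.
  by rewrite mulfV ?gt_eqF ?size_gt0.
move: (cexp _) (cexp _) NE; rewrite -/(rc _) => c1 c2; rewrite -/(rc _).
move: (rc N) (rc _) => x y NE; rewrite -[LHS]mulr1 -[in LHS]NE; ring.
Qed.

End Hankel.

Section Deterministic.
Local Open Scope sesquilinear_scope.
Variables (R : realType) (d m s : nat) (a : 'I_s -> R[i]) (theta : 'I_s -> 'rV[R]_d).
Variables (eta : 'rV[int]_d -> R[i]) (nu : R).
Local Notation N := ((2 * m).+1%:R ^+ d : R).
Local Notation Phi := (steering_mx m theta).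
Local Notation H := (hankel m (fun x => exp_sum a theta x + eta x)).
Hypotheses (s_gt0 : (0 < s)%N) (nu_ge0 : 0 <= nu) (nu_small : nu <= 1 / 8).
Hypothesis a_ge1 : forall l, 1 <= cabs (a l).
Hypothesis Gram : forall c, (1 / 2) * ip c c <= ip (c *m Phi) (c *m Phi).
Hypothesis noise : forall z, nrm (z *m hankel m eta) <= nu * N * nrm z.

Let H0E : rc N *: (Phi^T *m diag_mx (\row_l a l) *m Phi) + hankel m eta = H.
Proof. by rewrite hankelD hankel_exp_sum. Qed.

Let half_gt0 : 0 < 1 / 2 :> R. Proof. lra. Qed.
Let row_ge1 l : 1 <= cabs ((\row_l a l) 0 l). Proof. by rewrite mxE. Qed.

Let Ht : H^T = H. Proof. exact: hankel_sym. Qed.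

Lemma hankel_gap : sigma H s.+1 < sigma H s.
Proof.
have [U [V /[dup] svd [Uu Vu S0 Sd _]]] := singular_values_svd H.
have HE := svd_row_factor svd Ht; rewrite -[in X in _ *m X]H0E in HE.
have Uu' : U^T \is unitarymx by rewrite trmx_unitary; exact: Uu.
have Vu' : V^T \is unitarymx by rewrite trmx_unitary; exact: Vu.
have N0 := size_gt0 R d m; have n8 := nu_small.
have sN := leq_sources half_gt0 Gram.
have s1N : (s.-1 < #|{: cube m d}|)%N by rewrite prednK.
have -> : sigma H s = singular_values H 0 (Ordinal s1N) by rewrite -sigma_nth /= prednK.
have hd_ := head_singular_ge N0 half_gt0 Gram row_ge1 noise Uu' Vu' S0 Sd HE (i := Ordinal s1N).
have {}hd_ := hd_ ltac:(by rewrite /= prednK).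
apply: lt_le_trans hd_.
(* If [s] is the size of the matrix, [sigma] at [s.+1] is 0 by convention and the lower bound
   suffices. *)
have [sN'|Ns] := ltnP s #|{: cube m d}|; last first.
  rewrite sigma_default // -mulrBl mulr_gt0 //; lra.
rewrite (sigma_nth _ (Ordinal sN')).
apply: le_lt_trans (tail_singular_le noise Uu' Vu' S0 Sd HE (i := Ordinal sN') (leqnn s)) _.
rewrite ltrBrDr -mulrDl ltr_pM2r //; lra.
Qed.

(** The bounds hold for every singular value decomposition, hence for the one chosen in
    [leading_left_space]. In the second, [nu <= 1/8] keeps the denominator [1/2 - nu] above
    [1/4]. *)
Lemma leading_space_close :
  (forall x, (x <= Phi)%MS ->
    nrm (x - x *m proj_ortho (leading_left_space H s)) <= 4 * nu * nrm x) /\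
  (forall x, (x <= leading_left_space H s)%MS ->
    nrm (x - x *m proj_ortho Phi) <= 4 * nu * nrm x).
Proof.
have [U [S [V [/[dup] svd [Uu Vu S0 Sd _] ->]]]] := leading_left_space_svd H s.
have HE := svd_row_factor svd Ht; rewrite -[in X in _ *m X]H0E in HE.
have Uu' : U^T \is unitarymx by rewrite trmx_unitary; exact: Uu.
have Vu' : V^T \is unitarymx by rewrite trmx_unitary; exact: Vu.
have N0 := size_gt0 R d m; have n8 := nu_small.
have e0 : 0 <= nu * N by rewrite mulr_ge0 // ltW.
have small : nu * N < 1 / 2 * N by rewrite ltr_pM2r //; lra.
split=> x xP.
  have := signal_to_leading N0 half_gt0 e0 Gram row_ge1 noise Uu' Vu' S0 Sd HE xP.
  have -> : 2 * (nu * N) / (1 / 2 * N) = 4 * nu; last exact.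
  by field; rewrite gt_eqF.
have := leading_to_signal N0 half_gt0 e0 Gram row_ge1 noise Uu' Vu' S0 Sd HE small xP.
move=> /le_trans; apply; apply: ler_wpM2r; first exact: nrm_ge0.
rewrite -mulrBl -mulf_div divff ?gt_eqF // mulr1 ler_pdivrMr; last lra.
have := ler_wpM2l nu_ge0 nu_small; nra.
Qed.

End Deterministic.

Section Threshold.
Local Open Scope sesquilinear_scope.
Variables (R : realType) (d : nat).
Hypothesis d_gt0 : (0 < d)%N.
Let sg : R := 1 / 1024.

(** The noise enters only through a bound on the operator norm of its Hankel matrix, so that both
    noise models reduce to this statement. *)
Lemma deterministic_core : exists sep g1 g2 : R,
  [/\ 0 < sep, 0 < g1 & g1 < g2] /\
  forall (m s : nat) (a : 'I_s -> R[i]) (theta : 'I_s -> 'rV[R]_d),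
    (1 <= m)%N -> (1 <= s)%N -> (forall l, 1 <= cabs (a l)) ->
    ((sep / m%:R)%:E <= separation theta)%E ->
  forall (eta : 'rV[int]_d -> R[i]) (nu : R), 0 <= nu -> nu <= sg / 256 ->
    (forall z, nrm (z *m hankel m eta) <= nu * (2 * m).+1%:R ^+ d * nrm z) ->
  let H := hankel m (fun x => exp_sum a theta x + eta x) in
  sigma H s.+1 < sigma H s /\
  forall (G : {fset 'rV[R]_d}) (alpha1 h : R),
    g1 / m%:R <= mesh G <= g2 / m%:R ->
    (sg / 2) ^+ 2 <= alpha1 <= sg ^+ 2 ->
    1 / 128 / m%:R ^+ 2 <= h <= 1 / 64 / m%:R ^+ 2 ->
  forall n out, gradient_music_output (music (leading_left_space H s)) G alpha1 h n out ->
    matches_within theta out (((7 / 8) ^+ n + 16 * nu) / m%:R).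
Proof.
have s0 : 0 < sg by rewrite /sg; lra.
set B : R := (1 + 10 * d%:R) ^+ d; set B' : R := 2 * ((200 * d%:R ^+ 2 + 86) * 2 ^+ d).
have B0 : 0 < B by rewrite exprn_gt0 //; have := ler0n R d; lra.
have B'0 : 0 < B'.
  by rewrite mulr_gt0 // mulr_gt0 ?exprn_gt0 //; have := sqr_ge0 (d%:R : R); lra.
(* The interference allowed by [localization] and by [near_orthogonal]; packing turns it into a
   separation constant depending on [d] only. *)
pose kap := Num.min (sg ^+ 2 / B) ((1 / 13) ^+ 2 / B').
have kap0 : 0 < kap by rewrite lt_min !divr_gt0 ?exprn_gt0 //; lra.
have k1 : B * kap <= sg ^+ 2 by rewrite mulrC -ler_pdivlMr // ge_min lexx.
have k2 : B' * kap <= (1 / 13) ^+ 2 by rewrite mulrC -ler_pdivlMr // ge_min lexx orbT.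
have [sep0 sep0_gt0 pk] := @packing_torus R d _ kap0.
(* A separation of at least [1/m] is what [near_unique] uses. *)
pose sep := Num.max sep0 1.
have sep1 : 1 <= sep by rewrite le_max lexx orbT.
have sepl : sep0 <= sep by rewrite le_max lexx.
have L1 : 0 < Lam R d.
  by rewrite /Lam; have := sqr_ge0 (d%:R : R); lra.
(* The mesh must be so fine that the second-order error of a grid step stays below the decrease
   given by the gradient. *)
pose g2 : R := sg / (32 * Lam R d).
have g20 : 0 < g2 by rewrite divr_gt0 // mulr_gt0.
exists sep, (g2 / 2), g2; split; first by split; lra.
move=> m s a theta m1 s1 a1 hsep eta nu nu0 nus noise H.
have mp : 0 < m%:R :> R by rewrite ltr0n.
have sepgt : 0 < sep by lra.
have packed : forall w (P : pred 'I_s),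
  (forall k, P k -> sep / (2 * m%:R) <= torus_dist w (theta k)) ->
  \sum_(k | P k) decay m (red (w - theta k)) <= kap.
  move=> w P hP; apply: pk => //.
    apply: le_trans hsep; rewrite lee_fin ler_pM2r ?invr_gt0 //.
  move=> k /hP; apply: le_trans; rewrite ler_pM2r // invr_gt0 mulr_gt0 //.
have k1' : B * kap <= 1 / 10.
  apply: le_trans k1 _; apply: le_trans (_ : sg * 1 <= _); last by rewrite /sg; lra.
  by rewrite expr2 ler_pM2l // /sg; lra.
have gram := Gram_lower d_gt0 m1 sepgt (ltW kap0) hsep packed k1'.
have nu8 : nu <= 1 / 8 by apply: le_trans nus _; rewrite /sg; lra.
have [c1 c2] := leading_space_close nu0 nu8 a1 gram noise.
split; first exact: (hankel_gap s1 nu8 a1 gram noise).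
move=> G alpha1 h /andP[Gl Gr] ha hh n out.
apply: (core_output d_gt0 m1 sepgt (ltW kap0) hsep packed (sg := sg) _ k1 _ nu0 nus c1 c2) => //.
- by rewrite [leLHS](_ : _ = B' * kap) // /B'; ring.
- by apply: lt_le_trans Gl; rewrite divr_gt0 // divr_gt0.
by rewrite mulrC -ler_pdivlMr.
Qed.

End Threshold.

(** * Adversarial noise *)

Section PowerMean.
Variable R : realType.

Lemma young_one (u r : R) : 0 <= u -> 1 <= r -> u <= 1 - r^-1 + u `^ r / r.
Proof.
move=> u0; rewrite le_eqVlt => /orP[/eqP <-|r1].
  by rewrite invr1 subrr add0r mulr1 powRr1.
have r0 : 0 < r by lra.
have q0 : 0 < r / (r - 1) by rewrite divr_gt0 // subr_gt0.
have rq : r^-1 + (r / (r - 1))^-1 = 1 by field; apply/andP; split; rewrite gt_eqF //; lra.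
have := conjugate_powR u0 ler01 r0 q0 rq.
rewrite powR1 mulr1 mul1r; move: (u `^ r / r) (r / (r - 1))^-1 r^-1 rq => x y z rq; lra.
Qed.

(** With [T = (S / N) ^ (1/r)], summing Young's inequality for [t k / T] bounds the sum by [N T];
    then [M <= N] is used. In the application [M = m^d] and [N] is the size of a window. *)
Lemma power_mean (K : finType) (t : K -> R) (r S M : R) : 1 <= r -> (forall k, 0 <= t k) ->
  \sum_k t k `^ r <= S -> 0 < M -> M <= #|K|%:R ->
  \sum_k t k <= #|K|%:R * (S `^ r^-1 / M `^ r^-1).
Proof.
move=> r1 t0 tS M0 MN; have r0 : 0 < r by lra.
set N := #|K|%:R in MN *; have N0 : 0 < N by apply: lt_le_trans MN.
have S0 : 0 <= S by apply: le_trans tS; apply: sumr_ge0 => k _; rewrite powR_ge0.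
have ri0 : 0 <= r^-1 by rewrite invr_ge0 ltW.
pose T := (S / N) `^ r^-1.
have TE : T <= S `^ r^-1 / M `^ r^-1.
  have -> : S `^ r^-1 / M `^ r^-1 = (S / M) `^ r^-1.
    rewrite powRM ?invr_ge0 ?(ltW M0) //; congr (_ * _).
    by rewrite -powR_inv1 ?powR_ge0 // -powRrM mulrN1 powRN -(powR_inv1 (ltW M0)) -powRrM mulN1r powRN.
  apply: ge0_ler_powR => //; rewrite ?nnegrE ?divr_ge0 ?(ltW M0) ?(ltW N0) //.
  by apply: ler_wpM2l => //; rewrite lef_pV2.
apply: le_trans (ler_wpM2l (ltW N0) TE).
have Tr : T `^ r = S / N by rewrite -powRrM mulVf ?gt_eqF // powRr1 // divr_ge0 // ltW.
have T0 : 0 <= T by exact: powR_ge0.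
(* If [T = 0] one cannot divide by it, but all the [t k] vanish. *)
move: T0; rewrite le_eqVlt => /orP[/eqP T0|T0].
  rewrite -T0 mulr0.
  have S00 : S <= 0.
    move: Tr; rewrite -T0 powR0 ?gt_eqF // => /esym/eqP.
    by rewrite mulf_eq0 invr_eq0 (gt_eqF N0) orbF => /eqP ->.
  rewrite big1 // => k _; apply/eqP.
  have : t k `^ r <= 0.
    apply: le_trans S00; apply: le_trans tS; rewrite (bigD1 k) //= lerDl.
    by apply: sumr_ge0 => j _; rewrite powR_ge0.
  by rewrite le_eqVlt ltNge powR_ge0 orbF powR_eq0 => /andP[].
have tk k : t k <= T * (1 - r^-1) + T * (t k `^ r / (S / N) / r).
  rewrite -mulrDr mulrC -ler_pdivrMr // -Tr.
  have -> : t k `^ r / T `^ r = (t k / T) `^ r.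
    rewrite powRM ?invr_ge0 ?(ltW T0) //; congr (_ * _).
    by rewrite -powR_inv1 ?powR_ge0 // -powRrM mulrN1 powRN -(powR_inv1 (ltW T0)) -powRrM mulN1r powRN.
  by apply: young_one => //; rewrite divr_ge0 // ltW.
apply: le_trans (ler_sum _ (fun k _ => tk k)) _.
rewrite big_split /= sumr_const -mulr_sumr -mulr_suml -mulr_suml.
rewrite -[(T * _) *+ _]mulr_natr -[#|_|%:R]/N -mulrA -mulrDr [leRHS]mulrC ler_pM2l //.
have SN : 0 < S / N by rewrite -Tr powR_gt0.
have h : (\sum_k t k `^ r) / (S / N) <= N.
  rewrite ler_pdivrMr // mulrC divfK ?gt_eqF //.
rewrite mulrBl mul1r -lerBrDl opprB addrCA subrr addr0 mulrC.
by apply: ler_wpM2l.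
Qed.

End PowerMean.

Section SchurBound.
Variables (R : realType) (d m : nat).
Local Notation N := ((2 * m).+1%:R ^+ d : R).

Lemma cauchy_schwarz_weighted (K : finType) (h x : K -> R) : (forall k, 0 <= h k) ->
  (\sum_k x k * h k) ^+ 2 <= (\sum_k h k) * \sum_k x k ^+ 2 * h k.
Proof.
move=> h0; set A := \sum_k h k; set B := \sum_k _; set C := \sum_k x k ^+ 2 * _.
have A0 : 0 <= A by apply: sumr_ge0.
move: (A0); rewrite le_eqVlt => /orP[/eqP A00|Ap].
  have hk k : h k = 0.
    apply/eqP; rewrite eq_le h0 andbT A00 /A (bigD1 k) //= lerDl.
    by apply: sumr_ge0.
  by rewrite /B big1 ?expr0n -?A00 ?mul0r //= => k _; rewrite hk mulr0.
have : 0 <= \sum_k h k * (A * x k - B) ^+ 2.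
  by apply: sumr_ge0 => k _; rewrite mulr_ge0 ?sqr_ge0.
have -> : \sum_k h k * (A * x k - B) ^+ 2 = A * (A * C - B ^+ 2).
  have -> : A * (A * C - B ^+ 2) = A ^+ 2 * C - (2 * A * B) * B + B ^+ 2 * A by ring.
  have -> : A ^+ 2 * C = \sum_k A ^+ 2 * (x k ^+ 2 * h k) by rewrite -mulr_sumr.
  have -> : 2 * A * B * B = \sum_k 2 * A * B * (x k * h k) by rewrite -mulr_sumr.
  have -> : B ^+ 2 * A = \sum_k B ^+ 2 * h k by rewrite -mulr_sumr.
  rewrite -sumrB -big_split /=.
  by apply: eq_bigr => k _; ring.
by rewrite pmulr_rge0 // subr_ge0.
Qed.

(** The absolute values of the entries form a symmetric matrix, so the bound on the row sums is also
    one on the column sums, and weighted Cauchy-Schwarz uses each once. *)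
Lemma hankel_schur (eta : 'rV[int]_d -> R[i]) (b : R) :
  (forall x : cube m d, \sum_(y : cube m d) cabs (eta (cube_pt x + cube_pt y)) <= b) ->
  forall z, nrm (z *m hankel m eta) <= b * nrm z.
Proof.
move=> hb z; pose h j k : R := cabs (hankel m eta j k).
have hk j : \sum_k h j k <= b.
  apply: le_trans (hb (enum_val j)).
  rewrite [leRHS](reindex _ (onW_bij _ (@enum_val_bij (cube m d)))) /=.
  by apply: ler_sum => k _; rewrite /h mxE.
have hC j k : h j k = h k j by rewrite /h !mxE addrC.
have h0 j k : 0 <= h j k by exact: cabs_ge0.
have [j|nz] := pickP (fun j : 'I_#|{: cube m d}| => true); last first.
  rewrite /nrm !ip_self !big1 ?sqrtr0 ?mulr0 // => j; by have := nz j.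
move=> _; have b0 : 0 <= b by apply: le_trans (hk j); apply: sumr_ge0.
apply: nrm_le_sq; first by rewrite mulr_ge0 ?nrm_ge0.
rewrite exprMn nrm2 !ip_self.
apply: (@le_trans _ _ (\sum_k b * \sum_j cabs (z 0 j) ^+ 2 * h j k)).
  apply: ler_sum => k _.
  apply: (@le_trans _ _ ((\sum_j cabs (z 0 j) * h j k) ^+ 2)).
    apply: lerXn2r; rewrite ?nnegrE ?cabs_ge0 //.
      by apply: sumr_ge0 => i _; rewrite mulr_ge0 ?cabs_ge0.
    rewrite !mxE; apply: le_trans (cabs_sum _ _ _) _.
    by apply: ler_sum => i _; rewrite cabsM.
  apply: le_trans (cauchy_schwarz_weighted _ (fun j => h0 j k)) _.
  apply: ler_wpM2r; first by apply: sumr_ge0 => i _; rewrite mulr_ge0 ?sqr_ge0.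
  by under eq_bigr => i _ do rewrite hC.
rewrite -mulr_sumr exchange_big /= expr2 -mulrA; apply: ler_wpM2l => //.
rewrite mulr_sumr; apply: ler_sum => i _; rewrite -mulr_sumr mulrC.
by apply: ler_wpM2r; rewrite ?sqr_ge0.
Qed.

Definition cube_shift (x y : cube m d) : cube (2 * m) d := [ffun i => inord (x i + y i)].

Lemma cube_shiftE (x y : cube m d) i : cube_shift x y i = (x i + y i)%N :> nat.
Proof.
by rewrite ffunE inordK //; have := ltn_ord (x i); have := ltn_ord (y i); lia.
Qed.

Lemma cube_pt_shift (x y : cube m d) : cube_pt (cube_shift x y) = cube_pt x + cube_pt y.
Proof. by apply/rowP => i; rewrite !mxE cube_shiftE; lia. Qed.

Lemma cube_shift_inj (x : cube m d) : injective (cube_shift x).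
Proof.
move=> y z yz; apply/ffunP => i; apply: val_inj => /=.
by have := congr1 (fun w : cube (2 * m) d => val (w i)) yz; rewrite /= !cube_shiftE; lia.
Qed.

Lemma card_cube : #|{: cube m d}|%:R = N.
Proof. by rewrite card_ffun !card_ord natrX. Qed.

Lemma sum_window (f : 'rV[int]_d -> R) (x : cube m d) : (forall w, 0 <= f w) ->
  \sum_(y : cube m d) f (cube_pt x + cube_pt y) <= \sum_(w : cube (2 * m) d) f (cube_pt w).
Proof.
move=> f0; under eq_bigr => y _ do rewrite -cube_pt_shift.
apply: (@sum_injection R _ _ xpredT xpredT (cube_shift x) (fun w => f (cube_pt w))) => //.
by move=> y z _ _; exact: cube_shift_inj.
Qed.

(** A row of the Hankel matrix shows a translate of the small cube inside the sampling cube: its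
    [l^p] sum is at most the whole one, and the power mean over its points gives the [l^1] sum. *)
Lemma window_le_lp (p : \bar R) (eta : 'rV[int]_d -> R[i]) (x : cube m d) : (0 < m)%N -> (1 <= p)%E ->
  \sum_(y : cube m d) cabs (eta (cube_pt x + cube_pt y)) <=
  N * (lp_norm (2 * m) p eta / size_pow d m p).
Proof.
move=> m0; case: p => [r| |] //; last 1 first.
  move=> _; rewrite /size_pow /= mulr0 powRr0 divr1 -card_cube mulr_natl -sumr_const.
  apply: ler_sum => y _; rewrite -cube_pt_shift.
  exact: (@le_bigmax _ _ _ 0 (fun w : cube (2 * m) d => cabs (eta (cube_pt w)))).
rewrite lee_fin => r1; have r0 : 0 < r by lra.
rewrite /size_pow inver gt_eqF //= powRrM powR_mulrn // -card_cube.
apply: power_mean => //.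
- by move=> y; exact: cabs_ge0.
- by apply: (@sum_window (fun w => cabs (eta w) `^ r)) => w; exact: powR_ge0.
- by rewrite exprn_gt0 // ltr0n.
by rewrite card_cube; apply: lerXn2r; rewrite ?nnegrE // ler_nat; lia.
Qed.

Lemma adversarial_bound (p : \bar R) (eta : 'rV[int]_d -> R[i]) : (0 < m)%N -> (1 <= p)%E ->
  forall z, nrm (z *m hankel m eta) <= lp_norm (2 * m) p eta / size_pow d m p * N * nrm z.
Proof.
by move=> m0 p1; apply: hankel_schur => x; rewrite mulrC; exact: window_le_lp.
Qed.

End SchurBound.

Section Iterations.
Variable R : realType.

(** From [7/8 <= expR (- 1/8)]; this is the origin of the iteration constant 8. *)
Lemma contraction_power (u : R) (n : nat) : 0 < u -> 8 * ln u^-1 <= n%:R -> (7 / 8) ^+ n <= u.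
Proof.
move=> u0 hn; apply: (@le_trans _ _ (expR (n%:R * (- (1 / 8))))).
  rewrite expRM_natl; apply: lerXn2r; rewrite ?nnegrE ?expR_ge0 //.
  by apply: le_trans (expR_ge1Dx _); lra.
rewrite -[leRHS](@lnK R) ?posrE // ler_expR.
move: hn; rewrite lnV ?posrE //; lra.
Qed.

Lemma max_abs_ge1 s (a : 'I_s -> R[i]) : (exists l, cabs (a l) = 1) -> 1 <= max_abs a.
Proof. by move=> [l <-]; exact: (@le_bigmax _ _ _ 0 (fun l => cabs (a l)) l). Qed.

Lemma size_pow_gt0 d m (p : \bar R) : (0 < m)%N -> 0 < size_pow d m p.
Proof. by move=> m0; rewrite powR_gt0 // ltr0n. Qed.

Lemma lp_norm_ge0 d m (p : \bar R) (f : 'rV[int]_d -> R[i]) : 0 <= lp_norm m p f.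
Proof.
case: p => [r| |] /=; first exact: powR_ge0.
all: by elim/big_rec: _ => // x y _ y0; rewrite le_max y0 orbT.
Qed.

End Iterations.

(** * Hankel matrices and the discrete Fourier transform *)

Section RootsOfUnity.
Local Open Scope sesquilinear_scope.
Variable R : realType.
Local Notation cexp := (@cexp R).

Lemma cexp_neq1 (t : R) : (forall z : int, t != z%:~R) -> cexp t != 1.
Proof.
move=> tz; apply/eqP => t1; have := chord_ge (rnd_half t).
have -> : cexp (t - (rnd t)%:~R) = 1 by rewrite -mulrNz cexpDint.
rewrite subrr cabs0 pmulr_rle0; last lra.
by rewrite normr_le0 subr_eq0 (negPf (tz _)).
Qed.

Lemma sum_roots (n : nat) (j : int) : j != 0 -> (`|j| < n)%N ->
  \sum_(k < n) cexp (k%:R / n%:R * j%:~R) = 0.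
Proof.
move=> j0 jn; have n0 : (0 < n)%N by apply: leq_ltn_trans jn.
have nR : (n%:R : R) != 0 by rewrite pnatr_eq0 -lt0n.
have e1 : cexp (j%:~R / n%:R) != 1.
  apply: cexp_neq1 => z; apply/eqP => /(congr1 (fun x => x * n%:R)).
  rewrite divfK // -[n%:R]/((n%:Z)%:~R) -intrM => /intr_inj jE.
  have [z0|z0] := eqVneq z 0; first by rewrite jE z0 mul0r eqxx in j0.
  have z1 : (0 < `|z|)%N by rewrite absz_gt0.
  by move: jn; rewrite jE abszM absz_nat; have := leq_pmull n z1; lia.
have -> : \sum_(k < n) cexp (k%:R / n%:R * j%:~R) = \sum_(k < n) cexp (j%:~R / n%:R) ^+ k.
  by apply: eq_bigr => k _; rewrite -cexpM_nat; congr cexp; ring.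
have := subrX1 (cexp (j%:~R / n%:R)) n.
rewrite -cexpM_nat divfK // cexp_int subrr => /esym/eqP.
by rewrite mulf_eq0 subr_eq0 (negPf e1) => /eqP.
Qed.

End RootsOfUnity.

Section DiscreteFourier.
Local Open Scope sesquilinear_scope.
Variables (R : realType) (d m : nat).
Local Notation cexp := (@cexp R).
Local Notation n := (2 * (2 * m)).+1.
Local Notation M := (n%:R ^+ d : R).

Definition freq (k : cube (2 * m) d) : 'rV[R]_d := \row_i ((k i : nat)%:R / n%:R).

Definition dft (eta : 'rV[int]_d -> R[i]) (k : cube (2 * m) d) : R[i] :=
  \sum_(w : cube (2 * m) d) eta (cube_pt w) * cexp (- inner (freq k) (cube_pt w)).

Lemma sum_freq (y : 'rV[int]_d) : (forall i, (`|y 0%R i| < n)%N) ->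
  \sum_k cexp (inner (freq k) y) = if y == 0 then rc M else 0.
Proof.
move=> yn.
have -> : \sum_k cexp (inner (freq k) y) =
    \prod_i \sum_(k < n) cexp (k%:R / n%:R * (y 0 i)%:~R).
  rewrite bigA_distr_bigA; apply: eq_bigr => k _ /=.
  by rewrite /inner cexp_sum; apply: eq_bigr => i _; rewrite mxE.
have [->|y0] := eqVneq y 0.
  under eq_bigr => i _ do under eq_bigr => k _ do rewrite mxE mulr0 cexp0.
  by under eq_bigr => i _ do rewrite sumr_const card_ord; rewrite prodr_const card_ord -rc_nat rcX.
have [i yi] : exists i, y 0 i != 0.
  apply/existsP; apply: contraR y0 => /existsPn h; apply/eqP/rowP => i.
  by have := h i; rewrite negbK mxE => /eqP.
by rewrite (bigD1 i) //= sum_roots ?mul0r.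
Qed.

Lemma innerBr (w : 'rV[R]_d) (x y : 'rV[int]_d) : inner w (x - y) = inner w x - inner w y.
Proof. by rewrite /inner -sumrB; apply: eq_bigr => i _; rewrite !mxE intrB mulrBr. Qed.

Lemma innerDr (w : 'rV[R]_d) (x y : 'rV[int]_d) : inner w (x + y) = inner w x + inner w y.
Proof. by rewrite /inner -big_split; apply: eq_bigr => i _; rewrite !mxE intrD mulrDr. Qed.

Lemma cube_pt_inj p : injective (@cube_pt p d).
Proof.
move=> x y xy; apply/ffunP => i; apply: val_inj => /=.
by have := congr1 (fun w : 'rV[int]_d => w 0 i) xy; rewrite !mxE; lia.
Qed.

Lemma cube_pt_diff p (x y : cube p d) i : (`|(cube_pt x - cube_pt y)%R 0%R i| < (2 * p).+1)%N.
Proof. by rewrite !mxE; have := ltn_ord (x i); have := ltn_ord (y i); lia. Qed.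

Lemma sum_freq_diff (x y : cube (2 * m) d) :
  \sum_k cexp (inner (freq k) (cube_pt x - cube_pt y)) = if x == y then rc M else 0.
Proof.
rewrite sum_freq => [|i]; last exact: cube_pt_diff.
by rewrite subr_eq0 (inj_eq (@cube_pt_inj _)).
Qed.

(** Characters of the group of order [(4m+1)^d], restricted to the small cube. The matrix is
    rectangular, with orthonormal rows. *)
Definition fourier_mx : 'M[R[i]]_(#|{: cube m d}|, #|{: cube (2 * m) d}|) :=
  \matrix_(j, k) (rc (Num.sqrt M)^-1 * cexp (inner (freq (enum_val k)) (cube_pt (enum_val j)))).

Lemma norm_constM : rc (Num.sqrt M)^-1 * rc (Num.sqrt M)^-1 * rc M = 1.
Proof.
have M0 : 0 < M by rewrite exprn_gt0 // ltr0n.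
by rewrite -!rcM -invfM -expr2 sqr_sqrtr ?(ltW M0) // mulVf ?gt_eqF.
Qed.

Lemma fourier_unitary : fourier_mx \is unitarymx.
Proof.
apply/unitarymxP/matrixP => j j'; rewrite !mxE.
under eq_bigr => k _ do rewrite !mxE rmorphM /= -cexpN conjCE /= oppr0 -/(rc _) mulrACA -cexpD -innerBr.
rewrite -mulr_sumr (sum_cube
  (fun k => cexp (inner (freq k) (cube_pt (enum_val j) - cube_pt (enum_val j'))))).
rewrite sum_freq => [|i]; last first.
  by apply: leq_trans (cube_pt_diff _ _ _) _; lia.
rewrite subr_eq0 (inj_eq (@cube_pt_inj _)) (inj_eq enum_val_inj).
by case: eqP => _; rewrite ?mulr0 // norm_constM.
Qed.

(* The window [x + y] has width [4 m + 1], so the transform of that period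
   represents the symbol without wrap-around. *)
Lemma hankel_fourier (eta : 'rV[int]_d -> R[i]) :
  hankel m eta = fourier_mx *m diag_mx (\row_k dft eta (enum_val k)) *m fourier_mx^T.
Proof.
apply/matrixP => j j'; rewrite !mxE.
have cM (c u v z : R[i]) : c * u * z * (c * v) = c * c * (z * (u * v)) by ring.
under eq_bigr => k _ do rewrite mul_mx_diag !mxE cM -cexpD -innerDr.
rewrite -mulr_sumr (sum_cube
  (fun k => dft eta k * cexp (inner (freq k) (cube_pt (enum_val j) + cube_pt (enum_val j'))))).
rewrite -cube_pt_shift; set u := cube_shift _ _.
have -> : \sum_(k : cube (2 * m) d) dft eta k * cexp (inner (freq k) (cube_pt u)) =
    \sum_(w : cube (2 * m) d) eta (cube_pt w) * \sum_(k : cube (2 * m) d) cexp (inner (freq k) (cube_pt u - cube_pt w)).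
  under [RHS]eq_bigr => w _ do rewrite mulr_sumr.
  rewrite exchange_big /=; apply: eq_bigr => k _; rewrite mulr_suml.
  by apply: eq_bigr => w _; rewrite -mulrA -cexpD innerBr addrC.
rewrite (bigD1 u) //= [X in _ * (_ + X)]big1 ?addr0 => [|w wu]; last first.
  by rewrite sum_freq_diff eq_sym (negPf wu) mulr0.
by rewrite sum_freq_diff eqxx mulrCA norm_constM mulr1.
Qed.

(** The factorization has norm-preserving, diagonal and contracting factors, so the largest Fourier
    coefficient bounds the operator norm. *)
Lemma hankel_dft_bound (eta : 'rV[int]_d -> R[i]) (b : R) :
  (forall k, cabs (dft eta k) <= b) -> forall z, nrm (z *m hankel m eta) <= b * nrm z.
Proof.
move=> hb z; have b0 : 0 <= b by apply: le_trans (hb [ffun=> ord0]); exact: cabs_ge0.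
(* The transpose goes from the larger space to the smaller one. After conjugation it is the adjoint
   of an isometry, hence a contraction by duality. *)
have FT u : nrm (u *m fourier_mx^T) <= nrm u.
  rewrite -nrm_conj map_mxM -[leRHS]nrm_conj; move: (map_mx _ u) => v.
  apply: nrm_test => [|x]; first exact: nrm_ge0.
  rewrite /ip hd_mulmx -/(ip _ _) trmxCK; apply: le_trans (ip_le _ _) _.
  by rewrite nrm_unitary // fourier_unitary.
rewrite hankel_fourier !mulmxA; apply: le_trans (FT _) _.
apply: le_trans (nrm_diag_le b0 _) _ => [j _|]; first by rewrite mxE.
by rewrite nrm_unitary // fourier_unitary.
Qed.

End DiscreteFourier.

Import HBNNSimple.

(** * Independence and Gaussian tails *)

Section IntegralComp.
Context (R : realType) (dO dT : measure_display) (Om : measurableType dO) (T : measurableType dT).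
Variables (P : {measure set Om -> \bar R}) (X : Om -> T).
Hypothesis mX : measurable_fun [set: Om] X.

Lemma measurable_preim B : measurable B -> measurable (X @^-1` B).
Proof. by move=> mB; rewrite -[_ @^-1` _]setTI; exact: mX. Qed.

Lemma integral_indic_comp B : measurable B -> (\int[P]_t (\1_B (X t))%:E = P (X @^-1` B))%E.
Proof.
move=> mB; rewrite -[in RHS](setIT (X @^-1` B)) -integral_indic //.
exact: measurable_preim.
Qed.

Lemma integral_simple_comp (s : {nnsfun T >-> R}) (g : Om -> R) :
  measurable_fun [set: Om] g -> (forall t, 0 <= g t) ->
  let v := fset_set (s @` setT) in
  (\int[P]_t (s (X t) * g t)%:E =
   \sum_(i < #|` v|) (v`_i)%:E * \int[P]_t (\1_(s @^-1` [set v`_i]) (X t) * g t)%:E)%E.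
Proof.
move=> mg g0 v.
have v0 (i : 'I_#|` v|) : 0 <= v`_i.
  have : v`_i \in v by rewrite mem_nth.
  by rewrite in_fset_set // inE => -[x _ <-].
have mind (i : 'I_#|` v|) : measurable_fun [set: Om] (fun t => \1_(s @^-1` [set v`_i]) (X t) : R).
  by apply: measurableT_comp => //; apply: measurable_indic; exact: measurable_sfunP.
have ind0 (i : 'I_#|` v|) t : 0 <= \1_(s @^-1` [set v`_i]) (X t) * g t.
  by rewrite mulr_ge0 // indicE.
under eq_integral => t _.
  rewrite fimfunEord mulr_suml -sumEFin.
  over.
rewrite ge0_integral_sum //; last 2 first.
- move=> i; apply/measurable_EFinP; apply: measurable_funM => //.
  exact: measurable_funM.
- by move=> i t _; rewrite lee_fin -mulrA mulr_ge0.
apply: eq_bigr => i _.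
under eq_integral => t _ do rewrite -mulrA EFinM.
rewrite ge0_integralZl_EFin //.
- by move=> t _; rewrite lee_fin.
- by apply/measurable_EFinP; apply: measurable_funM.
Qed.

End IntegralComp.

Section Transfer.
Context (R : realType) (dO dQ dT : measure_display).
Context (Om : measurableType dO) (Om' : measurableType dQ) (T : measurableType dT).
Variables (P : {measure set Om -> \bar R}) (Q : {measure set Om' -> \bar R}).
Variables (X : Om -> T) (Y : Om' -> T) (G : Om -> R) (c : R).
Hypotheses (mX : measurable_fun [set: Om] X) (mY : measurable_fun [set: Om'] Y).
Hypothesis mG : measurable_fun [set: Om] G.
Hypotheses (G0 : forall t, 0 <= G t) (c0 : 0 <= c).
(** The weight [G] allows two uses: with [X] the identity and [G] a normal density, it expresses
    expectations through the law; with [Y = X] and [G] the product of the other factors, it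
    expresses independence. *)
Hypothesis indic : forall B, measurable B ->
  (\int[P]_t (\1_B (X t) * G t)%:E = c%:E * Q (Y @^-1` B))%E.

Lemma transfer_simple (s : {nnsfun T >-> R}) :
  (\int[P]_t (s (X t) * G t)%:E = c%:E * \int[Q]_t (s (Y t))%:E)%E.
Proof.
rewrite integral_simple_comp //.
under [in RHS]eq_integral => t _ do rewrite -[s (Y t)]mulr1.
rewrite (@integral_simple_comp _ _ _ _ _ Q Y mY s (fun=> 1)) //.
have v0 (i : 'I_#|` fset_set (s @` setT)|) : 0 <= (fset_set (s @` setT))`_i.
  have : (fset_set (s @` setT))`_i \in fset_set (s @` setT) by rewrite mem_nth.
  by rewrite in_fset_set // inE => -[x _ <-].
rewrite ge0_sume_distrr => [|i _]; last first.
  by rewrite mule_ge0 ?lee_fin // integral_ge0 // => t _; rewrite lee_fin mulr1 indicE.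
apply: eq_bigr => i _; move: (_`_i) => y.
have mB : measurable (s @^-1` [set y]) by exact: measurable_sfunP.
move: (s @^-1` _) mB => B mB.
transitivity (y%:E * (c%:E * Q (Y @^-1` B)))%E; first by congr (_ * _)%E; exact: indic.
rewrite muleCA; congr (_ * (_ * _))%E; rewrite -(integral_indic_comp Q mY mB).
by apply: eq_integral => t _; rewrite mulr1.
Qed.

(* Simple functions and monotone convergence extend the identity from indicators. *)
Lemma transfer (f : T -> R) : measurable_fun [set: T] f -> (forall x, 0 <= f x) ->
  (\int[P]_t (f (X t) * G t)%:E = c%:E * \int[Q]_t (f (Y t))%:E)%E.
Proof.
move=> mf f0; have mF : measurable_fun [set: T] (EFin \o f : T -> \bar R) by apply/measurable_EFinP.
pose s_ := nnsfun_approx measurableT mF.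
have s_nd x : {homo (fun n => s_ n x) : m n / (m <= n)%N >-> m <= n}.
  by move=> m n mn; exact/lefP/nd_nnsfun_approx.
have s_cvg x : (fun n => (s_ n x)%:E) @ \oo --> (f x)%:E.
  by apply: (@cvg_nnsfun_approx _ _ _ _ measurableT _ mF) => // y _; rewrite lee_fin.
have ms n : measurable_fun [set: Om] (fun t => s_ n (X t)) by apply: measurableT_comp.
have ms' n : measurable_fun [set: Om'] (fun t => s_ n (Y t)) by apply: measurableT_comp.
have cvg1 : (\int[P]_t (s_ n (X t) * G t)%:E @[n --> \oo] --> \int[P]_t (f (X t) * G t)%:E)%E.
  have -> : (\int[P]_t (f (X t) * G t)%:E = \int[P]_t limn (fun n => (s_ n (X t) * G t)%:E))%E.
    apply: eq_integral => t _; apply/esym/cvg_lim => //.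
    under eq_fun => n do rewrite EFinM.
    by rewrite EFinM; apply: cvgeZr.
  apply: cvg_monotone_convergence => //.
  - by move=> n; apply/measurable_EFinP; exact: measurable_funM.
  - by move=> n t _; rewrite lee_fin mulr_ge0.
  - by move=> t _ m n mn; rewrite lee_fin ler_wpM2r // s_nd.
have cvg2 : (\int[Q]_t (s_ n (Y t))%:E @[n --> \oo] --> \int[Q]_t (f (Y t))%:E)%E.
  have -> : (\int[Q]_t (f (Y t))%:E = \int[Q]_t limn (fun n => (s_ n (Y t))%:E))%E.
    by apply: eq_integral => t _; apply/esym/cvg_lim.
  apply: cvg_monotone_convergence => //.
  - by move=> n; apply/measurable_EFinP.
  - by move=> n t _; rewrite lee_fin.
  - by move=> t _ m n mn; rewrite lee_fin s_nd.
have cvg3 : (\int[P]_t (s_ n (X t) * G t)%:E @[n --> \oo] --> c%:E * \int[Q]_t (f (Y t))%:E)%E.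
  by under eq_fun => n do rewrite transfer_simple; exact: cvgeZl.
exact: cvg_unique cvg1 cvg3.
Qed.

End Transfer.

Section ProductExpectation.
Context (R : realType) (dO dT : measure_display) (Om : measurableType dO) (T : measurableType dT).
Variables (P : probability Om R) (I : finType) (X : I -> Om -> T).
Hypothesis mX : forall i, measurable_fun [set: Om] (X i).
Hypothesis indep : mutually_independent P X.

Lemma measurable_prod_comp (h : I -> T -> R) (Q : pred I) :
  (forall i, measurable_fun [set: T] (h i)) ->
  measurable_fun [set: Om] (fun t => \prod_(i | Q i) h i (X i t)).
Proof.
move=> mh; rewrite (_ : (fun t => _) = (fun t => \prod_(i <- [seq i <- enum I | Q i]) h i (X i t))).
  by apply: measurable_prod => i _; apply: measurableT_comp.
by apply/funext => t; rewrite big_filter big_enum_cond.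
Qed.

Lemma expectation_prod_indic (h : I -> T -> R) (B : I -> set T) :
  (forall i, measurable (B i)) -> (forall i, h i = \1_(B i)) ->
  (\int[P]_t (\prod_i h i (X i t))%:E = \prod_i P (X i @^-1` B i))%E.
Proof.
move=> mB hB; have := indep [set: I]%SET mB.
under [in X in _ = X -> _]eq_bigl => i do rewrite inE.
move=> <-.
have -> : [set i | i \in [set: I]%SET] = [set: I] by apply/seteqP; split=> // i _ /=; rewrite inE.
have mbig : measurable (\bigcap_(i in [set: I]) (X i @^-1` B i)).
  apply: fin_bigcap_measurable => // i _; exact: measurable_preim.
have -> : P (\bigcap_(i in [set: I]) (X i @^-1` B i)) =
    (\int[P]_t (\1_(\bigcap_(i in [set: I]) (X i @^-1` B i)) t)%:E)%E.
  by rewrite integral_indic // setIT.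
apply: eq_integral => t _; congr EFin; rewrite indicE.
have [tB|tB] := boolP (t \in _).
  rewrite inE in tB; rewrite big1 // => i _; rewrite hB indicE mem_set //; exact: tB.
have [i iB] : exists i, ~ B i (X i t).
  apply/existsNP => h1; move/negP: tB; apply; rewrite inE => i _; exact: h1.
by rewrite (bigD1 i) //= hB indicE memNset // mul0r.
Qed.

(* The factors that are not indicators are eliminated one at a time: once the claim
   is known for an indicator in position [j], [transfer] extends it to [h j]. *)
Lemma expectation_prod (h : I -> T -> R) (e : I -> R) :
  (forall i, measurable_fun [set: T] (h i)) -> (forall i x, 0 <= h i x) ->
  (forall i, \int[P]_t (h i (X i t))%:E = (e i)%:E)%E ->
  (\int[P]_t (\prod_i h i (X i t))%:E = (\prod_i e i)%:E)%E.
Proof.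
suff main : forall r : seq I, forall (h : I -> T -> R) (e : I -> R),
    (forall i, i \notin r -> exists B, measurable B /\ h i = \1_B) ->
    (forall i, measurable_fun [set: T] (h i)) -> (forall i x, 0 <= h i x) ->
    (forall i, \int[P]_t (h i (X i t))%:E = (e i)%:E)%E ->
    (\int[P]_t (\prod_i h i (X i t))%:E = (\prod_i e i)%:E)%E.
  by apply: (main (enum I)) => i; rewrite mem_enum.
move=> {h e}; elim=> [|j r IH] h e hr mh h0 he.
  have /boolp.choice[B hB] : forall i, exists B, measurable B /\ h i = \1_B.
    by move=> i; exact: hr.
  rewrite (expectation_prod_indic (fun i => (hB i).1) (fun i => (hB i).2)).
  rewrite -prodEFin; apply: eq_bigr => i _; rewrite -he.
  by rewrite (hB i).2 integral_indic_comp //; exact: (hB i).1.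
pose G t := \prod_(i | i != j) h i (X i t).
have e0 i : 0 <= e i.
  by rewrite -lee_fin -he; apply: integral_ge0 => t _; rewrite lee_fin.
have -> : (\int[P]_t (\prod_i h i (X i t))%:E = \int[P]_t (h j (X j t) * G t)%:E)%E.
  by apply: eq_integral => t _; rewrite (bigD1 j).
rewrite (@transfer _ _ _ _ _ _ _ P P (X j) (X j) G (\prod_(i | i != j) e i)) //.
- by rewrite he -EFinM mulrC [in RHS](bigD1 j) //.
- exact: measurable_prod_comp.
- by move=> t; apply: prodr_ge0.
move=> B mB.
pose h' i := if i == j then \1_B else h i : T -> R.
pose e' i := if i == j then fine (P (X j @^-1` B)) else e i.
have -> : (\int[P]_t (\1_B (X j t) * G t)%:E = \int[P]_t (\prod_i h' i (X i t))%:E)%E.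
  apply: eq_integral => t _; rewrite [in RHS](bigD1 j) //= /h' eqxx /G.
  by congr (_ * _)%:E; apply: eq_bigr => i /negPf ->.
rewrite (IH h' e').
- rewrite [in LHS](bigD1 j) //= {1}/e' eqxx mulrC EFinM fineK ?fin_num_measure //; last first.
    exact: measurable_preim.
  by congr (_%:E * _)%E; apply: eq_bigr => i /negPf; rewrite /e' => ->.
- move=> i ir; rewrite /h'; case: eqP => [_|/eqP ij]; first by exists B.
  by apply: hr; rewrite inE negb_or ij.
- by move=> i; rewrite /h'; case: eqP => // _; exact: measurable_indic.
- by move=> i x; rewrite /h'; case: eqP => // _; rewrite indicE.
move=> i; rewrite /h' /e'; case: eqP => [->|_]; last exact: he.
rewrite fineK ?fin_num_measure //; last exact: measurable_preim.
exact: integral_indic_comp.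
Qed.

End ProductExpectation.

Section Gaussian.
Context (R : realType) (dO : measure_display) (Om : measurableType dO) (P : probability Om R).

(* Completing the square. *)
Lemma normal_pdf_tilt (a s x : R) : s ^+ 2 = 1 / 2 ->
  expR (a * x) * normal_pdf 0 s x = expR (a ^+ 2 / 4) * normal_pdf (a / 2) s x.
Proof.
move=> s2; have s0 : s != 0 by apply/eqP => s0; move: s2; rewrite s0 expr0n /=; lra.
rewrite !normal_pdfE // mulrCA [RHS]mulrCA; congr (_ * _).
rewrite /normal_fun -!expRD; congr expR; rewrite s2 -mulr_natr; by field.
Qed.

Lemma normal_mgf (X : Om -> R) (a : R) : has_normal_law P X 0 2^-1 ->
  (\int[P]_t (expR (a * X t))%:E = (expR (a ^+ 2 / 4))%:E)%E.
Proof.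
move=> [mX lawX]; set s := Num.sqrt (2^-1 : R) in lawX.
have s2 : s ^+ 2 = 1 / 2 by rewrite sqr_sqrtr ?invr_ge0 // mul1r.
have mf : measurable_fun [set: R] (fun x : R => expR (a * x)).
  by apply: measurableT_comp => //; exact: measurable_funM.
have h := @transfer _ _ _ _ _ _ _ (@lebesgue_measure R) P id X (normal_pdf 0 s) 1 _ mX
  (measurable_normal_pdf 0 s) (normal_pdf_ge0 0 s) _ (fun x => expR (a * x)) mf (fun x => expR_ge0 _).
rewrite -[LHS]mul1e -h //.
  under eq_integral => x _ do rewrite /= normal_pdf_tilt // EFinM.
  rewrite ge0_integralZl_EFin ?expR_ge0 //.
  - by rewrite integral_normal_pdf mule1.
  - by move=> x _; rewrite lee_fin normal_pdf_ge0.
  - by apply/measurable_EFinP; exact: measurable_normal_pdf.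
move=> B mB; rewrite mul1e; apply: etrans (esym (lawX B mB)); rewrite /normal_prob [RHS]integral_mkcond.
apply: eq_integral => x _; rewrite /= patchE indicE; case: ifP => _; rewrite ?mul1r ?mul0r //.
Qed.

Lemma complex_normal_mgf (Z : Om -> R[i]) (a b : R) : standard_complex_normal P Z ->
  (\int[P]_t (expR (a * Re (Z t) + b * Im (Z t)))%:E = (expR ((a ^+ 2 + b ^+ 2) / 4))%:E)%E.
Proof.
move=> [lawRe lawIm ind].
pose X (c : bool) t := if c then Im (Z t) else Re (Z t).
pose w (c : bool) := if c then b else a.
have mX c : measurable_fun [set: Om] (X c) by case: c; [exact: lawIm.1|exact: lawRe.1].
have := expectation_prod mX ind (h := fun c x => expR (w c * x)) (e := fun c => expR (w c ^+ 2 / 4)).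
have -> : (a ^+ 2 + b ^+ 2) / 4 = b ^+ 2 / 4 + a ^+ 2 / 4 by rewrite mulrDl addrC.
rewrite big_bool /= -expRD => <- //.
- apply: eq_integral => t _; rewrite big_bool /= -expRD addrC //.
- by move=> c; apply: measurableT_comp => //; exact: measurable_funM.
by case; [exact: normal_mgf lawIm|exact: normal_mgf lawRe].
Qed.

Variables (I : finType) (g : I -> Om -> R[i]).
Hypothesis iid : iid_standard_complex_normal P g.

Definition linear_form (a b : I -> R) t := \sum_i (a i * Re (g i t) + b i * Im (g i t)).

Lemma measurable_linear_form a b : measurable_fun [set: Om] (linear_form a b).
Proof.
apply: measurable_sum => i; have [[mr _] [mi _] _] := iid.1 i.
by apply: measurable_funD; apply: measurable_funM.
Qed.

Lemma linear_form_mgf (a b : I -> R) :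
  (\int[P]_t (expR (linear_form a b t))%:E = (expR ((\sum_i (a i ^+ 2 + b i ^+ 2)) / 4))%:E)%E.
Proof.
have mg i : measurable_fun [set: Om] (fun t => (Re (g i t), Im (g i t))).
  by have [[mr _] [mi _] _] := iid.1 i; exact/measurable_fun_pairP.
have := expectation_prod mg iid.2 (h := fun i p => expR (a i * p.1 + b i * p.2))
  (e := fun i => expR ((a i ^+ 2 + b i ^+ 2) / 4)).
rewrite -expR_sum -mulr_suml => <- //.
- by apply: eq_integral => t _; rewrite -expR_sum.
- move=> i; apply: measurableT_comp => //; apply: measurable_funD; apply: measurable_funM => //.
by move=> i; exact: complex_normal_mgf (iid.1 i).
Qed.

(** Chernoff's bound: the exponent [r^2 V / 4 - r tau] is minimal at [r = 2 tau / V], with value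
    [- tau^2 / V]. *)
Lemma linear_form_tail (a b : I -> R) (V tau : R) : 0 < V -> 0 < tau ->
  \sum_i (a i ^+ 2 + b i ^+ 2) <= V ->
  (P [set t | (tau <= linear_form a b t)%R] <= (expR (- (tau ^+ 2 / V)))%:E)%E.
Proof.
move=> V0 tau0 SV; pose r := 2 * tau / V; have r0 : 0 < r by rewrite divr_gt0 // mulr_gt0.
set Y := linear_form a b; set A := [set t | _].
have mY : measurable_fun [set: Om] Y by exact: measurable_linear_form.
have mA : measurable A.
  have -> : A = Y @^-1` `[tau, +oo[%classic.
    by apply/seteqP; split=> t /=; rewrite in_itv /= andbT.
  exact: measurable_preim.
have mgf : (\int[P]_t (expR (r * Y t))%:E <= (expR (r ^+ 2 * V / 4))%:E)%E.
  have := linear_form_mgf (fun i => r * a i) (fun i => r * b i).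
  have -> : \sum_i ((r * a i) ^+ 2 + (r * b i) ^+ 2) = r ^+ 2 * \sum_i (a i ^+ 2 + b i ^+ 2).
    by rewrite mulr_sumr; apply: eq_bigr => i _; rewrite mulrDr !exprMn.
  have E : forall t, linear_form (fun i => r * a i) (fun i => r * b i) t = r * Y t.
    by move=> t; rewrite /Y /linear_form mulr_sumr; apply: eq_bigr => i _; rewrite mulrDr !mulrA.
  under eq_integral => t _ do rewrite E.
  by move=> ->; rewrite lee_fin ler_expR ler_pM2r ?invr_gt0 // ler_wpM2l // sqr_ge0.
have low : ((expR (r * tau))%:E * P A <= \int[P]_t (expR (r * Y t))%:E)%E.
  have -> : (P A = \int[P]_t (\1_A t)%:E)%E by rewrite integral_indic // setIT.
  have mI : measurable_fun [set: Om] (fun t => (\1_A t)%:E : \bar R).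
    by apply/measurable_EFinP; exact: measurable_indic.
  have I0 t : [set: Om] t -> (0 <= (\1_A t)%:E :> \bar R)%E by rewrite lee_fin indicE.
  rewrite -(ge0_integralZl_EFin P measurableT I0 mI (expR_ge0 _)).
  apply: ge0_le_integral => //.
  - by apply/measurable_EFinP; apply: measurable_funM => //; exact: measurable_indic.
  - by apply/measurable_EFinP; apply: measurableT_comp => //; exact: measurable_funM.
  move=> t _; rewrite -EFinM lee_fin indicE; have [tA|_] := boolP (t \in A).
    by rewrite mulr1 ler_expR ler_pM2l //; move: tA; rewrite inE.
  by rewrite mulr0 expR_ge0.
have := le_trans low mgf.
rewrite -[P A]fineK ?fin_num_measure // -EFinM !lee_fin => h.
rewrite -(ler_pM2l (expR_gt0 (r * tau))); apply: le_trans h _.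
rewrite -expRD ler_expR /r le_eqVlt; apply/orP; left; apply/eqP; field.
by rewrite gt_eqF.
Qed.

Lemma union_bound (J : finType) (A : J -> set Om) (p : R) :
  (forall j, measurable (A j)) -> (forall j, (P (A j) <= p%:E)%E) ->
  exists B : set Om, [/\ measurable B, ((1 - #|J|%:R * p)%:E <= P B)%E &
    forall t, B t -> forall j, ~ A j t].
Proof.
move=> mA pA; pose U (r : seq J) := [set t | exists2 j, j \in r & A j t].
have UE j r : U (j :: r) = A j `|` U r.
  apply/seteqP; split=> t /=.
    by move=> [k]; rewrite inE => /orP[/eqP ->|kr] kt; [left|right; exists k].
  by move=> [jt|[k kr kt]]; [exists j; rewrite ?mem_head|exists k; rewrite // inE kr orbT].
have hU r : measurable (U r) /\ (P (U r) <= ((size r)%:R * p)%:E)%E.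
  elim: r => [|j r [mr pr]].
    have -> : U [::] = set0 by apply/seteqP; split=> t // -[].
    by rewrite measure0 mul0r.
  rewrite UE; split; first exact: measurableU.
  apply: le_trans (measureU2 _ _ _) _ => //.
  rewrite (_ : (size (j :: r))%:R * p = p + (size r)%:R * p).
    by have := leeD (pA j) pr.
  by rewrite /= -natr1 mulrDl mul1r addrC.
have [mU pU] := hU (enum J); exists (~` U (enum J)); split.
- exact: measurableC.
- rewrite probability_setC // cardE EFinB leeB //.
by move=> t tU j jt; apply: tU; exists j; rewrite ?mem_enum.
Qed.

End Gaussian.

(** * Fourier coefficients of Gaussian noise *)

Section GaussianNoise.
Context (R : realType) (dO : measure_display) (Om : measurableType dO) (P : probability Om R).

Lemma with_probability_mono (r : R) (E E' : Om -> Prop) : (forall t, E t -> E' t) ->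
  with_probability_at_least P r E -> with_probability_at_least P r E'.
Proof. by move=> EE' [A [mA PA AE]]; exists A; split=> // t /AE /EE'. Qed.

Lemma with_probability_0 (E : Om -> Prop) : with_probability_at_least P 0 E.
Proof. by exists set0; split=> //; rewrite measure0. Qed.

Lemma lp_norm2 d m (f : 'rV[int]_d -> R[i]) :
  lp_norm m 2%:E f = Num.sqrt (\sum_(x : cube m d) cabs (f (cube_pt x)) ^+ 2).
Proof.
rewrite /lp_norm -powR12_sqrt; last by apply: sumr_ge0 => x _; rewrite sqr_ge0.
by congr (_ `^ _); apply: eq_bigr => x _; rewrite powR_mulrn ?cabs_ge0.
Qed.

(** The union bound runs over 4 phases and [(4m+1)^d] frequencies and must leave [m^-d]. As
    [4 <= m^d] and [4m+1 <= m^4], a tail of [m^-(6d)] for each event suffices. *)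
Lemma count_tests (d m : nat) : (2 <= d)%N -> (2 <= m)%N ->
  (4 * (2 * (2 * m)).+1 ^ d * m ^ d <= m ^ (6 * d))%N.
Proof.
move=> d2 m2.
have e1 : (4 <= m ^ d)%N by apply: (@leq_trans (2 ^ d)); [exact: (@leq_pexp2l 2 2 d)|rewrite leq_exp2r //; lia].
have e2 : ((2 * (2 * m)).+1 ^ d <= (m ^ 4) ^ d)%N.
  have : (8 * m <= m ^ 4)%N by rewrite [(m ^ 4)%N]expnSr leq_mul2r (@leq_exp2r 2 m 3) // m2 orbT.
  by move=> h; apply: leq_trans (_ : ((8 * m) ^ d <= _)%N); rewrite leq_exp2r ?(leq_trans _ d2) //; lia.
have -> : (m ^ (6 * d) = m ^ d * (m ^ 4) ^ d * m ^ d)%N.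
  by rewrite -expnM -!expnD; congr expn; lia.
by rewrite leq_mul2r leq_mul // orbT.
Qed.

Definition phase (c : bool * bool) : R[i] :=
  if c.1 then (if c.2 then Complex 0 1 else Complex 0 (-1)) else (if c.2 then 1 else -1).

Lemma cabs_phase c : cabs (phase c) = 1.
Proof.
case: c => -[] [] //=; rewrite ?cabsN ?cabs1 // cabsE /= ?expr0n ?sqrrN ?expr1n ?add0r sqrtr1 //.
Qed.

(* Four real parts control the modulus: a complex Gaussian bound reduces to
   one-sided tails of real linear forms. *)
Lemma cabs_le_phases (z : R[i]) (tau : R) : (forall c, Re (phase c * z) < tau) -> cabs z <= 2 * tau.
Proof.
move=> h; apply: le_trans (cabs_le_ReIm z) _; rewrite mulr_natl mulr2n.
have := h (false, false); have := h (false, true); have := h (true, false); have := h (true, true).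
rewrite /phase /= !ReM /= !mul0r !mulN1r !mul1r !subr0 ?sub0r ?oppr0 ?mul0r ?subr0 => h1 h2 h3 h4.
by apply: lerD; apply: ltW; rewrite ltr_norml; lra.
Qed.

Variables (d m : nat) (g : 'rV[int]_d -> Om -> R[i]).
Hypotheses (d2 : (2 <= d)%N) (m2 : (2 <= m)%N).
Hypothesis iid : iid_standard_complex_normal P (fun (x : cube (2 * m) d) => g (cube_pt x)).

Lemma gaussian_dft (sg : 'rV[int]_d -> R) :
  with_probability_at_least P (1 - m%:R ^- d)
    (fun t => forall k : cube (2 * m) d, cabs (dft (fun x => rc (sg x) * g x t) k) <=
      2 * Num.sqrt (6 * d%:R) *
      (Num.sqrt (\sum_(x : cube (2 * m) d) sg (cube_pt x) ^+ 2) * Num.sqrt (ln m%:R))).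
Proof.
set V := \sum_x _; have mp : 0 < m%:R :> R by rewrite ltr0n; lia.
have V0 : 0 <= V by apply: sumr_ge0 => x _; rewrite sqr_ge0.
have lm : 0 < ln m%:R :> R by rewrite ln_gt0 // ltr1n.
have d6 : 0 < 6 * d%:R :> R by rewrite mulr_gt0 // ltr0n; lia.
move: V0; rewrite le_eqVlt => /orP[/eqP V0|Vp].
  exists setT; split=> // [|t _ k].
    by rewrite probability_setT lee_fin lerBlDr lerDl invr_ge0 exprn_ge0 // ltW.
  rewrite -V0 sqrtr0 mul0r mulr0 /dft big1 ?cabs0 // => w _.
  have -> : sg (cube_pt w) = 0.
    apply/eqP; rewrite -sqrf_eq0 eq_le sqr_ge0 andbT V0 /V (bigD1 w) //= lerDl.
    by apply: sumr_ge0 => x _; rewrite sqr_ge0.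
  by rewrite -/(0 : R[i]) !mul0r.
(* Chosen so that [expR (- (tau ^+ 2 / V))] is [m^-(6d)]. *)
pose tau := Num.sqrt (6 * d%:R * V * ln m%:R).
have tau2 : tau ^+ 2 = 6 * d%:R * V * ln m%:R.
  by rewrite sqr_sqrtr // mulr_ge0 ?mulr_ge0 // ltW.
have tau0 : 0 < tau by rewrite sqrtr_gt0; apply: mulr_gt0 => //; exact: mulr_gt0.
pose w (k x : cube (2 * m) d) : R[i] := cexp (- inner (freq R k) (cube_pt x)).
(* Coefficients of the real linear form [Re (phase * dft)]. As phase and character have modulus 1,
   their squares sum to [V] at every frequency. *)
pose a (j : cube (2 * m) d * (bool * bool)) (x : cube (2 * m) d) := sg (cube_pt x) * Re (phase j.2 * w j.1 x).
pose b (j : cube (2 * m) d * (bool * bool)) (x : cube (2 * m) d) := - (sg (cube_pt x) * Im (phase j.2 * w j.1 x)).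
have lin j t : Re (phase j.2 * dft (fun x => rc (sg x) * g x t) j.1) =
    linear_form (fun (x : cube (2 * m) d) => g (cube_pt x)) (a j) (b j) t.
  rewrite /dft mulr_sumr Re_sum; apply: eq_bigr => x _; rewrite -/(w j.1 x).
  rewrite (_ : _ * _ = rc (sg (cube_pt x)) * (phase j.2 * w j.1 x * g (cube_pt x) t)); last by ring.
  by rewrite Re_rcM ReM /a /b; ring.
have sq j : \sum_x (a j x ^+ 2 + b j x ^+ 2) <= V.
  apply: ler_sum => x _; rewrite /a /b sqrrN !exprMn -mulrDr -cabs2 cabsM cabs_phase /w cabs_cexp.
  by rewrite mulr1 expr1n mulr1.
pose A j := [set t | (tau <= linear_form (fun (x : cube (2 * m) d) => g (cube_pt x)) (a j) (b j) t)%R].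
have mA j : measurable (A j).
  have -> : A j = linear_form (fun (x : cube (2 * m) d) => g (cube_pt x)) (a j) (b j) @^-1` `[tau, +oo[%classic.
    by apply/seteqP; split=> t /=; rewrite in_itv /= andbT.
  by apply: measurable_preim => //; exact: measurable_linear_form iid _ _.
have [B [mB PB hB]] := union_bound mA (fun j => linear_form_tail iid Vp tau0 (sq j)).
exists B; split=> // [|t tB k].
  apply: le_trans PB; rewrite lee_fin lerD2l lerN2.
  have -> : tau ^+ 2 / V = (6 * d)%:R * ln m%:R.
    by rewrite tau2 natrM; field; rewrite gt_eqF.
  rewrite expRN expRM_natl lnK ?posrE // card_prod !card_prod card_bool card_ffun !card_ord.
  rewrite ler_pdivrMr ?exprn_gt0 // mulrC ler_pdivlMr ?exprn_gt0 // -!natrX -natrM ler_nat.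
  by apply: leq_trans (count_tests d2 m2); rewrite [(_ ^ d * _)%N]mulnC.
have -> : 2 * Num.sqrt (6 * d%:R) * (Num.sqrt V * Num.sqrt (ln m%:R)) = 2 * tau.
  by rewrite /tau !sqrtrM ?mulr_ge0 ?(ltW Vp) ?(ltW d6) //; ring.
apply: cabs_le_phases => c; rewrite (lin (k, c)) ltNge; apply/negP; exact: hB tB (k, c).
Qed.

End GaussianNoise.

(** With the iteration constants 8 and 9, an admissible number of iterations exists as soon as
    [ln c^-1 >= 1]. The bound [1/4] comes from [expR (- 1/2) >= 1/2]. *)
Lemma ln_inv_ge1 (R : realType) (c : R) : 0 < c -> c <= 1 / 4 -> 1 <= ln c^-1.
Proof.
move=> c0 c4; rewrite -ler_expR lnK ?posrE ?invr_gt0 // -[leLHS]invrK lef_pV2 ?posrE ?invr_gt0 ?expR_gt0 //.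
apply: le_trans c4 _; rewrite -expRN.
have -> : - 1 = 2%:R * - (1 / 2) :> R by lra.
rewrite expRM_natl; have := expR_ge1Dx (- (1 / 2) : R).
move: (expR _) => x hx; rewrite expr2; nra.
Qed.

Theorem theorem4p1 (R : realType) :
  exists h1 h2 cA nA1 nA2 nB1 nB2 : R,
  [/\ 0 < h1 < h2, 0 < cA, iteration_constants cA nA1 nA2 & 0 < nB1 < nB2] /\
  forall d : nat, (2 <= d)%N ->
  exists sep g1 g2 t1 t2 CA cB CB : R,
  [/\ 0 < sep, 0 < g1 < g2 & 0 < t1 < t2] /\
  [/\ 0 < CA, 0 < cB, iteration_constants cB nB1 nB2 & 0 < CB] /\
  forall (m s : nat) (a : 'I_s -> R[i]) (theta : 'I_s -> 'rV[R]_d),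
    (1 <= m)%N -> (1 <= s)%N ->
    (forall l, a l != 0) ->
    (forall l, 1 <= cabs (a l)) -> (exists l, cabs (a l) = 1) ->
    ((sep / m%:R)%:E <= separation theta)%E ->
  forall (G : {fset 'rV[R]_d}) (alpha1 h : R),
    g1 / m%:R <= mesh G <= g2 / m%:R ->
    t1 <= alpha1 <= t2 ->
    h1 / m%:R ^+ 2 <= h <= h2 / m%:R ^+ 2 ->
  (* adversarial noise *)
  (forall (p : \bar R) (eta : 'rV[int]_d -> R[i]),
    (1 <= p)%E ->
    let eps := lp_norm (2 * m) p eta in
    eps <= cA * (size_pow d m p / max_abs a) ->
    let H := hankel m (fun x => exp_sum a theta x + eta x) in
    sigma H s.+1 < sigma H s /\
    forall n : nat,
      0 < eps ->
      nA1 * ln (size_pow d m p / eps) <= n%:R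
        <= nA2 * ln (size_pow d m p / eps) ->
      forall out : seq 'rV[R]_d,
        gradient_music_output (music (leading_left_space H s)) G alpha1 h n
          out ->
        matches_within theta out (CA * (eps / (m%:R * size_pow d m p)))) /\
  (* random noise *)
  (forall (dO : measure_display) (Om : measurableType dO)
      (P : probability Om R) (g : 'rV[int]_d -> Om -> R[i])
      (sg : 'rV[R]_d -> R),
    iid_standard_complex_normal P
      (fun (x : cube (2 * m) d) => g (cube_pt x)) ->
    (forall x, 0 <= sg x) ->
    let sgC (x : 'rV[int]_d) : R[i] := Complex (sg (map_mx intr x)) 0 in
    let eps := lp_norm (2 * m) 2%:E sgC * Num.sqrt (ln m%:R) in
    eps * max_abs a <= cB * m%:R ^+ d ->
    let H (t : Om) :=
      hankel m (fun x => exp_sum a theta x + sgC x * g x t) in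
    with_probability_at_least P (1 - m%:R ^- d)
      (fun t => sigma (H t) s.+1 < sigma (H t) s) /\
    forall n : nat,
      0 < eps ->
      nB1 * ln (m%:R ^+ d / eps) <= n%:R <= nB2 * ln (m%:R ^+ d / eps) ->
      with_probability_at_least P (1 - m%:R ^- d)
        (fun t => sigma (H t) s.+1 < sigma (H t) s /\
          forall out : seq 'rV[R]_d,
            gradient_music_output (music (leading_left_space (H t) s))
              G alpha1 h n out ->
            matches_within theta out (CB * (eps / m%:R ^+ d.+1)))).
Proof.
pose sg : R := 1 / 1024; pose cA := sg / 256.
have sg0 : 0 < sg by rewrite /sg; lra.
have t12 : 0 < (sg / 2) ^+ 2 < sg ^+ 2.
  by move: sg sg0 {cA} => x x0; apply/andP; split; [apply: exprn_gt0; lra|nra].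
have cA0 : 0 < cA by rewrite /cA; lra.
have cA4 : cA <= 1 / 4 by rewrite /cA /sg; lra.
have it (c : R) : 0 < c -> c <= 1 / 4 -> iteration_constants c 8 9.
  by move=> c0 c4; split; [lra|lra|have := ln_inv_ge1 c0 c4; lra].
exists (1 / 128), (1 / 64), cA, 8, 9, 8, 9; split.
  split; [apply/andP; split; lra|by []|exact: it|apply/andP; split; lra].
move=> d d2; have d0 : (0 < d)%N by lia.
have [sep [g1 [g2 [[sep0 g10 g12] core]]]] := deterministic_core R d0.
pose K : R := 2 * Num.sqrt (6 * d%:R).
have K0 : 0 < K by rewrite mulr_gt0 // sqrtr_gt0 mulr_gt0 // ltr0n.
(* The second bound makes the Gaussian noise level [nu] at most [cA], the first provides the
   iteration constants. *)
pose cB := Num.min (1 / 4) (cA / K).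
have cB0 : 0 < cB by rewrite lt_min; apply/andP; split; [lra|exact: divr_gt0].
have cB4 : cB <= 1 / 4 by rewrite ge_min lexx.
have KcB : K * cB <= cA by rewrite mulrC -ler_pdivlMr // ge_min lexx orbT.
(* Both error constants add 1 for the contracted initial error and 16 for the noise floor [16 nu];
   in the random case [nu] carries the factor [K]. *)
exists sep, g1, g2, ((sg / 2) ^+ 2), (sg ^+ 2), 17, cB, (1 + 16 * K).
split; first by split; [exact: sep0|apply/andP|exact: t12].
split; first by split; [lra|exact: cB0|exact: it|lra].
move=> m s a theta m1 s1 _ a1 hmax hsep G alpha1 h hmesh halpha hh.
have mp : 0 < m%:R :> R by rewrite ltr0n.
have amax := max_abs_ge1 hmax.
split.
  move=> p eta p1 eps heps H.
  have sp0 : 0 < size_pow d m p by exact: size_pow_gt0.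
  set u := eps / size_pow d m p.
  have eps0 : 0 <= eps by exact: lp_norm_ge0.
  have u0 : 0 <= u by rewrite divr_ge0 // ltW.
  have uc : u <= cA.
    rewrite ler_pdivrMr //; apply: le_trans heps _; apply: ler_wpM2l; first exact: ltW.
    rewrite ler_pdivrMr; last exact: lt_le_trans amax.
    by rewrite ler_peMr // ltW.
  have [gap out_ok] := core m s a theta m1 s1 a1 hsep eta u u0 uc (adversarial_bound eta m1 p1).
  split=> // n epsp /andP[hn _] out hout.
  have [sz [tau ht]] := out_ok G alpha1 h hmesh halpha hh n out hout.
  split=> //; exists tau => l; apply: le_trans (ht l) _.
  have un : (7 / 8) ^+ n <= u.
    by apply: contraction_power; [rewrite divr_gt0|rewrite invf_div].
  have -> : 17 * (eps / (m%:R * size_pow d m p)) = (u + 16 * u) / m%:R.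
    by rewrite /u invfM; ring.
  by rewrite ler_pM2r ?invr_gt0 // lerD2r.
move=> dO Om P g sigm iid sg_ge0 sgC eps heps H.
have epsE : eps = Num.sqrt (\sum_(x : cube (2 * m) d) sigm (map_mx intr (cube_pt x)) ^+ 2) * Num.sqrt (ln m%:R).
  rewrite /eps lp_norm2; congr (Num.sqrt _ * _); apply: eq_bigr => x _.
  by rewrite cabs_rc real_normK ?num_real.
have eps0 : 0 <= eps by rewrite epsE mulr_ge0 ?sqrtr_ge0.
pose good t := forall k : cube (2 * m) d, cabs (dft (fun x => sgC x * g x t) k) <= K * eps.
have likely : with_probability_at_least P (1 - m%:R ^- d) good.
  have [m2|m1'] := leqP 2 m.
    have := gaussian_dft d2 m2 iid (fun x => sigm (map_mx intr x)).
    by rewrite -/K -epsE.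
  have -> : m%:R = 1 :> R by rewrite (_ : m = 1%N) //; apply/eqP; rewrite eqn_leq m1 andbT -ltnS.
  (* For [m = 1] the required probability is [0]. *)
  by rewrite expr1n invr1 subrr; exact: with_probability_0.
(* The Fourier bound [K * eps] relative to [m^d], which is at most the size [(2m+1)^d] of the
   cube. *)
pose nu := K * (eps / m%:R ^+ d).
have nu0 : 0 <= nu by rewrite mulr_ge0 ?divr_ge0 // ?exprn_ge0 // ltW.
have nuc : nu <= cA.
  apply: le_trans KcB; rewrite ler_pM2l // ler_pdivrMr ?exprn_gt0 //.
  by apply: le_trans heps; rewrite ler_peMr.
have goodP t : good t -> forall z, nrm (z *m hankel m (fun x => sgC x * g x t)) <= nu * (2 * m).+1%:R ^+ d * nrm z.
  move=> gt z; apply: le_trans (hankel_dft_bound gt z) _; apply: ler_wpM2r; first exact: nrm_ge0.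
  rewrite /nu -mulrA; apply: ler_wpM2l; first exact: ltW.
  rewrite -[leLHS]mulr1 -mulrA; apply: ler_wpM2l => //.
  rewrite mulrC ler_pdivlMr ?exprn_gt0 // mul1r.
  by apply: lerXn2r; rewrite ?nnegrE // ler_nat; exact: leq_trans (@leq_pmull m 2 isT) (leqnSn _).
split.
  apply: with_probability_mono likely => t /goodP nt.
  exact: (core m s a theta m1 s1 a1 hsep _ nu nu0 nuc nt).1.
move=> n epsp /andP[hn _]; apply: with_probability_mono likely => t /goodP nt.
have [gap out_ok] := core m s a theta m1 s1 a1 hsep _ nu nu0 nuc nt.
split=> // out hout.
have [sz [tau ht]] := out_ok G alpha1 h hmesh halpha hh n out hout.
split=> //; exists tau => l; apply: le_trans (ht l) _.
have un : (7 / 8) ^+ n <= eps / m%:R ^+ d.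
  by apply: contraction_power; [rewrite divr_gt0 ?exprn_gt0|rewrite invf_div].
have -> : (1 + 16 * K) * (eps / m%:R ^+ d.+1) = (eps / m%:R ^+ d + 16 * nu) / m%:R.
  by rewrite /nu exprS invfM; ring.
by rewrite ler_pM2r ?invr_gt0 // lerD2r.
Qed.
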